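(* Let $\mathcal{D}_+$ and $\mathcal{D}_-$ be the closures in $L^2(\mathbb{D})$ of the operators $e^{i\theta}(\partial_r+ir^{-1}\partial_\theta)$ and $e^{-i\theta}(-\partial_r+ir^{-1}\partial_\theta)$ on $C_c^\infty(\mathring{\mathbb{D}})$, so that $\mathcal{D}=\begin{pmatrix}0&\mathcal{D}_-\\ \mathcal{D}_+&0\end{pmatrix}$ is the minimal closed extension of the Dirac operator on the open unit disc. Then the self-adjoint extension $$\mathcal{D}_{ext}:=\begin{pmatrix}0&\mathcal{D}_+^*\\ \mathcal{D}_+&0\end{pmatrix}$$ of $\mathcal{D}$ has infinite-dimensional kernel, so its resolvent is not compact. Consequently $(C^\infty(\mathbb{D}),L^2(\mathbb{D},\mathbb{C}^2),\mathcal{D}_{ext})$ is not a spectral triple; moreover, with $F_{\mathcal{D}_{ext}}:=\mathcal{D}_{ext}(1+\mathcal{D}_{ext}^2)^{-1/2}$, the operator $1-F_{\mathcal{D}_{ext}}^2$ is not compact, so $(C(\mathbb{D}),L^2(\mathbb{D},\mathbb{C}^2),F_{\mathcal{D}_{ext}})$ is not a Fredholm module.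
   Context: $\mathbb{D}$ is the closed unit disc in $\mathbb{R}^2$ with polar coordinates $(r,\theta)$, $\mathring{\mathbb{D}}$ its interior, and $L^2$ spaces on $\mathbb{D}$ are taken with respect to the measure $\frac{1}{2\pi}r\,dr\,d\theta$. Functions on $\mathbb{D}$ act on $L^2(\mathbb{D},\mathbb{C}^2)$ by multiplication on each component. A spectral triple $(\mathcal{A},\mathcal{H},\mathcal{D})$ consists of a Hilbert space $\mathcal{H}$, a $*$-subalgebra $\mathcal{A}$ of the bounded operators on $\mathcal{H}$, and a densely defined self-adjoint operator $\mathcal{D}$ such that for all $a\in\mathcal{A}$: $a\cdot\mathrm{dom}\,\mathcal{D}\subset\mathrm{dom}\,\mathcal{D}$ and $[\mathcal{D},a]$ is bounded on $\mathrm{dom}\,\mathcal{D}$; and $a(1+\mathcal{D}^2)^{-1/2}$ is compact. A Fredholm module $(A,\mathcal{H},F)$ consists of an algebra $A$ of bounded operators on $\mathcal{H}$ and a bounded operator $F$ on $\mathcal{H}$ such that $a(F-F^* )$, $a(1-F^2)$ and $[F,a]$ are compact for all $a\in A$. *)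

(* Defs.v *)
(* Mathematical Components, with MathComp-Analysis. *)
From HB Require Import structures.
From mathcomp Require Import all_boot all_order all_algebra.
From mathcomp Require Import all_classical all_reals all_analysis.
From mathcomp Require Import measurable_realfun.
From mathcomp Require Import complex.
From mathcomp Require Import ring lra.
Set Implicit Arguments.
Unset Strict Implicit.
Unset Printing Implicit Defensive.
Import Order.TTheory GRing.Theory Num.Theory.
Import numFieldNormedType.Exports.
Local Open Scope quotient_scope.
Local Open Scope classical_set_scope.
Local Open Scope complex_scope.
Local Open Scope ring_scope.

(* The inner product is linear in its first argument. *)
HB.mixin Record NormedModule_isHilbert (R : realType) H
    & CompleteNormedModule R[i] H := {
  inner : H -> H -> R[i];
  innerP : forall a (x y z : H),
    inner (a *: x + y) z = a * inner x z + inner y z;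
  innerC : forall x y : H, inner y x = (inner x y)^*;
  normr_inner : forall x : H, `|x| ^+ 2 = inner x x
}.

#[short(type="hilbertType")]
HB.structure Definition Hilbert (R : realType) :=
  {H of CompleteNormedModule R[i] H & NormedModule_isHilbert R H}.

(* A Hilbert space from a complete inner product on a plain module: the norm
   and the topology are derived from the inner product. *)
HB.factory Record Lmodule_isHilbert (R : realType) H & GRing.Lmodule R[i] H := {
  inner : H -> H -> R[i];
  innerP : forall a (x y z : H),
    inner (a *: x + y) z = a * inner x z + inner y z;
  innerC : forall x y : H, inner y x = (inner x y)^*;
  inner_ge0 : forall x : H, 0 <= inner x x;
  inner_eq0 : forall x : H, inner x x = 0 -> x = 0;
  inner_complete : forall u : nat -> H,
    (forall e : R, 0 < e -> exists N, forall m n, (N <= m)%N -> (N <= n)%N ->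
       inner (u m - u n) (u m - u n) < e%:C) ->
    exists l, forall e : R, 0 < e -> exists N, forall n, (N <= n)%N ->
       inner (u n - l) (u n - l) < e%:C
}.

HB.builders Context R H & Lmodule_isHilbert R H.

Let innerDl (x y z : H) : inner (x + y) z = inner x z + inner y z.
Proof. by rewrite -[x]scale1r innerP mul1r scale1r. Qed.

Let inner0l (z : H) : inner 0 z = 0.
Proof. by apply: (addrI (inner 0 z)); rewrite -innerDl !addr0. Qed.

Let innerZl a (x z : H) : inner (a *: x) z = a * inner x z.
Proof. by rewrite -[a *: x]addr0 innerP inner0l addr0. Qed.

Let innerZr a (x z : H) : inner x (a *: z) = a^* * inner x z.
Proof. by rewrite innerC innerZl rmorphM/= -innerC. Qed.

Let innerDr (x y z : H) : inner x (y + z) = inner x y + inner x z.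
Proof. by rewrite innerC innerDl rmorphD/= -!innerC. Qed.

Let nrm (x : H) : R[i] := (Num.sqrt (complex.Re (inner x x)))%:C.

Let ReE (x : H) : inner x x = (complex.Re (inner x x))%:C.
Proof. by case: (inner x x) (ger0_Im (inner_ge0 x)) => a b /= ->. Qed.

Let Re_ge0 (x : H) : 0 <= complex.Re (inner x x).
Proof. by rewrite -ler0c -ReE inner_ge0. Qed.

Let nrm_ge0 x : 0 <= nrm x.
Proof. by rewrite /nrm ler0c sqrtr_ge0. Qed.

Let nrm_sqr (x : H) : nrm x ^+ 2 = inner x x.
Proof. by rewrite /nrm -rmorphXn/= sqr_sqrtr// -ReE. Qed.

Let nrmZ a (x : H) : nrm (a *: x) = `|a| * nrm x.
Proof.
apply/eqP; rewrite -(@eqrXn2 _ 2)// ?mulr_ge0//.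
by rewrite exprMn !nrm_sqr innerZl innerZr mulrA normCK.
Qed.

Let nrm0_eq0 (x : H) : nrm x = 0 -> x = 0.
Proof. by move=> x0; apply: inner_eq0; rewrite -nrm_sqr x0 expr0n. Qed.

Let CS (x y : H) : inner x y * (inner x y)^* <= inner x x * inner y y.
Proof.
have [y0|y0] := eqVneq (inner y y) 0.
  have -> : y = 0 by exact: inner_eq0.
  by rewrite (innerC 0 x) !inner0l !rmorph0 !mulr0 ?mul0r lexx.
have yp : 0 < inner y y by rewrite lt_def y0 inner_ge0.
have := inner_ge0 (inner y y *: x - inner x y *: y).
rewrite -scaleNr innerDl !innerDr !innerZl !innerZr.
have yyc : (inner y y)^* = inner y y by rewrite -innerC.
rewrite yyc rmorphN (innerC x y).
set a := inner x x; set b := inner y y; set c := inner x y.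
have -> : b * (b * a) + b * (- c^* * c) + (- c * (b * c^*) + - c * (- c^* * b)) =
  b * (a * b - c * c^*) by ring.
by rewrite pmulr_rge0// subr_ge0.
Qed.

Let ler_nrmD (x y : H) : nrm (x + y) <= nrm x + nrm y.
Proof.
rewrite -(@ler_pXn2r _ 2)// ?nnegrE ?addr_ge0//.
rewrite sqrrD !nrm_sqr innerDl !innerDr (innerC x y).
have -> : inner x x + inner x y + ((inner x y)^* + inner y y) =
  inner x x + (inner x y + (inner x y)^*) + inner y y by ring.
rewrite lerD2r lerD2l (addcJ (inner x y)) mulr_natl.
rewrite lerMn2r/=.
apply: (@le_trans _ _ `|inner x y|).
  by apply: le_trans (normc_ge_Re _); rewrite lecR ler_norm.
rewrite -(@ler_pXn2r _ 2)// ?nnegrE ?mulr_ge0//.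
by rewrite exprMn !nrm_sqr normCK CS.
Qed.

HB.instance Definition _ := @Lmodule_isNormed.Build R[i] H nrm ler_nrmD nrmZ nrm0_eq0.

Let normE (x : H) : `|x| = nrm x. Proof. by []. Qed.

Let complete (F : set_system H) : ProperFilter F -> cauchy F -> cvg F.
Proof.
move=> FF /cauchyP Fc.
have epsP n : 0 < (n.+1%:R^-1)%:C :> R[i] by rewrite ltcR invr_gt0.
have /choice[c Fc_] n := Fc _ (epsP n).
have FB n : F (ball (c n) (n.+1%:R^-1)%:C) by exact: Fc_.
have key m n : nrm (c m - c n) < (m.+1%:R^-1 + n.+1%:R^-1)%:C.
  have [z [zm zn]] := filter_ex (filterI (FB m) (FB n)).
  move: zm zn; rewrite -!ball_normE/= => zm zn.
  rewrite -(subrK z (c m)) -addrA -normE (le_lt_trans (ler_normD _ _))//.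
  by rewrite rmorphD/= ltrD// distrC.
have small (e : R) : 0 < e -> exists N, forall n, (N <= n)%N -> n.+1%:R^-1 < e.
  move=> e0; have [N _ HN] := near_infty_natSinv_lt (PosNum e0).
  by exists N => n Nn; apply: HN.
have sq (x : H) (e : R) : 0 < e -> nrm x < e%:C <-> inner x x < (e ^+ 2)%:C.
  move=> e0; rewrite -nrm_sqr rmorphXn/= ltr_pXn2r// nnegrE ?nrm_ge0//.
  by rewrite ler0c ltW.
have [|l Hl] := @inner_complete c.
  move=> e e0.
  have se : 0 < Num.sqrt e by rewrite sqrtr_gt0.
  have [N HN] := small (Num.sqrt e / 2) (divr_gt0 se (ltr0Sn _ _)).
  exists N => m n Nm Nn.
  rewrite -[e]sqr_sqrtr ?ltW//; apply/sq => //.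
  apply: (lt_trans (key m n)); rewrite ltcR.
  by rewrite [ltRHS]splitr ltrD// HN.
apply/cvg_ex; exists l; apply/cvg_ballP => e e0.
have eE : e = (complex.Re e)%:C by rewrite RRe_real// gtr0_real.
have re0 : 0 < complex.Re e / 2 by rewrite divr_gt0// -ltcR -eE.
have [N1 H1] := small _ re0.
have [|N2 H2] := Hl ((complex.Re e / 2) ^+ 2); first by rewrite exprn_gt0.
set N := maxn N1 N2.
apply: filterS (FB N) => z; rewrite -!ball_normE/= => zN.
rewrite distrC -(subrK (c N) z) -addrA (le_lt_trans (ler_normD _ _))//.
rewrite eE (splitr (complex.Re e)) rmorphD/= ltrD//.
  rewrite distrC (lt_trans zN)// ltcR H1// leq_maxl//.
by rewrite normE; apply/sq => //; apply: H2; rewrite leq_maxr.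
Unshelve. all: by [].
Qed.

HB.instance Definition _ := Uniform_isComplete.Build H complete.

HB.instance Definition _ := NormedModule_isHilbert.Build R H innerP innerC nrm_sqr.

HB.end.

Section DirectSum.
Context (R : realType) (H1 H2 : hilbertType R).

(* An alias of the product: H1 * H2 itself carries the maximum norm, which does
   not come from an inner product. *)
Definition hsum : Type := (H1 * H2)%type.

HB.instance Definition _ := GRing.Lmodule.copy hsum (H1 * H2)%type.

Definition hsum_inner (x y : hsum) : R[i] := inner x.1 y.1 + inner x.2 y.2.

Lemma sum_innerP a (x y z : hsum) :
  hsum_inner (a *: x + y) z = a * hsum_inner x z + hsum_inner y z.
Proof. by rewrite /hsum_inner/= !innerP mulrDr addrACA. Qed.

Lemma sum_innerC (x y : hsum) : hsum_inner y x = (hsum_inner x y)^*.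
Proof. by rewrite /hsum_inner rmorphD/= -!innerC. Qed.

Lemma sum_inner_ge0 (x : hsum) : 0 <= hsum_inner x x.
Proof. by rewrite addr_ge0// -normr_inner exprn_ge0. Qed.

Lemma sum_inner_eq0 (x : hsum) : hsum_inner x x = 0 -> x = 0.
Proof.
case: x => x1 x2; rewrite /hsum_inner/= -!normr_inner => /eqP.
by rewrite paddr_eq0 ?exprn_ge0// !sqrf_eq0 !normr_eq0 => /andP[/eqP-> /eqP->].
Qed.

Lemma hilbert_cauchy_seq (H : hilbertType R) (u : nat -> H) :
  (forall e : R, 0 < e -> exists N, forall m n, (N <= m)%N -> (N <= n)%N ->
     `|u m - u n| ^+ 2 < e%:C) ->
  exists l, forall e : R, 0 < e -> exists N, forall n, (N <= n)%N ->
    `|u n - l| ^+ 2 < e%:C.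
Proof.
move=> uc.
have sq (x : H) (e : R) : 0 < e -> (`|x| < e%:C) = (`|x| ^+ 2 < (e ^+ 2)%:C).
  by move=> e0; rewrite rmorphXn/= ltr_pXn2r// nnegrE// ler0c ltW.
have : cauchy (u @ \oo).
  apply/cauchyP => e e0.
  have eE : e = (complex.Re e)%:C by rewrite RRe_real// gtr0_real.
  have re0 : 0 < complex.Re e by rewrite -ltcR -eE.
  have [|N HN] := uc (complex.Re e ^+ 2); first by rewrite exprn_gt0.
  exists (u N), N => // n /= Nn; rewrite -ball_normE/= eE sq//.
  exact: HN.
move=> /cauchy_cvg/cvg_ex[l /cvg_ballP ul]; exists l => e e0.
have se : 0 < Num.sqrt e by rewrite sqrtr_gt0.
have [|N _ HN] := ul (Num.sqrt e)%:C; first by rewrite ltcR.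
exists N => n Nn; have := HN n Nn; rewrite -ball_normE/= distrC sq//.
by rewrite sqr_sqrtr// ltW.
Qed.

Lemma sum_inner_complete (u : nat -> hsum) :
  (forall e : R, 0 < e -> exists N, forall m n, (N <= m)%N -> (N <= n)%N ->
     hsum_inner (u m - u n) (u m - u n) < e%:C) ->
  exists l, forall e : R, 0 < e -> exists N, forall n, (N <= n)%N ->
     hsum_inner (u n - l) (u n - l) < e%:C.
Proof.
move=> uc.
have [|l1 Hl1] := @hilbert_cauchy_seq H1 (fun n => (u n).1).
  move=> e /uc[N HN]; exists N => m n Nm Nn; apply: le_lt_trans (HN m n Nm Nn).
  by rewrite /hsum_inner -!normr_inner lerDl exprn_ge0.
have [|l2 Hl2] := @hilbert_cauchy_seq H2 (fun n => (u n).2).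
  move=> e /uc[N HN]; exists N => m n Nm Nn; apply: le_lt_trans (HN m n Nm Nn).
  by rewrite /hsum_inner -!normr_inner lerDr exprn_ge0.
exists (l1, l2) => e e0; have e20 : 0 < e / 2 by rewrite divr_gt0.
have [N1 HN1] := Hl1 _ e20; have [N2 HN2] := Hl2 _ e20.
exists (maxn N1 N2) => n; rewrite geq_max => /andP[n1 n2].
rewrite (splitr e) rmorphD/= /hsum_inner -!normr_inner.
by rewrite ltrD//; [exact: HN1|exact: HN2].
Qed.

HB.instance Definition _ := Lmodule_isHilbert.Build R hsum
  sum_innerP sum_innerC sum_inner_ge0 sum_inner_eq0 sum_inner_complete.

End DirectSum.
Section RieszFischer.
Context d (T : measurableType d) (R : realType) (mu : {measure set T -> \bar R}).

Lemma Lfun2P (f : T -> R) : reflect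
  (measurable_fun setT f /\ (\int[mu]_x (f x ^+ 2)%:E < +oo)%E)
  (f \in Lfun mu 2%:E).
Proof.
apply: (iffP idP) => [f2|[mf f2]].
  split; first by move: f2; rewrite inE => /andP[/[!inE]].
  exact: integrable_lty (Lfun2_integrable_sqr f2).
rewrite inE; apply/andP; split; rewrite inE//= /finite_norm unlock /=.
rewrite poweR_lty// (le_lt_trans _ f2)//.
rewrite le_eqVlt; apply/orP; left; apply/eqP; apply: eq_integral => x _.
by rewrite powR_mulrn// -normrX ger0_norm// sqr_ge0.
Qed.

Lemma Lfun2_ae_cauchy (a : nat -> T -> R) :
  (forall k, measurable_fun setT (a k)) ->
  (forall k, (\int[mu]_x ((a k.+1 x - a k x) ^+ 2)%:E <= (8^-1 ^+ k)%:E)%E) ->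
  {ae mu, forall x, cvgn (a ^~ x)}.
Proof.
move=> ma a8.
pose g k x : \bar R := (4 ^+ k * (a k.+1 x - a k x) ^+ 2)%:E.
have mg k : measurable_fun setT (g k).
  apply/measurable_EFinP/measurable_funM => //.
  exact/measurable_funX/measurable_funB.
have g0 k x : (0 <= g k x)%E by rewrite lee_fin mulr_ge0// sqr_ge0.
pose S x : \bar R := (\sum_(k <oo) g k x)%E.
have mS : measurable_fun setT S by exact: ge0_emeasurable_sum.
have S0 x : (0 <= S x)%E by exact: nneseries_ge0.
have intS : (\int[mu]_x S x < +oo)%E.
  rewrite integral_nneseries//.
  apply: (@le_lt_trans _ _ 2%:E); last by rewrite ltry.
  apply: le_trans (@epsilon_trick0 R 2 xpredT _) => //.
  apply: lee_nneseries => k _; first by rewrite integral_ge0.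
  under eq_integral do rewrite /g EFinM.
  rewrite ge0_integralZl//; last first.
  - by move=> x _; rewrite lee_fin sqr_ge0.
  - by apply/measurable_EFinP/measurable_funX/measurable_funB.
  rewrite (@le_trans _ _ ((4 ^+ k)%:E * (8^-1 ^+ k)%:E)%E)//.
    by rewrite lee_wpmul2l// lee_fin.
  rewrite -EFinM lee_fin -exprMn natrX exprS.
  rewrite invfM mulrA divff// mul1r.
  by rewrite (_ : 4 * 8^-1 = 2^-1) ?exprVn//; lra.
have iS : mu.-integrable setT S.
  apply/integrableP; split=> //.
  by under eq_integral do rewrite gee0_abs//.
have := integrable_ae measurableT iS.
apply: filterS => x /(_ I) Sfin.
pose s := fine (S x).
have gs k : 4 ^+ k * (a k.+1 x - a k x) ^+ 2 <= s.
  rewrite -lee_fin fineK//.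
  apply: le_trans (nneseries_lim_ge k.+1 _) => //.
  by rewrite big_nat_recr//= leeDr// sume_ge0.
have hs k : `|a k.+1 x - a k x| <= Num.sqrt s * 2^-1 ^+ k.
  have s0 : 0 <= s by rewrite fine_ge0.
  rewrite -(@ler_pXn2r _ 2)// ?nnegrE ?mulr_ge0// ?exprn_ge0// ?sqrtr_ge0//.
  rewrite exprMn sqr_sqrtr// -normrX ger0_norm ?sqr_ge0// exprAC.
  rewrite (_ : 2^-1 ^+ 2 = 4^-1 :> R); last by lra.
  by rewrite exprVn ler_pdivlMr ?exprn_gt0// mulrC.
pose u k := a k.+1 x - a k x.
have us : cvgn (series u).
  apply: normed_cvg; apply: series_le_cvg hs _ => //.
  apply: is_cvg_geometric_series.
  by rewrite ger0_norm// invf_lt1// ltr1n.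
have -> : a ^~ x = (fun n => series u n + a 0%N x).
  apply/funext => n; rewrite /series/= telescope_sumr//.
  by rewrite subrK.
by apply: is_cvgD => //; exact: is_cvg_cst.
Qed.

(* Riesz-Fischer, for real-valued functions *)
Lemma Lfun2_complete (u : nat -> T -> R) :
  (forall n, u n \in Lfun mu 2%:E) ->
  (forall e : R, 0 < e -> exists N, forall m n, (N <= m)%N -> (N <= n)%N ->
     (\int[mu]_x ((u m x - u n x) ^+ 2)%:E < e%:E)%E) ->
  exists2 f, f \in Lfun mu 2%:E &
    forall e : R, 0 < e -> exists N, forall n, (N <= n)%N ->
     (\int[mu]_x ((u n x - f x) ^+ 2)%:E < e%:E)%E.
Proof.
move=> uL uc.
have mu_ n : measurable_fun setT (u n) by have /Lfun2P[] := uL n.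
have h8 k : 0 < 8^-1 ^+ k :> R by rewrite exprn_gt0// invr_gt0.
have /choice[N HN] k := uc (8^-1 ^+ k) (h8 k).
pose M k := maxn k (\max_(i < k.+1) N i).
have MN k j : (k <= j)%N -> (N k <= M j)%N.
  move=> kj; rewrite leq_max; apply/orP; right.
  have kj1 : (k < j.+1)%N by [].
  exact: (leq_bigmax (Ordinal kj1)).
pose a k := u (M k).
have ma k : measurable_fun setT (a k) by exact: mu_.
have aae := Lfun2_ae_cauchy ma (fun k => ltW (HN k _ _ (MN k k.+1 (leqnSn k)) (MN k k (leqnn k)))).
pose f x := fine (limn_esup (fun k => (a k x)%:E)).
have mf : measurable_fun setT f.
  apply: measurableT_comp => //.
  apply: measurable_fun_limn_esup => k; exact/measurable_EFinP.
have fae : {ae mu, forall x, (a ^~ x) @ \oo --> f x}.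
  apply: filterS aae => x ax.
  have : (a k x)%:E @[k --> \oo] --> (limn (a ^~ x))%:E.
    by apply: cvg_EFin => //; exact: nearW.
  by move=> /cvg_limn_einf_sup[_]; rewrite /f => ->.
have key n (e : R) : (exists K, forall k, (K <= k)%N ->
    (\int[mu]_x ((u n x - a k x) ^+ 2)%:E <= e%:E)%E) ->
    (\int[mu]_x ((u n x - f x) ^+ 2)%:E <= e%:E)%E.
  move=> [K HK].
  pose v k x : \bar R := ((u n x - a (k + K)%N x) ^+ 2)%:E.
  have mv k : measurable_fun setT (v k).
    by apply/measurable_EFinP/measurable_funX/measurable_funB.
  have v0 k x : (0 <= v k x)%E by rewrite lee_fin sqr_ge0.
  have -> : (\int[mu]_x ((u n x - f x) ^+ 2)%:E = \int[mu]_x limn_einf (v ^~ x))%E.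
    apply: ae_eq_integral => //.
  - by apply/measurable_EFinP/measurable_funX/measurable_funB.
  - apply: (eq_measurable_fun (fun x => - limn_esup (fun k => - v k x))%E) => //.
    apply: measurableT_comp => //.
    by apply: measurable_fun_limn_esup => k; apply: measurableT_comp.
  - apply: filterS fae => x ax _.
    apply/esym; apply: (cvg_limn_einf_sup _).1.
    apply: cvg_EFin; first exact: nearW.
    rewrite /v/= ; under eq_fun do rewrite expr2.
    rewrite expr2; have : (u n x - a (k + K)%N x) @[k --> \oo] --> u n x - f x.
      apply: cvgB; first exact: cvg_cst.
      by rewrite (cvg_shiftn K (a ^~ x)).
    by move=> H; exact: cvgM.
  apply: le_trans (fatou mu measurableT mv _) _ => //.
  rewrite limn_einf_lim; apply: lime_le; first exact: is_cvg_einfs.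
  apply: nearW => m; apply: (@le_trans _ _ (\int[mu]_x v m x)%E).
    by apply: ereal_inf_lbound; exists m => /=.
  by apply: HK; rewrite leq_addl.
have fc (e : R) : 0 < e -> exists N, forall n, (N <= n)%N ->
     (\int[mu]_x ((u n x - f x) ^+ 2)%:E < e%:E)%E.
  move=> e0; have e20 : 0 < e / 2 by rewrite divr_gt0.
  have [K HK] := uc _ e20; exists K => n Kn.
  apply: (@le_lt_trans _ _ (e / 2)%:E); last by rewrite lte_fin; lra.
  apply: key; exists K => k Kk; apply/ltW/HK => //.
  by rewrite (leq_trans Kk)// leq_maxl.
exists f => //.
have [n0 /(_ _ (leqnn _)) Hn0] := fc 1 ltr01.
have -> : f = u n0 \+ (fun x => f x - u n0 x).
  by apply/funext => x /=; rewrite addrC subrK.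
apply: (Lfun_addr_closed mu (lee1n 2)).2 => //.
apply/Lfun2P; split; first exact: measurable_funB.
apply: lt_trans (ltry 1); apply: le_lt_trans Hn0.
by rewrite le_eqVlt; apply/orP; left; apply/eqP/eq_integral => x _; rewrite -sqrrN opprB.
Qed.
End RieszFischer.

Section L2.
Context d (T : measurableType d) (R : realType) (mu : {measure set T -> \bar R}).

(* f is measurable and |f|^2 = (Re f)^2 + (Im f)^2 is integrable. *)
Definition L2fun : {pred T -> R[i]} := [pred f : T -> R[i] |
  (@complex.Re R \o f \in Lfun mu 2%:E) && (@complex.Im R \o f \in Lfun mu 2%:E)].

Lemma Lfun2D (f g : T -> R) : f \in Lfun mu 2%:E -> g \in Lfun mu 2%:E ->
  f \+ g \in Lfun mu 2%:E.
Proof. by move=> fL gL; exact: (Lfun_addr_closed mu (lee1n 2)).2. Qed.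

Lemma Lfun2Z (f : T -> R) a : f \in Lfun mu 2%:E ->
  (fun x => a * f x) \in Lfun mu 2%:E.
Proof.
move=> fL; have -> : (fun x => a * f x) = a \o* f.
  by apply/funext => x /=; rewrite mulrC.
by apply: Lfun_scale => //; rewrite ler1n.
Qed.

Lemma L2fun_submod_closed : submod_closed L2fun.
Proof.
split.
  have L0 : (fun=> 0) \in Lfun mu 2%:E.
    exact: (Lfun_addr_closed mu (lee1n 2)).1.
  by apply/andP; split; exact: L0.
move=> a f g /andP[f1 f2] /andP[g1 g2]; apply/andP; split.
- rewrite (_ : _ \o _ = (fun x => complex.Re a * complex.Re (f x)) \+
    (fun x => - complex.Im a * complex.Im (f x)) \+ (@complex.Re R \o g)).
    by rewrite !Lfun2D// Lfun2Z.
  apply/funext => x; rewrite /= -[(a *: f + g) x]/(a * f x + g x).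
  case: a => a b; case: (f x) => u v; case: (g x) => s t.
  by rewrite /= mulNr.
- rewrite (_ : _ \o _ = (fun x => complex.Re a * complex.Im (f x)) \+
    (fun x => complex.Im a * complex.Re (f x)) \+ (@complex.Im R \o g)).
    by rewrite !Lfun2D// Lfun2Z.
  apply/funext => x; rewrite /= -[(a *: f + g) x]/(a * f x + g x).
  case: a => a b; case: (f x) => u v; case: (g x) => s t.
  by [].
Qed.

HB.instance Definition _ := GRing.isSubmodClosed.Build _ _ L2fun
  L2fun_submod_closed.

Record sqint := SqInt { sqint_fun :> T -> R[i]; _ : sqint_fun \in L2fun }.

HB.instance Definition _ := [isSub for sqint_fun].
HB.instance Definition _ := [Choice of sqint by <:].
HB.instance Definition _ := [SubChoice_isSubLmodule of sqint by <:].

Definition sqint_ae_eq (f g : sqint) := `[< {ae mu, forall x, f x = g x} >].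

Lemma sqint_ae_refl : reflexive sqint_ae_eq.
Proof. by move=> f; apply/asboolP; exact: aeW. Qed.

Lemma sqint_ae_sym : symmetric sqint_ae_eq.
Proof.
by move=> f g; apply/asboolP/asboolP; apply: filterS => x ->.
Qed.

Lemma sqint_ae_trans : transitive sqint_ae_eq.
Proof.
move=> g f h /asboolP fg /asboolP gh; apply/asboolP.
by apply: filterS2 fg gh => x -> ->.
Qed.

Canonical sqint_ae_eq_equiv := EquivRel sqint_ae_eq sqint_ae_refl sqint_ae_sym sqint_ae_trans.

Definition L2 : Type := {eq_quot sqint_ae_eq}.
HB.instance Definition _ := Choice.on L2.
HB.instance Definition _ := EqQuotient.on L2.

(* An element of L2 is an almost everywhere class; as a function it stands for
   a chosen representative, so that pointwise formulas about it are to be read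
   almost everywhere. *)
Definition L2_fun (x : L2) : T -> R[i] := repr x.
Coercion L2_fun : L2 >-> Funclass.

Lemma L2_eqP (x y : L2) : {ae mu, forall t, x t = y t} <-> x = y.
Proof.
split=> [xy|->]; last exact: aeW.
by rewrite -[x]reprK -[y]reprK; apply/eqmodP/asboolP.
Qed.

Lemma L2_piE (f : sqint) : {ae mu, forall t, (\pi_L2 f : L2) t = f t}.
Proof.
have : \pi_L2 (repr (\pi_L2 f)) = \pi_L2 f by rewrite reprK.
by move=> /eqmodP/asboolP.
Qed.

Lemma L2_inP (x : L2) : (x : T -> R[i]) \in L2fun.
Proof. by rewrite /L2_fun; case: (repr x). Qed.

Definition L2add (x y : L2) : L2 := \pi_L2 (repr x + repr y).
Definition L2opp (x : L2) : L2 := \pi_L2 (- repr x).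
Definition L2zero : L2 := \pi_L2 (0 : sqint).
Definition L2scale (a : R[i]) (x : L2) : L2 := \pi_L2 (a *: repr x).

Lemma L2addE x y : {ae mu, forall t, L2add x y t = x t + y t}.
Proof. exact: L2_piE. Qed.
Lemma L2oppE x : {ae mu, forall t, L2opp x t = - x t}.
Proof. exact: L2_piE. Qed.
Lemma L2zeroE : {ae mu, forall t, L2zero t = 0}.
Proof. exact: L2_piE. Qed.
Lemma L2scaleE a x : {ae mu, forall t, L2scale a x t = a * x t}.
Proof. exact: L2_piE. Qed.

Lemma ae_filterS4 (P Q S U V : set T) :
  (forall t, P t -> Q t -> S t -> U t -> V t) ->
  (\forall t \ae mu, P t) -> (\forall t \ae mu, Q t) ->
  (\forall t \ae mu, S t) -> (\forall t \ae mu, U t) -> \forall t \ae mu, V t.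
Proof.
move=> H p q s u; apply: filterS3 p q (filterI s u) => t tP tQ [tS tU].
exact: H.
Qed.

Lemma L2addA : associative L2add.
Proof.
move=> x y z; apply/L2_eqP.
have := L2addE x (L2add y z); have := L2addE y z.
have := L2addE (L2add x y) z; have := L2addE x y.
apply: ae_filterS4 => t h1 h2 h3 h4.
by rewrite h4 h3 h2 h1 addrA.
Qed.

Lemma L2addC : commutative L2add.
Proof.
move=> x y; apply/L2_eqP.
have := L2addE x y; have := L2addE y x.
by apply: filterS2 => t h1 h2; rewrite h1 h2 addrC.
Qed.

Lemma L2add0 : left_id L2zero L2add.
Proof.
move=> x; apply/L2_eqP.
have := L2addE L2zero x; have := L2zeroE.
by apply: filterS2 => t h1 h2; rewrite h2 h1 add0r.
Qed.

Lemma L2addN : left_inverse L2zero L2opp L2add.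
Proof.
move=> x; apply/L2_eqP.
have := L2addE (L2opp x) x; have := L2oppE x; have := L2zeroE.
by apply: filterS3 => t h1 h2 h3; rewrite h3 h2 h1 addNr.
Qed.

HB.instance Definition _ := GRing.isZmodule.Build L2 L2addA L2addC L2add0 L2addN.

Lemma L2DE (x y : L2) : {ae mu, forall t, L2_fun (x + y) t = x t + y t}.
Proof. exact: L2addE. Qed.
Lemma L2NE (x : L2) : {ae mu, forall t, L2_fun (- x) t = - x t}.
Proof. exact: L2oppE. Qed.
Lemma L20E : {ae mu, forall t, L2_fun 0 t = 0}.
Proof. exact: L2zeroE. Qed.

Lemma L2scaleA a b x : L2scale a (L2scale b x) = L2scale (a * b) x.
Proof.
apply/L2_eqP.
have := L2scaleE a (L2scale b x); have := L2scaleE b x.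
have := L2scaleE (a * b) x.
by apply: filterS3 => t h1 h2 h3; rewrite h1 h3 h2 mulrA.
Qed.

Lemma L2scale1 : left_id 1 L2scale.
Proof.
move=> x; apply/L2_eqP; have := L2scaleE 1 x.
by apply: filterS => t ->; rewrite mul1r.
Qed.

Lemma L2scaleDr : right_distributive L2scale +%R.
Proof.
move=> a x y; apply/L2_eqP.
have := L2scaleE a (x + y); have := L2DE x y.
have := L2DE (L2scale a x) (L2scale a y).
have hx := L2scaleE a x; have hy := L2scaleE a y.
move=> h1 h2 h3; apply: ae_filterS4 h1 h2 h3 (filterI hx hy) => t h3 h4 h5 [h1 h2].
by rewrite h3 h5 h4 h1 h2 mulrDr.
Qed.

Lemma L2scaleDl x : {morph L2scale^~ x : a b / a + b}.
Proof.
move=> a b; apply/L2_eqP.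
have := L2DE (L2scale a x) (L2scale b x); have := L2scaleE (a + b) x.
have := L2scaleE a x; have := L2scaleE b x.
apply: ae_filterS4 => t h1 h2 h3 h4.
by rewrite h3 h4 h1 h2 mulrDl.
Qed.

HB.instance Definition _ := GRing.Zmodule_isLmodule.Build R[i] L2
  L2scaleA L2scale1 L2scaleDr L2scaleDl.

Lemma L2ZE a (x : L2) : {ae mu, forall t, L2_fun (a *: x) t = a * x t}.
Proof. exact: L2scaleE. Qed.


Definition cintegrable (h : T -> R[i]) :=
  (@complex.Re R \o h \in Lfun mu 1%:E) && (@complex.Im R \o h \in Lfun mu 1%:E).

Definition cintegral (h : T -> R[i]) : R[i] :=
  (\int[mu]_t complex.Re (h t)) +i* (\int[mu]_t complex.Im (h t)).

Lemma cintegral_ae (h k : T -> R[i]) : cintegrable h -> cintegrable k ->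
  {ae mu, forall t, h t = k t} -> cintegral h = cintegral k.
Proof.
move=> /andP[h1 h2] /andP[k1 k2] hk; rewrite /cintegral /Rintegral.
congr (fine _ +i* fine _).
- apply: ae_eq_integral => //.
  + by have /Lfun1_integrable/integrableP[] := h1.
  + by have /Lfun1_integrable/integrableP[] := k1.
  + by apply: filterS hk => t -> _.
- apply: ae_eq_integral => //.
  + by have /Lfun1_integrable/integrableP[] := h2.
  + by have /Lfun1_integrable/integrableP[] := k2.
  + by apply: filterS hk => t -> _.
Qed.

Lemma cintegral_lin a (h k : T -> R[i]) : cintegrable h -> cintegrable k ->
  cintegrable (fun t => a * h t + k t) /\
  cintegral (fun t => a * h t + k t) = a * cintegral h + cintegral k.
Proof.
move=> /andP[h1 h2] /andP[k1 k2].
have iZ (f : T -> R) c : f \in Lfun mu 1%:E ->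
    mu.-integrable setT (EFin \o (fun t => c * f t)).
  by move=> /Lfun1_integrable/(integrableZl measurableT c).
have iD (f g : T -> R) : mu.-integrable setT (EFin \o f) ->
    mu.-integrable setT (EFin \o g) -> mu.-integrable setT (EFin \o (fun t => f t + g t)).
  by move=> fi gi; exact: (integrableD measurableT fi gi).
have iB (f g : T -> R) : mu.-integrable setT (EFin \o f) ->
    mu.-integrable setT (EFin \o g) -> mu.-integrable setT (EFin \o (fun t => f t - g t)).
  by move=> fi gi; exact: (integrableB measurableT fi gi).
have /Lfun1_integrable k1' := k1; have /Lfun1_integrable k2' := k2.
have ReE t : complex.Re (a * h t + k t) = (complex.Re a * complex.Re (h t) -
    complex.Im a * complex.Im (h t)) + complex.Re (k t).
  by case: (a) => ? ?; case: (h t) => ? ?; case: (k t).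
have ImE t : complex.Im (a * h t + k t) = (complex.Re a * complex.Im (h t) +
    complex.Im a * complex.Re (h t)) + complex.Im (k t).
  by case: (a) => ? ?; case: (h t) => ? ?; case: (k t).
split.
  apply/andP; split; apply/Lfun1_integrable.
  - rewrite (_ : _ \o _ = EFin \o (fun t => (complex.Re a * complex.Re (h t) -
      complex.Im a * complex.Im (h t)) + complex.Re (k t))); last first.
      by apply/funext => t; rewrite /= ReE.
    by apply: (iD) => //; apply: (iB); [exact: (iZ _ _ h1)|exact: (iZ _ _ h2)].
  - rewrite (_ : _ \o _ = EFin \o (fun t => (complex.Re a * complex.Im (h t) +
      complex.Im a * complex.Re (h t)) + complex.Im (k t))); last first.
      by apply/funext => t; rewrite /= ImE.
    by apply: (iD) => //; apply: (iD); [exact: (iZ _ _ h2)|exact: (iZ _ _ h1)].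
have /Lfun1_integrable h1' := h1; have /Lfun1_integrable h2' := h2.
rewrite /cintegral; under eq_Rintegral do rewrite ReE.
rewrite RintegralD//=; last by apply: (iB); [exact: (iZ _ _ h1)|exact: (iZ _ _ h2)].
rewrite RintegralB//=; [|exact: (iZ _ _ h1)|exact: (iZ _ _ h2)].
rewrite !RintegralZl//.
under [X in _ +i* X = _]eq_Rintegral do rewrite ImE.
rewrite RintegralD//=; last by apply: (iD); [exact: (iZ _ _ h2)|exact: (iZ _ _ h1)].
rewrite RintegralD//=; [|exact: (iZ _ _ h2)|exact: (iZ _ _ h1)].
rewrite !RintegralZl//.
by case: a {ReE ImE}.
Qed.

Lemma L2fun_cintegrable (f g : T -> R[i]) : f \in L2fun -> g \in L2fun ->
  cintegrable (fun t => f t * (g t)^*).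
Proof.
move=> /andP[f1 f2] /andP[g1 g2].
have L1D (u v : T -> R) : u \in Lfun mu 1 -> v \in Lfun mu 1 ->
    u \+ v \in Lfun mu 1.
  by move=> uL vL; exact: (Lfun_addr_closed mu (lexx 1%E)).2.
have L1N (u : T -> R) : u \in Lfun mu 1 -> \- u \in Lfun mu 1.
  by move=> uL; have := Lfun_oppr_closed uL.
apply/andP; split.
- rewrite (_ : _ \o _ = ((@complex.Re R \o f) \* (@complex.Re R \o g)) \+
    ((@complex.Im R \o f) \* (@complex.Im R \o g))).
    by apply: (L1D); exact: Lfun2_mul_Lfun1.
  by apply/funext => t /=; case: (f t) => a b; case: (g t) => a' b' /=; rewrite mulrN opprK.
- rewrite (_ : _ \o _ = \- ((@complex.Re R \o f) \* (@complex.Im R \o g)) \+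
    ((@complex.Im R \o f) \* (@complex.Re R \o g))).
    by apply: (L1D); [apply: L1N|]; exact: Lfun2_mul_Lfun1.
  by apply/funext => t /=; case: (f t) => a b; case: (g t) => a' b' /=; rewrite mulrN.
Qed.

Definition L2inner (x y : L2) : R[i] := cintegral (fun t => x t * (y t)^*).

Lemma L2innerP a (x y z : L2) :
  L2inner (a *: x + y) z = a * L2inner x z + L2inner y z.
Proof.
have xz := L2fun_cintegrable (L2_inP x) (L2_inP z); have yz := L2fun_cintegrable (L2_inP y) (L2_inP z).
have [il <-] := cintegral_lin a xz yz.
apply: cintegral_ae => //; first exact: (L2fun_cintegrable (L2_inP _) (L2_inP _)).
apply: filterS2 (L2DE (a *: x) y) (L2ZE a x) => t -> ->.
by rewrite mulrDl mulrA.
Qed.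

Lemma L2innerC (x y : L2) : L2inner y x = (L2inner x y)^*.
Proof.
rewrite /L2inner /cintegral; apply/eqP; rewrite eq_complex/=; apply/andP; split; apply/eqP.
  apply: eq_Rintegral => t _; case: (x t); case: (y t) => a b c e /=.
  by rewrite !mulrN !opprK mulrC (mulrC b).
have /andP[_ /Lfun1_integrable i2] := L2fun_cintegrable (L2_inP x) (L2_inP y).
rewrite -mulN1r -RintegralZl//; apply: eq_Rintegral => t _.
case: (x t); case: (y t) => a b c e /=; ring.
Qed.

Lemma L2innerE (x : L2) : L2inner x x =
  (\int[mu]_t (complex.Re (x t) ^+ 2 + complex.Im (x t) ^+ 2))%:C.
Proof.
rewrite /L2inner /cintegral; congr (_ +i* _).
  by apply: eq_Rintegral => t _; case: (x t) => a b /=; ring.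
transitivity (\int[mu]_(t in setT) (0 : R)); last by rewrite Rintegral_cst// mul0r.
by apply: eq_Rintegral => t _; case: (x t) => a b /=; ring.
Qed.

Lemma L2sqr_integrable (x : L2) : mu.-integrable setT
  (fun t => (complex.Re (x t) ^+ 2 + complex.Im (x t) ^+ 2)%:E).
Proof.
have /andP[/Lfun2_integrable_sqr x1 /Lfun2_integrable_sqr x2] := L2_inP x.
exact: (integrableD measurableT x1 x2).
Qed.

Lemma L2inner_ge0 (x : L2) : 0 <= L2inner x x.
Proof.
rewrite L2innerE ler0c Rintegral_ge0// => t _.
by rewrite addr_ge0// sqr_ge0.
Qed.

Lemma L2inner_eq0 (x : L2) : L2inner x x = 0 -> x = 0.
Proof.
have ix := L2sqr_integrable x.
rewrite L2innerE => -[] /eqP.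
rewrite /Rintegral fine_eq0 ?integrable_fin_num// => /eqP x0.
apply/L2_eqP.
have : (\int[mu]_t `|(complex.Re (x t) ^+ 2 + complex.Im (x t) ^+ 2)%:E| = 0)%E.
  rewrite -[RHS]x0; apply: eq_integral => t _.
  by rewrite gee0_abs// lee_fin addr_ge0// sqr_ge0.
move=> /ae_eq_integral_abs.
have /integrableP[mx _] := ix.
move=> /(_ measurableT mx) xae.
apply: filterS2 xae L20E => t /(_ I) [] /eqP + ->.
rewrite paddr_eq0 ?sqr_ge0// !sqrf_eq0 => /andP[/eqP r0 /eqP i0].
by apply/eqP; rewrite eq_complex/= r0 i0 eqxx.
Qed.

Lemma L2dist (x : L2) (f g : T -> R) : f \in Lfun mu 2%:E -> g \in Lfun mu 2%:E ->
  {ae mu, forall t, x t = f t +i* g t} ->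
  (L2inner x x = (fine (\int[mu]_t (f t ^+ 2)%:E + \int[mu]_t (g t ^+ 2)%:E)%E)%:C) /\
  ((\int[mu]_t (f t ^+ 2)%:E + \int[mu]_t (g t ^+ 2)%:E)%E \is a fin_num).
Proof.
move=> /Lfun2_integrable_sqr f2 /Lfun2_integrable_sqr g2 xE; split; last first.
  by rewrite fin_numD !integrable_fin_num.
rewrite L2innerE /Rintegral; congr (fine _)%:C.
rewrite -integralD//; apply: ae_eq_integral => //.
- by have /integrableP[] := L2sqr_integrable x.
- by have /integrableP[] := integrableD measurableT f2 g2.
by apply: filterS xE => t -> _.
Qed.

Lemma L2inner_complete (u : nat -> L2) :
  (forall e : R, 0 < e -> exists N, forall m n, (N <= m)%N -> (N <= n)%N ->
     L2inner (u m - u n) (u m - u n) < e%:C) ->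
  exists l, forall e : R, 0 < e -> exists N, forall n, (N <= n)%N ->
     L2inner (u n - l) (u n - l) < e%:C.
Proof.
move=> uc.
pose a n t := complex.Re (u n t); pose b n t := complex.Im (u n t).
have aL n : a n \in Lfun mu 2%:E by have /andP[] := L2_inP (u n).
have bL n : b n \in Lfun mu 2%:E by have /andP[] := L2_inP (u n).
have LB (f g : T -> R) : f \in Lfun mu 2%:E -> g \in Lfun mu 2%:E ->
    (fun t => f t - g t) \in Lfun mu 2%:E.
  move=> fL gL; rewrite (_ : (fun t => _) = f \+ (fun t => -1 * g t)).
    by rewrite Lfun2D// Lfun2Z.
  by apply/funext => t /=; rewrite mulN1r.
have uB (x y : L2) : {ae mu, forall t, L2_fun (x - y) t =
    (complex.Re (x t) - complex.Re (y t)) +i* (complex.Im (x t) - complex.Im (y t))}.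
  apply: filterS2 (L2DE x (- y)) (L2NE y) => t -> ->.
  by case: (x t) => ? ?; case: (y t).
have I0 (f : T -> R) : (0 <= \int[mu]_t (f t ^+ 2)%:E)%E.
  by apply: integral_ge0 => t _; rewrite lee_fin sqr_ge0.
have [|f fL Hf] := @Lfun2_complete _ _ _ mu a aL.
  move=> e /uc[N HN]; exists N => m n Nm Nn.
  have [E F] := L2dist (LB _ _ (aL m) (aL n)) (LB _ _ (bL m) (bL n)) (uB _ _).
  have := HN m n Nm Nn; rewrite E ltcR -lte_fin fineK//.
  by apply: le_lt_trans; rewrite leeDl.
have [|g gL Hg] := @Lfun2_complete _ _ _ mu b bL.
  move=> e /uc[N HN]; exists N => m n Nm Nn.
  have [E F] := L2dist (LB _ _ (aL m) (aL n)) (LB _ _ (bL m) (bL n)) (uB _ _).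
  have := HN m n Nm Nn; rewrite E ltcR -lte_fin fineK//.
  by apply: le_lt_trans; rewrite leeDr.
have lL : (fun t => f t +i* g t) \in L2fun by apply/andP; split.
pose l : L2 := \pi_L2 (SqInt lL).
exists l => e e0; have e20 : 0 < e / 2 by rewrite divr_gt0.
have [N1 HN1] := Hf _ e20; have [N2 HN2] := Hg _ e20.
exists (maxn N1 N2) => n; rewrite geq_max => /andP[n1 n2].
have lB : {ae mu, forall t, L2_fun (u n - l) t = (a n t - f t) +i* (b n t - g t)}.
  by apply: filterS2 (uB (u n) l) (L2_piE (SqInt lL)) => t -> ->.
have [-> F] := L2dist (LB _ _ (aL n) fL) (LB _ _ (bL n) gL) lB.
rewrite ltcR -lte_fin fineK// (splitr e) EFinD lteD//; [exact: HN1|exact: HN2].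
Qed.

HB.instance Definition _ := Lmodule_isHilbert.Build R L2
  L2innerP L2innerC L2inner_ge0 L2inner_eq0 L2inner_complete.

End L2.

(* An unbounded operator from H1 to H2 is given by its graph T, a subset of
   H1 * H2, so that the closure of an operator is the closure of a set. *)
Section Operators.
Context (R : realType).
Implicit Types H : hilbertType R.

Definition is_operator H1 H2 (T : set (H1 * H2)) :=
  [/\ T (0, 0),
      forall (c : R[i]) x x' y y', T (x, y) -> T (x', y') ->
        T (c *: x + x', c *: y + y') &
      forall x y y', T (x, y) -> T (x, y') -> y = y'].

Definition dom H1 H2 (T : set (H1 * H2)) : set H1 :=
  [set x | exists y, T (x, y)].

Definition ker H1 H2 (T : set (H1 * H2)) : set H1 := [set x | T (x, 0)].

Definition adjoint H1 H2 (T : set (H1 * H2)) : set (H2 * H1) :=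
  [set z | forall x y, T (x, y) -> inner y z.1 = inner x z.2].

Definition self_adjoint H (T : set (H * H)) :=
  [/\ is_operator T, dense (dom T) & adjoint T = T].

(* The block operator with zero diagonal, upper right entry B and lower left
   entry A, on the Hilbert sum of H1 and H2. *)
Definition offdiag H1 H2 (B : set (H2 * H1)) (A : set (H1 * H2)) :
    set (hsum H1 H2 * hsum H1 H2) :=
  [set z | B (z.1.2, z.2.1) /\ A (z.1.1, z.2.2)].

Definition infinite_dimensional H (V : set H) := forall n,
  exists v : 'I_n -> H, (forall i, V (v i)) /\
    forall c : 'I_n -> R[i], \sum_i c i *: v i = 0 -> forall i, c i = 0.

Definition bounded_op H (A : H -> H) :=
  linear A /\ exists M : R, forall x, `|A x| <= M%:C * `|x|.

Definition compact_op H (A : H -> H) :=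
  bounded_op A /\ compact (closure (A @` [set x | `|x| <= 1])).

(* S = (T - z)^-1 *)
Definition is_resolvent H (T : set (H * H)) (z : R[i]) (S : H -> H) :=
  bounded_op S /\ forall x y, T (x, y + z *: x) <-> S y = x.

(* The adjoint of a bounded operator, which exists by Riesz representation. *)
Definition adjop H (A : H -> H) : H -> H :=
  xget (fun=> 0) [set A' | forall x y, inner (A x) y = inner x (A' y)].

(* On its natural domain, the x in dom T with T x in dom T. *)
Definition one_plus_sq H (T : set (H * H)) : set (H * H) :=
  [set z | exists y w, [/\ T (z.1, y), T (y, w) & z.2 = z.1 + w]].

(* B = (1 + T^2)^(-1/2), the positive square root of the bounded operator
   (1 + T^2)^-1; there is exactly one such B when T is self-adjoint. *)
Definition is_inv_sqrt_one_plus_sq H (T : set (H * H)) (B : H -> H) :=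
  [/\ bounded_op B, forall x, 0 <= inner (B x) x &
      forall x y, one_plus_sq T (x, y) <-> B (B y) = x].

Definition inv_sqrt_one_plus_sq H (T : set (H * H)) : H -> H :=
  xget (fun=> 0) [set B | is_inv_sqrt_one_plus_sq T B].

(* T (1 + T^2)^(-1/2) *)
Definition bounded_transform H (T : set (H * H)) : H -> H :=
  fun x => xget 0 [set y | T (inv_sqrt_one_plus_sq T x, y)].

Definition subalgebra H (A : set (H -> H)) :=
  [/\ forall a, A a -> bounded_op a,
      A (fun=> 0),
      forall (c : R[i]) a b, A a -> A b -> A (fun x => c *: a x + b x) &
      forall a b, A a -> A b -> A (a \o b)].

Definition star_subalgebra H (A : set (H -> H)) :=
  subalgebra A /\ forall a, A a -> A (adjop a).

Definition spectral_triple H (A : set (H -> H)) (D : set (H * H)) :=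
  [/\ star_subalgebra A, self_adjoint D &
    forall a, A a ->
      [/\ forall x, dom D x -> dom D (a x),
          exists M : R, forall x y z, D (x, y) -> D (a x, z) ->
            `|z - a y| <= M%:C * `|x| &
          compact_op (a \o inv_sqrt_one_plus_sq D)]].

Definition fredholm_module H (A : set (H -> H)) (F : H -> H) :=
  [/\ subalgebra A, bounded_op F &
    forall a, A a ->
      [/\ compact_op (fun x => a (F x - adjop F x)),
          compact_op (fun x => a (x - F (F x))) &
          compact_op (fun x => F (a x) - a (F x))]].

End Operators.

Section Multiplication.
Context d (T : measurableType d) (R : realType) (mu : {measure set T -> \bar R}).

(* Multiplication by a. Only the almost everywhere class of a matters, so for a
   measure carried by a set D only the values of a on D do. *)
Definition mulop (a : T -> R[i]) (x : L2 mu) : L2 mu :=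
  xget 0 [set y : L2 mu | {ae mu, forall t, y t = a t * x t}].

Definition mulop2 (a : T -> R[i]) (x : hsum (L2 mu) (L2 mu)) :
  hsum (L2 mu) (L2 mu) := (mulop a x.1, mulop a x.2).

End Multiplication.

Section Disc.
Context (R : realType).

Local Notation plane := (measurableTypeR R * measurableTypeR R)%type.

Definition polar (q : plane) : plane := (q.1 * cos q.2, q.1 * sin q.2).

Definition polar_box : set plane := `[0, 1]%classic `*` `[0, 2 * pi]%classic.

(* The measure r dr dtheta / (2 pi) on the rectangle of polar coordinates. *)
Definition polar_area (A : set plane) : \bar R :=
  (\int[lebesgue_measure \x lebesgue_measure]_(q in A `&` polar_box)
     (q.1 / (2 * pi))%:E)%E.

Lemma measurable_polar_box : measurable polar_box.
Proof. by apply: measurableX; exact: measurable_itv. Qed.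

Lemma measurable_polar : measurable_fun setT polar.
Proof.
have mc : measurable_fun setT (cos : R -> R).
  exact: continuous_measurable_fun (@continuous_cos R).
have ms : measurable_fun setT (sin : R -> R).
  exact: continuous_measurable_fun (@continuous_sin R).
apply/measurable_fun_pairP; split.
- apply: (@measurable_funM _ plane R setT fst (fun q => cos q.2)).
    exact: measurable_fst.
  exact: measurableT_comp mc measurable_snd.
- apply: (@measurable_funM _ plane R setT fst (fun q => sin q.2)).
    exact: measurable_fst.
  exact: measurableT_comp ms measurable_snd.
Qed.

Lemma polar_area0 : polar_area set0 = 0%E.
Proof. by rewrite /polar_area set0I integral_set0. Qed.

Lemma polar_area_ge0 A : (0 <= polar_area A)%E.
Proof.
apply: integral_ge0 => q [_ [/= + _]]; rewrite in_itv/= => /andP[q0 _].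
by rewrite lee_fin divr_ge0// mulr_ge0// pi_ge0.
Qed.

Lemma polar_area_sigma_additive : semi_sigma_additive polar_area.
Proof.
move=> F mF tF mUF; rewrite /polar_area; apply: cvg_toP.
  apply: ereal_nondecreasing_is_cvgn => m n mn.
  by apply: lee_sum_nneg_natr => // k _ _; exact: polar_area_ge0.
rewrite setI_bigcupl ge0_integral_bigcup//=.
- by move=> k; apply: measurableI => //; exact: measurable_polar_box.
- apply/measurable_EFinP/measurable_funTS.
  apply: (@measurable_funM _ plane R setT fst (cst (2 * pi)^-1)) => //.
- move=> q [k _ [_ [/= + _]]]; rewrite in_itv/= => /andP[q0 _].
  by rewrite lee_fin divr_ge0// mulr_ge0// pi_ge0.
- exact: trivIset_setIr.
Qed.

HB.instance Definition _ := isMeasure.Build _ _ _ polar_area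
  polar_area0 polar_area_ge0 polar_area_sigma_additive.

(* Its image in the plane, carried by the closed unit disc. *)
Definition disc_measure : set plane -> \bar R := pushforward polar_area polar.

Lemma disc_measure0 : disc_measure set0 = 0%E.
Proof. by rewrite /disc_measure /pushforward preimage_set0 measure0. Qed.

Lemma disc_measure_ge0 A : (0 <= disc_measure A)%E.
Proof. exact: polar_area_ge0. Qed.

Lemma disc_measure_sigma_additive : semi_sigma_additive disc_measure.
Proof.
by apply: measure_semi_sigma_additive; exact: measurable_polar.
Qed.

HB.instance Definition _ := isMeasure.Build _ _ _ disc_measure
  disc_measure0 disc_measure_ge0 disc_measure_sigma_additive.

Definition closed_disc : set plane := [set p | p.1 ^+ 2 + p.2 ^+ 2 <= 1].
Definition open_disc : set plane := [set p | p.1 ^+ 2 + p.2 ^+ 2 < 1].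

(* Continuous partial derivatives of all orders up to k. *)
Fixpoint Ck (k : nat) (f : R * R -> R) : Prop :=
  continuous f /\
  if k is k'.+1 then
    [/\ forall p, derivable f p (1, 0) /\ derivable f p (0, 1),
        Ck k' ('D_(1, 0) f) & Ck k' ('D_(0, 1) f)]
  else True.

(* Smooth complex functions on the plane. Their restrictions to the closed disc
   are the smooth functions on it, boundary included. *)
Definition csmooth (f : R * R -> R[i]) := forall k,
  Ck k (@complex.Re R \o f) /\ Ck k (@complex.Im R \o f).

(* Smooth functions with compact support in the open disc, extended by 0. *)
Definition Cc_smooth (f : R * R -> R[i]) :=
  let supp := closure [set p | f p != 0] in
  [/\ csmooth f, compact supp & supp `<=` open_disc].

Definition disc_continuous (f : R * R -> R[i]) :=
  {within closed_disc, continuous (@complex.Re R \o f)} /\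
  {within closed_disc, continuous (@complex.Im R \o f)}.

Definition cderive1 (u : R -> R[i]) (t : R) : R[i] :=
  derive1 (@complex.Re R \o u) t +i* derive1 (@complex.Im R \o u) t.

Definition expi (t : R) : R[i] := cos t +i* sin t.

(* The partial derivatives of f in polar coordinates, as functions of
   q = (r, theta). *)
Definition dr (f : plane -> R[i]) (q : plane) : R[i] :=
  cderive1 (fun r => f (polar (r, q.2))) q.1.
Definition dtheta (f : plane -> R[i]) (q : plane) : R[i] :=
  cderive1 (fun t => f (polar (q.1, t))) q.2.

Definition L2D : hilbertType R := L2 disc_measure.

(* exp(i theta) (d_r + i r^-1 d_theta) on smooth functions with compact support.
   The formula is only used for almost all (r, theta), so that r = 0 does not
   matter. *)
Definition Dplus0 : set (L2D * L2D) :=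
  [set z : L2D * L2D | exists f, [/\ Cc_smooth f,
     {ae disc_measure, forall p, L2_fun z.1 p = f p} &
     {ae polar_area, forall q, L2_fun z.2 (polar q) =
       expi q.2 * (dr f q + 'i * (q.1^-1)%:C * dtheta f q)}]].

(* exp(- i theta) (- d_r + i r^-1 d_theta) *)
Definition Dminus0 : set (L2D * L2D) :=
  [set z : L2D * L2D | exists f, [/\ Cc_smooth f,
     {ae disc_measure, forall p, L2_fun z.1 p = f p} &
     {ae polar_area, forall q, L2_fun z.2 (polar q) =
       expi (- q.2) * (- dr f q + 'i * (q.1^-1)%:C * dtheta f q)}]].

Definition Dplus : set (L2D * L2D) := closure Dplus0.
Definition Dminus : set (L2D * L2D) := closure Dminus0.

Definition smooth_algebra : set (hsum L2D L2D -> hsum L2D L2D) :=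
  [set A | exists2 a : plane -> R[i], csmooth a & A = mulop2 a].
Definition continuous_algebra : set (hsum L2D L2D -> hsum L2D L2D) :=
  [set A | exists2 a : plane -> R[i], disc_continuous a & A = mulop2 a].

End Disc.

Arguments L2D R : clear implicits.
Arguments Dplus0 R : clear implicits.
Arguments Dminus0 R : clear implicits.
Arguments Dplus R : clear implicits.
Arguments Dminus R : clear implicits.
Arguments smooth_algebra R : clear implicits.
Arguments continuous_algebra R : clear implicits.

(* Main.v *)
Require Import Defs.
From HB Require Import structures.
From mathcomp Require Import all_boot all_order all_algebra.
From mathcomp Require Import all_classical all_reals all_analysis.
From mathcomp Require Import measurable_realfun.
From mathcomp Require Import complex.
From mathcomp Require Import ring lra.
Set Implicit Arguments.
Unset Strict Implicit.
Unset Printing Implicit Defensive.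
Import Order.TTheory GRing.Theory Num.Theory.
Import numFieldNormedType.Exports.
Local Open Scope quotient_scope.
Local Open Scope classical_set_scope.
Local Open Scope complex_scope.
Local Open Scope ring_scope.

(** The extension is self-adjoint because of a general fact on closed operators,
    and its kernel is infinite-dimensional because the domain of the adjoint of
    D_+ carries no boundary condition.

    In cartesian coordinates D_+ is d_x + i d_y and D_- is -(d_x - i d_y)
    ([Dplus0P], [Dminus0P]). If f has compact support in the open disc and g is
    smooth, the difference of (D_+ f) g^* and f (D_- g)^* is a sum of partial
    derivatives of functions that vanish on the unit circle, so it has integral
    zero ([mean_derive_zero]); hence D_- is contained in the adjoint of D_+
    ([dbar_adjoint]). The divergence theorem behind this is the fundamental
    theorem of calculus in r and in theta ([polar_divergence]). Test functions
    are dense, since smooth bumps converge boundedly to the indicators of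
    quadrants, which generate the Borel sets ([L2_orthogonal_bumps]); so both
    operators are closable. For a closed densely defined T with densely defined
    adjoint S, orthogonal projection onto the graph gives that the adjoint of S
    is T ([biadjoint]), and then the block operator with off-diagonal entries S
    and T is self-adjoint ([offdiag_self_adjoint]).

    In this pairing it is f alone that vanishes on the circle. So
    every power of the conjugate coordinate zbar = x - i y, on which d_x - i d_y
    vanishes, lies in the kernel of the adjoint of D_+. These powers are
    linearly independent in L^2, because a nonzero polynomial in zbar vanishes
    only at finitely many points, a null set ([zbar_poly_ae], [ker_infinite]).

    For a self-adjoint T, the operators T - i and T + i have contractive inverses
    S and S' that are defined everywhere ([sa_surj]), S' S is the inverse of
    1 + T^2, and its positive root B is the limit of an explicit iteration
    ([root_contraction], [inv_sqrt_exists]). The range of B is dense, and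
    T B is a contraction on it, so T B is everywhere defined and bounded
    ([transform_total]). On the kernel of T these operators are explicit: B is
    the identity, F = T B is zero, and the resolvent at z is the scalar -1/z. A
    compact operator cannot be a nonzero scalar on an infinite-dimensional
    subspace ([compact_not_scalar]). Thus resolvents and 1 - F^2 are not
    compact, and the function 1, which acts as the identity, violates the
    compactness conditions on spectral triples and on Fredholm modules. *)

(** * Geometry of Hilbert spaces *)

Section HilbertGeometry.
Context (R : realType) (H : hilbertType R).
Implicit Types (x y z : H) (a : R[i]).

(** The norm and the inner product of the space have values in R[i]. Their real
    parts hold the same information ([hnE], [innerE]), and real arithmetic
    applies to them. *)
Definition hn x : R := complex.Re `|x|.
Definition rip x y : R := complex.Re (inner x y).

Lemma hnE x : `|x| = (hn x)%:C.
Proof. by rewrite /hn RRe_real// ger0_real. Qed.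

Lemma hn_ge0 x : 0 <= hn x.
Proof. by rewrite -ler0c -hnE. Qed.

Lemma innerDl x y z : inner (x + y) z = inner x z + inner y z.
Proof. by rewrite -[x]scale1r innerP mul1r scale1r. Qed.

Lemma inner0l z : inner 0 z = 0.
Proof. by apply: (addrI (inner 0 z)); rewrite -innerDl !addr0. Qed.

Lemma innerZl a x z : inner (a *: x) z = a * inner x z.
Proof. by rewrite -[a *: x]addr0 innerP inner0l addr0. Qed.

Lemma innerZr a x z : inner x (a *: z) = a^* * inner x z.
Proof. by rewrite innerC innerZl rmorphM/= -innerC. Qed.

Lemma innerDr x y z : inner x (y + z) = inner x y + inner x z.
Proof. by rewrite innerC innerDl rmorphD/= -!innerC. Qed.

Lemma inner0r z : inner z 0 = 0.
Proof. by rewrite innerC inner0l rmorph0. Qed.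

Lemma innerNl x z : inner (- x) z = - inner x z.
Proof. by rewrite -scaleN1r innerZl mulN1r. Qed.

Lemma innerNr x z : inner z (- x) = - inner z x.
Proof. by rewrite innerC innerNl rmorphN/= -innerC. Qed.

Lemma innerBl x y z : inner (x - y) z = inner x z - inner y z.
Proof. by rewrite innerDl innerNl. Qed.

Lemma innerBr x y z : inner x (y - z) = inner x y - inner x z.
Proof. by rewrite innerDr innerNr. Qed.

Lemma hn_sqr x : inner x x = (hn x ^+ 2)%:C.
Proof. by rewrite -normr_inner hnE rmorphXn. Qed.

Lemma rip_xx x : rip x x = hn x ^+ 2.
Proof. by rewrite /rip hn_sqr. Qed.

Lemma ripC x y : rip x y = rip y x.
Proof. by rewrite /rip (innerC y x); case: (inner y x). Qed.

Lemma ripDl x y z : rip (x + y) z = rip x z + rip y z.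
Proof. by rewrite /rip innerDl raddfD. Qed.

Lemma ripDr x y z : rip z (x + y) = rip z x + rip z y.
Proof. by rewrite ripC ripDl !(ripC z). Qed.

Lemma ripNl x z : rip (- x) z = - rip x z.
Proof. by rewrite /rip innerNl raddfN. Qed.

Lemma ripNr x z : rip z (- x) = - rip z x.
Proof. by rewrite ripC ripNl ripC. Qed.

Lemma ripZl (s : R) x z : rip (s%:C *: x) z = s * rip x z.
Proof. by rewrite /rip innerZl; case: (inner x z) => u v; simpc. Qed.

Lemma ripZr (s : R) x z : rip z (s%:C *: x) = s * rip z x.
Proof. by rewrite ripC ripZl ripC. Qed.

Lemma innerE x y : inner x y = rip x y +i* rip x ('i%C *: y).
Proof.
rewrite /rip innerZr; case: (inner x y) => u v /=.
by congr (_ +i* _); ring.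
Qed.

Lemma hn0 : hn 0 = 0.
Proof. by rewrite /hn normr0. Qed.

Lemma hn0_eq0 x : hn x = 0 -> x = 0.
Proof. by move=> x0; apply/eqP; rewrite -normr_eq0 hnE x0. Qed.

Lemma hnZ a x : hn (a *: x) = complex.Re `|a| * hn x.
Proof.
rewrite /hn normrZ; have : `|a| \is Num.real by rewrite ger0_real.
have : `|x| \is Num.real by rewrite ger0_real.
by move=> /RRe_real <- /RRe_real <-; rewrite -rmorphM.
Qed.

Lemma hnD x y : hn (x + y) <= hn x + hn y.
Proof. by rewrite -lecR rmorphD/= -!hnE ler_normD. Qed.

Lemma hnN x : hn (- x) = hn x.
Proof. by rewrite /hn normrN. Qed.

Lemma hnB x y : hn (x - y) = hn (y - x).
Proof. by rewrite -hnN opprB. Qed.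

Lemma hnD_sqr x y : hn (x + y) ^+ 2 = hn x ^+ 2 + hn y ^+ 2 + 2 * rip x y.
Proof. by rewrite -!rip_xx ripDl !ripDr (ripC y x); ring. Qed.

Lemma hnB_sqr x y : hn (x - y) ^+ 2 = hn x ^+ 2 + hn y ^+ 2 - 2 * rip x y.
Proof. by rewrite hnD_sqr hnN ripNr mulrN. Qed.

Lemma hnZr (s : R) x : hn (s%:C *: x) ^+ 2 = s ^+ 2 * hn x ^+ 2.
Proof. by rewrite -!rip_xx ripZl ripZr mulrA. Qed.

Lemma parallelogram x y :
  hn (x + y) ^+ 2 + hn (x - y) ^+ 2 = 2 * (hn x ^+ 2 + hn y ^+ 2).
Proof. by rewrite hnD_sqr hnB_sqr; ring. Qed.

Lemma rip_le x y : rip x y <= hn x * hn y.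
Proof.
have := hnD_sqr x y; have := hnD x y; have := hn_ge0 (x + y).
have := hn_ge0 x; have := hn_ge0 y; nra.
Qed.

Lemma rip_norm x y : `|rip x y| <= hn x * hn y.
Proof.
by rewrite ler_norml rip_le andbT lerNl -ripNl -[hn x]hnN rip_le.
Qed.

Lemma eq_innerr x y : (forall z, inner x z = inner y z) -> x = y.
Proof.
move=> xy; apply/eqP; rewrite -subr_eq0; apply/eqP/hn0_eq0/eqP.
by rewrite -sqrf_eq0 -rip_xx /rip innerBl xy subrr.
Qed.

Definition hcvg (u : nat -> H) x :=
  forall e : R, 0 < e -> exists N, forall n, (N <= n)%N -> hn (u n - x) < e.

Definition adherent (V : set H) x :=
  forall e : R, 0 < e -> exists2 v, V v & hn (x - v) < e.

Definition submod (V : set H) :=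
  V 0 /\ forall (c : R[i]) x y, V x -> V y -> V (c *: x + y).

Lemma hcauchy_cvg (u : nat -> H) :
  (forall e : R, 0 < e -> exists N, forall m n, (N <= m)%N -> (N <= n)%N ->
     hn (u m - u n) < e) -> exists x, hcvg u x.
Proof.
have sq x (e : R) : 0 < e -> (`|x| ^+ 2 < (e ^+ 2)%:C) = (hn x < e).
  by move=> e0; rewrite hnE -rmorphXn/= ltcR ltr_pXn2r// nnegrE ?hn_ge0// ltW.
move=> uc; have [|x ux] := @hilbert_cauchy_seq R H u.
  move=> e e0; have se : 0 < Num.sqrt e by rewrite sqrtr_gt0.
  have [N HN] := uc _ se; exists N => m n Nm Nn.
  by rewrite -[e]sqr_sqrtr ?ltW// sq// HN.
exists x => e e0; have [|N HN] := ux (e ^+ 2); first by rewrite exprn_gt0.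
by exists N => n Nn; rewrite -sq// HN.
Qed.

Lemma small_inv (e : R) : 0 < e -> exists N, forall n, (N <= n)%N -> n.+1%:R^-1 < e.
Proof.
move=> e0; have [N _ HN] := near_infty_natSinv_lt (PosNum e0).
by exists N => n Nn; apply: HN.
Qed.

Lemma adherent_seq (V : set H) x : adherent V x ->
  exists2 u, hcvg u x & forall n, V (u n).
Proof.
move=> Vx; have /choice[u uP] : forall n : nat, exists v, V v /\ hn (v - x) < n.+1%:R^-1.
  move=> n; have [|v Vv vx] := Vx n.+1%:R^-1; first by rewrite invr_gt0.
  by exists v; rewrite hnB.
exists u; last by move=> n; have [] := uP n.
move=> e /small_inv[N HN]; exists N => n /HN; apply: lt_trans.
by have [] := uP n.
Qed.

Lemma ler_all_eps (a b : R) : (forall e, 0 < e -> a <= b + e) -> a <= b.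
Proof. by move=> h; apply/ler_addgt0Pr. Qed.

(** A minimizing sequence for the distance from x to V is Cauchy by the
    parallelogram law, and its limit v minimizes the distance. Moving v by s w
    gives 2 s Re <x - v, w> <= s^2 |w|^2 for all real s, hence Re <x - v, w> = 0;
    the imaginary part is the real part for i w. *)
Lemma projection (V : set H) : submod V -> (forall x, adherent V x -> V x) ->
  forall x, exists2 v, V v & forall w, V w -> inner (x - v) w = 0.
Proof.
move=> [V0 VL] Vcl x.
have VZ c y : V y -> V (c *: y) by move=> Vy; rewrite -[c *: y]addr0; exact: VL.
have VD y z : V y -> V z -> V (y + z).
  by move=> Vy Vz; rewrite -[y]scale1r; exact: VL.
pose E := [set hn (x - v) ^+ 2 | v in V].
have E0 : has_inf E.
  split; first by exists (hn (x - 0) ^+ 2); exists 0.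
  by exists 0 => _ [v _ <-]; rewrite sqr_ge0.
pose d := inf E.
have dE v : V v -> d <= hn (x - v) ^+ 2.
  by move=> Vv; apply: ge_inf; [exact: E0.2|exists v].
have /choice[u uP] : forall n : nat, exists v, V v /\ hn (x - v) ^+ 2 < d + n.+1%:R^-1.
  move=> n; have [|_ [v Vv <-] vd] := @inf_adherent R E (n.+1%:R^-1) _ E0.
    by rewrite invr_gt0.
  by exists v.
have uc m n : hn (u m - u n) ^+ 2 <= 2 * (m.+1%:R^-1 + n.+1%:R^-1).
  have := parallelogram (x - u m) (x - u n).
  have -> : x - u m - (x - u n) = - (u m - u n).
    by rewrite !opprB addrC addrA subrK.
  have -> : x - u m + (x - u n) = 2%:C *: (x - (2^-1)%:C *: (u m + u n)).
    rewrite scalerBr scalerA -rmorphM/= mulfV// scale1r.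
    rewrite addrACA -opprD; congr (_ - _).
    by rewrite -[2]/(1 + 1) rmorphD/= scalerDl scale1r.
  rewrite hnN hnZr; have [Vm um] := uP m; have [Vn un] := uP n.
  have := dE ((2^-1)%:C *: (u m + u n)) (VZ _ _ (VD _ _ Vm Vn)).
  rewrite (_ : 2 ^+ 2 = 4 :> R); last by ring.
  move: um un; set i1 := _.+1%:R^-1; set i2 := _.+1%:R^-1.
  set h1 := hn _ ^+ 2; set h2 := hn _ ^+ 2; set h3 := hn _ ^+ 2.
  set h4 := hn _ ^+ 2; move: h1 h2 h3 h4 i1 i2 => h1 h2 h3 h4 i1 i2.
  lra.
have [|v uv] := @hcauchy_cvg u.
  move=> e e0; have [|N HN] := @small_inv (e ^+ 2 / 4).
    by rewrite divr_gt0// exprn_gt0.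
  exists N => m n Nm Nn.
  rewrite -(@ltr_pXn2r _ 2)// ?nnegrE ?hn_ge0// ?ltW//.
  apply: le_lt_trans (uc m n) _; have := HN m Nm; have := HN n Nn.
  by move: (n.+1%:R^-1) (m.+1%:R^-1) => i1 i2; lra.
have Vv : V v.
  apply: Vcl => e /uv[N /(_ N (leqnn _)) h]; exists (u N); first by have [] := uP N.
  by rewrite hnB.
have xvd : hn (x - v) ^+ 2 <= d.
  apply: ler_all_eps => e e0.
  have : hn (x - v) <= Num.sqrt (d + e).
    apply: ler_all_eps => e1 e10.
    have [N1 H1] := uv e1 e10; have [N2 H2] := small_inv e0.
    pose n := maxn N1 N2.
    have -> : x - v = (x - u n) + (u n - v) by rewrite addrA subrK.
    apply: le_trans (hnD _ _) _; apply: lerD; last by rewrite ltW// H1// leq_maxl.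
    rewrite -[hn (x - u n)]ger0_norm ?hn_ge0// -sqrtr_sqr.
    have [_ /ltW h] := uP n; apply: ler_wsqrtr.
    by apply: le_trans h _; rewrite lerD2l ltW// H2// leq_maxr.
  have d0 : 0 <= d by apply: lb_le_inf; [exact: E0.1|move=> _ [w _ <-]; rewrite sqr_ge0].
  by rewrite -(@ler_pXn2r _ 2)// ?nnegrE ?hn_ge0 ?sqrtr_ge0// sqr_sqrtr// addr_ge0// ltW.
have rip0 w : V w -> rip (x - v) w = 0.
  move=> Vw; apply/eqP; rewrite -sqrf_eq0; apply/eqP.
  have p : 0 < 1 + hn w ^+ 2 by rewrite ltr_pwDl// sqr_ge0.
  (* The optimal s would divide by the square of hn w, which can be zero; adding
     1 keeps the argument uniform. *)
  have [s sE] : exists s, s * (1 + hn w ^+ 2) = rip (x - v) w.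
    by exists (rip (x - v) w / (1 + hn w ^+ 2)); rewrite divfK// gt_eqF.
  have := dE (v + s%:C *: w) (VD _ _ Vv (VZ _ _ Vw)).
  have -> : x - (v + s%:C *: w) = (x - v) - s%:C *: w by rewrite opprD addrA.
  rewrite hnB_sqr hnZr ripZr => h.
  have {}h : 2 * (s * rip (x - v) w) <= s ^+ 2 * hn w ^+ 2.
    have := le_trans xvd h; rewrite -addrA lerDl subr_ge0.
    by move: (s * rip _ _) => ?; lra.
  move: h; rewrite -sE; move: (hn w) (sqr_ge0 (hn w)) (sqr_ge0 s) => {sE p} q q0 s0 h.
  have s2 : s ^+ 2 * (2 + q ^+ 2) <= 0.
    have -> : s ^+ 2 * (2 + q ^+ 2) = 2 * (s * (s * (1 + q ^+ 2))) - s ^+ 2 * q ^+ 2 by ring.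
    by rewrite subr_le0.
  have /eqP : s ^+ 2 * (2 + q ^+ 2) = 0.
    by apply/eqP; rewrite eq_le s2 mulr_ge0// addr_ge0.
  have q2 : 2 + q ^+ 2 != 0 by rewrite gt_eqF// ltr_wpDr.
  by rewrite mulf_eq0 sqrf_eq0 (negbTE q2) orbF => /eqP ->; rewrite mul0r expr0n.
exists v => // w Vw; rewrite innerE rip0// rip0 ?complexr0//; exact: VZ.
Qed.

(** The projection of x onto the closure of V differs from x by a vector
    orthogonal to V. *)
Lemma dense_of_orthogonal (V : set H) : submod V ->
  (forall x, (forall v, V v -> inner x v = 0) -> x = 0) -> forall x, adherent V x.
Proof.
move=> [V0 VL] Vo x.
have [||v Vv xv] := @projection (adherent V) _ _ x.
- split; first by move=> e e0; exists 0; rewrite // subr0 hn0.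
  move=> c y z Vy Vz e e0.
  have c0 : 0 < complex.Re `|c| + 1 by rewrite ltr_wpDl// -ler0c RRe_real// ger0_real.
  have [v Vv vy] := Vy _ (divr_gt0 (divr_gt0 e0 (ltr0Sn _ 1)) c0).
  have [w Vw wz] := Vz _ (divr_gt0 e0 (ltr0Sn _ 1)).
  exists (c *: v + w); first exact: VL.
  rewrite opprD addrACA -scalerBr; apply: le_lt_trans (hnD _ _) _.
  rewrite (splitr e) ler_ltD// hnZ.
  apply: (@le_trans _ _ ((complex.Re `|c| + 1) * hn (y - v))).
    by rewrite ler_wpM2r// ?hn_ge0// lerDl.
  by rewrite mulrC -ler_pdivlMr// ltW.
- move=> y yV e e0; have [v Vv yv] := yV _ (divr_gt0 e0 (ltr0Sn _ 1)).
  have [w Vw vw] := Vv _ (divr_gt0 e0 (ltr0Sn _ 1)).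
  exists w => //; rewrite -(subrK v y) -addrA; apply: le_lt_trans (hnD _ _) _.
  by rewrite (splitr e) ltrD.
have -> : x = v; last exact: Vv.
apply/eqP; rewrite -subr_eq0; apply/eqP/Vo => w Vw; apply: xv => e e0.
by exists w; rewrite // subrr hn0.
Qed.

End HilbertGeometry.

(** * Closures and adjoints of graphs *)

Section Graphs.
Context (R : realType).
Implicit Types H : hilbertType R.

(** The closure of a graph is taken in the product topology, while orthogonality
    of graphs lives in the Hilbert sum; [closureP] compares the two. *)
Definition graph_set H1 H2 (T : set (H1 * H2)) : set (hsum H1 H2) :=
  [set z | T (z.1, z.2)].

Lemma hn_hsum H1 H2 (z : hsum H1 H2) : hn z ^+ 2 = hn z.1 ^+ 2 + hn z.2 ^+ 2.
Proof. by rewrite -!rip_xx /rip -raddfD. Qed.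

Lemma inner_hsum H1 H2 (z w : hsum H1 H2) :
  inner z w = inner z.1 w.1 + inner z.2 w.2.
Proof. by []. Qed.

Lemma hn_ltE H (x : H) (e : R) : 0 <= e -> (hn x < e) = (hn x ^+ 2 < e ^+ 2).
Proof. by move=> e0; rewrite ltr_pXn2r// nnegrE hn_ge0. Qed.

Lemma hn_hsum1 H1 H2 (z : hsum H1 H2) : hn z.1 <= hn z.
Proof.
by rewrite -(@ler_pXn2r _ 2)// ?nnegrE ?hn_ge0// hn_hsum lerDl sqr_ge0.
Qed.

Lemma hn_hsum2 H1 H2 (z : hsum H1 H2) : hn z.2 <= hn z.
Proof.
by rewrite -(@ler_pXn2r _ 2)// ?nnegrE ?hn_ge0// hn_hsum lerDr sqr_ge0.
Qed.

Lemma hn_hsumD H1 H2 (z : hsum H1 H2) : hn z <= hn z.1 + hn z.2.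
Proof.
rewrite -(@ler_pXn2r _ 2)// ?nnegrE ?addr_ge0 ?hn_ge0// hn_hsum sqrrD.
by rewrite addrAC lerDl mulrn_wge0// mulr_ge0 ?hn_ge0.
Qed.

Lemma closureP H1 H2 (T : set (H1 * H2)) x y :
  closure T (x, y) <-> adherent (graph_set T) ((x, y) : hsum H1 H2).
Proof.
split=> [cT e e0|aT B /nbhs_ballP[e /= e0 eB]].
  have e20 : 0 < e / 2 by rewrite divr_gt0.
  have [|[x' y'] [/= Txy [bx ey]]] := cT (ball (x, y) (e / 2)%:C).
    by apply: nbhsx_ballx; rewrite ltcR.
  exists ((x', y') : hsum H1 H2) => //.
  apply: le_lt_trans (hn_hsumD _) _ => /=; rewrite (splitr e).
  by rewrite ltrD// -ltcR -hnE; move: bx ey; rewrite -!ball_normE.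
have eE : e = (complex.Re e)%:C by rewrite RRe_real// gtr0_real.
have re0 : 0 < complex.Re e by rewrite -ltcR -eE.
have [[x' y'] /= Txy h] := aT _ re0.
exists (x', y'); split=> //; apply: eB; split; rewrite -ball_normE /= hnE eE ltcR.
  exact: le_lt_trans (hn_hsum1 _) h.
exact: le_lt_trans (hn_hsum2 _) h.
Qed.

Lemma dense_adherent H (V : set H) : (forall x, adherent V x) -> dense V.
Proof.
move=> Vd O [x Ox] oO.
have /nbhs_ballP[e /= e0 eO] : nbhs x O by apply: open_nbhs_nbhs; split.
have eE : e = (complex.Re e)%:C by rewrite RRe_real// gtr0_real.
have re0 : 0 < complex.Re e by rewrite -ltcR -eE.
have [v Vv xv] := Vd x _ re0; exists v; split=> //; apply: eO.
by rewrite -ball_normE /= hnE eE ltcR.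
Qed.

Definition lin_rel H1 H2 (T : set (H1 * H2)) := T (0, 0) /\
  forall (c : R[i]) x x' y y', T (x, y) -> T (x', y') ->
    T (c *: x + x', c *: y + y').

Lemma lin_rel_submod H1 H2 (T : set (H1 * H2)) : lin_rel T -> submod (graph_set T).
Proof. by move=> [T0 TL]; split=> // c [x y] [x' y']; exact: TL. Qed.

Lemma lin_relN H1 H2 (T : set (H1 * H2)) x y : lin_rel T -> T (x, y) -> T (- x, - y).
Proof.
move=> [T0 TL] Txy; have := TL (-1) _ _ _ _ Txy T0.
by rewrite !scaleN1r !addr0.
Qed.

Lemma lin_relZ H1 H2 (T : set (H1 * H2)) c x y : lin_rel T -> T (x, y) -> T (c *: x, c *: y).
Proof.
by move=> [T0 TL] Txy; have := TL c _ _ _ _ Txy T0; rewrite !addr0.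
Qed.

Lemma lin_relD H1 H2 (T : set (H1 * H2)) x y x' y' : lin_rel T ->
  T (x, y) -> T (x', y') -> T (x + x', y + y').
Proof.
by move=> [T0 TL] h /(TL 1 _ _ _ _ h); rewrite !scale1r.
Qed.

Lemma lin_relB H1 H2 (T : set (H1 * H2)) x y x' y' : lin_rel T ->
  T (x, y) -> T (x', y') -> T (x - x', y - y').
Proof. by move=> TL h /(lin_relN TL); exact: lin_relD. Qed.

Lemma adjoint_lin H1 H2 (T : set (H1 * H2)) : lin_rel (adjoint T).
Proof.
split=> [x y _ /=|c x x' y y' /= h h' u v Tuv /=]; first by rewrite !inner0r.
by rewrite !innerDr !innerZr (h _ _ Tuv) (h' _ _ Tuv).
Qed.

Lemma inner_adherent H1 H2 (z w : hsum H1 H2) (V : set (hsum H1 H2)) :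
  adherent V z -> (forall v, V v -> inner v w = 0) -> inner z w = 0.
Proof.
suff key u : adherent V z -> (forall v, V v -> rip v u = 0) -> rip z u = 0.
  move=> Vz Vw; rewrite innerE key//; last by move=> v /Vw; rewrite /rip => ->.
  rewrite key// => v /Vw vw; rewrite /rip innerZr vw mulr0//.
move=> Vz Vu; apply/eqP; rewrite -normr_le0; apply: ler_all_eps => e e0; rewrite add0r.
have u1 : 0 < hn u + 1 by rewrite ltr_wpDl ?hn_ge0.
have [v Vv zv] := Vz _ (divr_gt0 e0 u1).
have -> : rip z u = rip (z - v) u by rewrite ripDl ripNl (Vu v Vv) subr0.
apply: le_trans (rip_norm _ _) _.
apply: (@le_trans _ _ (hn (z - v) * (hn u + 1))).
  by rewrite ler_wpM2l ?hn_ge0// lerDl.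
by rewrite -ler_pdivlMr// ltW.
Qed.

(** In this form the facts on adjoints and closures below become facts on
    orthogonal complements. *)
Lemma adjointE H1 H2 (T : set (H1 * H2)) a b :
  adjoint T (a, b) <->
  forall v, graph_set T v -> inner v ((- b, a) : hsum H1 H2) = 0.
Proof.
split=> [h [x y] Txy|h x y Txy /=].
  by rewrite inner_hsum/= innerNr (h _ _ Txy)/= addNr.
have := h ((x, y) : hsum H1 H2) Txy.
by rewrite inner_hsum/= innerNr addrC => /eqP; rewrite subr_eq0 => /eqP.
Qed.

Lemma adjoint_closure H1 H2 (T : set (H1 * H2)) : adjoint (closure T) = adjoint T.
Proof.
apply/seteqP; split=> -[a b] /adjointE h; apply/adjointE => -[x y] Txy.
  by apply: h; exact: (@subset_closure _ T (x, y) Txy).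
move: Txy => /closureP/inner_adherent; exact.
Qed.

Lemma adjoint_closed H1 H2 (T : set (H1 * H2)) : closure (adjoint T) `<=` adjoint T.
Proof.
move=> [a b] /closureP cab; apply/adjointE => -[x y] Txy.
rewrite inner_hsum/= innerNr addrC; apply/eqP; rewrite subr_eq0; apply/eqP.
have : inner ((a, b) : hsum H2 H1) ((y, - x) : hsum H2 H1) = 0.
  apply: inner_adherent cab _ => -[c d] cd; rewrite inner_hsum/= innerNr.
  have /(_ _ _ Txy)/= := cd.
  by rewrite (innerC y c) (innerC x d) => ->; rewrite subrr.
rewrite inner_hsum/= innerNr => /eqP; rewrite subr_eq0 => /eqP ab.
by rewrite (innerC a y) (innerC b x) ab.
Qed.

(** Project a point (a, b) of the second adjoint onto the graph of T. The
    residue (a - v1, b - v2) is orthogonal to the graph, so that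
    (b - v2, -(a - v1)) lies in the adjoint. Pairing it with the residue, which
    also lies in the second adjoint, gives -|a - v1|^2 = |b - v2|^2, so both
    vanish. *)
Lemma biadjoint H1 H2 (T : set (H1 * H2)) : lin_rel T -> closure T `<=` T ->
  adjoint (adjoint T) = T.
Proof.
move=> TL Tcl; apply/seteqP; split; last first.
  move=> [x y] Txy a b /(_ _ _ Txy)/= ab.
  by rewrite (innerC x b) (innerC y a) ab.
move=> [a b] ab.
have [|[v1 v2] /= Tv vo] :=
  @projection R (hsum H1 H2) (graph_set T) (lin_rel_submod TL) _ (a, b).
  by move=> [x y] /closureP/Tcl.
have Tv' : adjoint (adjoint T) (v1, v2).
  move=> u w /(_ _ _ Tv)/= uw.
  by rewrite (innerC v1 w) (innerC v2 u) uw.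
have o : adjoint T (b - v2, - (a - v1)).
  move=> x y Txy /=; have := vo ((x, y) : hsum H1 H2) Txy.
  rewrite inner_hsum/= innerNr => /eqP; rewrite addrC addr_eq0 => /eqP h.
  by rewrite (innerC (b - v2)) h rmorphN/= -innerC.
have := lin_relB (adjoint_lin _) ab Tv' => /(_ _ _ o)/=.
rewrite innerNl !hn_sqr -rmorphN/= => -[] h.
have h1 := sqr_ge0 (hn (a - v1)); have h2 := sqr_ge0 (hn (b - v2)).
have /eqP : hn (a - v1) ^+ 2 = 0 by apply/eqP; rewrite eq_le h1 andbT -oppr_ge0 h.
have /eqP : hn (b - v2) ^+ 2 = 0 by apply/eqP; rewrite eq_le h2 andbT -h oppr_le0.
rewrite !sqrf_eq0 => /eqP/hn0_eq0/eqP; rewrite subr_eq0 => /eqP ->.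
by move=> /eqP/hn0_eq0/eqP; rewrite subr_eq0 => /eqP ->.
Qed.

Lemma closure_lin H1 H2 (T : set (H1 * H2)) : lin_rel T -> lin_rel (closure T).
Proof.
move=> TL; split; first by apply: subset_closure; exact: TL.1.
move=> c x x' y y' /closureP h /closureP h'; apply/closureP => e e0.
have e20 : 0 < e / 2 by rewrite divr_gt0.
have c0 : 0 < complex.Re `|c| + 1 by rewrite ltr_wpDl// -ler0c RRe_real// ger0_real.
have [v Vv vy] := h _ (divr_gt0 e20 c0).
have [w Vw wz] := h' _ e20.
exists (c *: v + w); first exact: (lin_rel_submod TL).2.
rewrite (_ : _ - _ = c *: (((x, y) : hsum H1 H2) - v) + (((x', y') : hsum H1 H2) - w)).
  apply: le_lt_trans (hnD _ _) _; rewrite (splitr e) ler_ltD// hnZ.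
  apply: (@le_trans _ _ ((complex.Re `|c| + 1) * hn (((x, y) : hsum H1 H2) - v))).
    by rewrite ler_wpM2r// ?hn_ge0// lerDl.
  by rewrite mulrC -ler_pdivlMr// ltW.
by rewrite opprD scalerBr addrACA.
Qed.

(** If (0, d) lies in the closure of the graph of T, then d is orthogonal to the
    domain of S. *)
Lemma formal_adjoint_closable H1 H2 (T : set (H1 * H2)) (S : set (H2 * H1)) :
  lin_rel T -> S `<=` adjoint T -> (forall y, adherent (dom S) y) ->
  is_operator (closure T).
Proof.
move=> TL ST Sd; have cTL := closure_lin TL; split; [exact: cTL.1|exact: cTL.2|].
move=> x y y' h /(lin_relB cTL h); rewrite subrr => {}h.
apply/eqP; rewrite -subr_eq0; apply/eqP/hn0_eq0/eqP; rewrite -sqrf_eq0 -normr_le0.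
apply: ler_all_eps => e e0; rewrite add0r.
set d := y - y' in h *.
have d1 : 0 < hn d + 1 by rewrite ltr_wpDl ?hn_ge0.
have [v [w Svw] dv] := Sd d _ (divr_gt0 e0 d1).
have := ST _ Svw; rewrite -adjoint_closure => /(_ _ _ h)/=; rewrite inner0l => dv0.
have -> : hn d ^+ 2 = rip d (d - v).
  by rewrite ripDr ripNr rip_xx /rip dv0/= subr0.
apply: le_trans (rip_norm _ _) _.
apply: (@le_trans _ _ ((hn d + 1) * hn (d - v))).
  by rewrite ler_wpM2r ?hn_ge0// lerDl.
by rewrite mulrC -ler_pdivlMr// ltW.
Qed.

Lemma adjoint_operator H1 H2 (T : set (H1 * H2)) :
  (forall x, adherent (dom T) x) -> is_operator (adjoint T).
Proof.
move=> Td; have AL := adjoint_lin T; split; [exact: AL.1|exact: AL.2|].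
move=> x y y' h /(lin_relB AL h); rewrite subrr => {}h.
apply/eqP; rewrite -subr_eq0; apply/eqP/hn0_eq0/eqP; rewrite -sqrf_eq0 -normr_le0.
apply: ler_all_eps => e e0; rewrite add0r.
set d := y - y' in h *.
have d1 : 0 < hn d + 1 by rewrite ltr_wpDl ?hn_ge0.
have [v [w Svw] dv] := Td d _ (divr_gt0 e0 d1).
have := h _ _ Svw; rewrite inner0r/= => /esym dv0.
have -> : hn d ^+ 2 = rip (d - v) d.
  by rewrite ripDl ripNl rip_xx /rip dv0/= subr0.
apply: le_trans (rip_norm _ _) _.
apply: (@le_trans _ _ (hn (d - v) * (hn d + 1))).
  by rewrite ler_wpM2l ?hn_ge0// lerDl.
by rewrite -ler_pdivlMr// ltW.
Qed.

Lemma adherent_hsum H1 H2 (V1 : set H1) (V2 : set H2) (z : hsum H1 H2) :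
  adherent V1 z.1 -> adherent V2 z.2 ->
  adherent [set w : hsum H1 H2 | V1 w.1 /\ V2 w.2] z.
Proof.
move=> h1 h2 e e0; have e20 : 0 < e / 2 by rewrite divr_gt0.
have [v1 Vv1 zv1] := h1 _ e20; have [v2 Vv2 zv2] := h2 _ e20.
exists (v1, v2) => //; apply: le_lt_trans (hn_hsumD _) _.
by rewrite (splitr e) ltrD.
Qed.

(** Testing a pair of the adjoint against graph points with one zero component
    separates the two blocks: one block lies in the adjoint of T, the other in
    the adjoint of the adjoint, which is T. *)
Lemma offdiag_self_adjoint H1 H2 (T : set (H1 * H2)) :
  is_operator T -> closure T `<=` T -> (forall x, adherent (dom T) x) ->
  (forall y, adherent (dom (adjoint T)) y) ->
  self_adjoint (offdiag (adjoint T) T).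
Proof.
move=> [T0 TL Tf] Tcl Td Ad; have [A0 AL Af] := adjoint_operator Td; split.
- split=> //; first by move=> c [x x'] [u u'] [y y'] [w w'] [/= h1 h2] [/= h3 h4]; split; [exact: AL|exact: TL].
  move=> [x x'] [y y'] [w w'] [/= h1 h2] [/= h3 h4].
  by rewrite (Af _ _ _ h1 h3) (Tf _ _ _ h2 h4).
- apply: dense_adherent => z; move=> e e0.
  have [[v1 v2] [[w2 Tw] [w1 Aw]] h] := adherent_hsum (Td z.1) (Ad z.2) e0.
  by exists (v1, v2) => //; exists (w1, w2).
apply/seteqP; split=> [[[a1 a2] [b1 b2]] h|[[a1 a2] [b1 b2]] [/= h1 h2]].
  split=> /=.
    move=> x y Txy; have := h ((x, 0) : hsum H1 H2) ((0, y) : hsum H1 H2).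
    by rewrite !inner_hsum/= !inner0l add0r addr0; apply; split.
  rewrite -(biadjoint (conj T0 TL) Tcl).
  move=> x y Txy; have := h ((0, x) : hsum H1 H2) ((y, 0) : hsum H1 H2).
  by rewrite !inner_hsum/= !inner0l add0r addr0; apply; split.
move=> [x x'] [y y'] [/= Ay Ty]; rewrite !inner_hsum/=.
have /(_ _ _ h2)/= := Ay; have /(_ _ _ Ty)/= := h1 => -> e.
by rewrite addrC; congr (_ + _); rewrite innerC -e -innerC.
Qed.

Lemma offdiag_closure H1 H2 (B : set (H2 * H1)) (A : set (H1 * H2)) :
  offdiag (closure B) (closure A) = closure (offdiag B A).
Proof.
apply/seteqP; split=> -[[x1 x2] [y1 y2]].
  move=> [/= /closureP hB /closureP hA]; apply/closureP => e e0.
  have e20 : 0 < e / 2 by rewrite divr_gt0.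
  have [[u2 w1] Bu hu] := hB _ e20; have [[u1 w2] Au hu'] := hA _ e20.
  exists (((u1, u2) : hsum H1 H2), ((w1, w2) : hsum H1 H2)); first by split.
  move: hu hu'; rewrite !hn_ltE ?ltW// => h h'.
  move: h h'; rewrite !hn_hsum/=.
  have := sqr_ge0 e; rewrite exprMn (_ : 2^-1 ^+ 2 = 4^-1); last by rewrite exprVn; congr (_^-1); ring.
  by move: (e ^+ 2) (hn _ ^+ 2) (hn _ ^+ 2) (hn _ ^+ 2) (hn _ ^+ 2) => ? ? ? ? ?; lra.
move=> /closureP h; split=> /=; apply/closureP => e /h[[[u1 u2] [w1 w2]] [/= Bu Au] hu].
  exists ((u2, w1) : hsum H2 H1) => //.
  apply: le_lt_trans hu; rewrite -(@ler_pXn2r _ 2)// ?nnegrE ?hn_ge0//.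
  rewrite !hn_hsum/=.
  have := sqr_ge0 (hn (x1 - u1)); have := sqr_ge0 (hn (y2 - w2)).
  by move: (hn _ ^+ 2) (hn _ ^+ 2) (hn _ ^+ 2) (hn _ ^+ 2) => ? ? ? ?; lra.
exists ((u1, w2) : hsum H1 H2) => //.
apply: le_lt_trans hu; rewrite -(@ler_pXn2r _ 2)// ?nnegrE ?hn_ge0//.
rewrite !hn_hsum/=.
have := sqr_ge0 (hn (x2 - u2)); have := sqr_ge0 (hn (y1 - w1)).
by move: (hn _ ^+ 2) (hn _ ^+ 2) (hn _ ^+ 2) (hn _ ^+ 2) => ? ? ? ?; lra.
Qed.

End Graphs.

(** * Square roots of positive contractions *)

(** Proves an identity between linear combinations of vectors by taking inner
    products with an arbitrary vector, which turns it into an identity of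
    scalars. *)
Ltac hvec := apply: eq_innerr => ?;
  rewrite !(innerDl, innerNl, innerZl, inner0l); ring.

Section LinearMaps.
Context (R : realType) (H : hilbertType R) (A : H -> H).
Hypothesis AL : linear A.

Lemma lmap0 : A 0 = 0.
Proof. by have := AL (-1) 0 0; rewrite !scaleN1r !addNr. Qed.

Lemma lmapZ c x : A (c *: x) = c *: A x.
Proof. by have := AL c x 0; rewrite lmap0 !addr0. Qed.

Lemma lmapD x y : A (x + y) = A x + A y.
Proof. by have := AL 1 x y; rewrite !scale1r. Qed.

Lemma lmapN x : A (- x) = - A x.
Proof. by rewrite -scaleN1r lmapZ scaleN1r. Qed.

Lemma lmapB x y : A (x - y) = A x - A y.
Proof. by rewrite lmapD lmapN. Qed.

Lemma bounded_of_hn M : (forall x, hn (A x) <= M * hn x) -> bounded_op A.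
Proof.
by move=> AM; split=> //; exists M => x; rewrite !hnE -rmorphM/= lecR.
Qed.

End LinearMaps.

Lemma bounded_hn (R : realType) (H : hilbertType R) (A : H -> H) : bounded_op A ->
  linear A /\ exists2 M, 0 <= M & forall x, hn (A x) <= M * hn x.
Proof.
move=> [AL [M AM]]; split=> //; exists `|M| => // x.
apply: le_trans (_ : M * hn x <= _); first by rewrite -lecR rmorphM/= -!hnE.
by rewrite ler_wpM2r ?hn_ge0// ler_norm.
Qed.

Section SquareRoot.
Context (R : realType) (H : hilbertType R) (X : H -> H).
Hypothesis XL : linear X.
Hypothesis Xc : forall x, hn (X x) <= hn x.
Hypothesis Xs : forall x y, inner (X x) y = inner x (X y).

(** A solution Z of 2 Z - Z^2 = X is a fixed point of Y |-> (X + Y^2) / 2, and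
    this is the iteration from 0; 1 - Z is then a root of 1 - X. *)
Fixpoint rootit n : H -> H := if n is m.+1 then
  fun x => (2^-1)%:C *: (X x + rootit m (rootit m x)) else fun=> 0.

(** The same iteration for the scalar X = 1. It increases to 1 and dominates the
    operator iteration. *)
Fixpoint rootmaj n : R := if n is m.+1 then (1 + rootmaj m ^+ 2) / 2 else 0.

Let Y := rootit.
Let c := rootmaj.

Let half_norm (x : H) : hn ((2^-1)%:C *: x) = 2^-1 * hn x.
Proof. by rewrite hnZ ger0_norm ?ler0c ?invr_ge0. Qed.

Lemma rootitS n x : Y n.+1 x = (2^-1)%:C *: (X x + Y n (Y n x)).
Proof. by []. Qed.

Lemma rootmaj_bnd n : 0 <= c n <= 1 /\ (1 - c n) * n.+2%:R <= 2.
Proof.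
elim: n => [|n []]; first by rewrite /c/= ler01 lexx subr0 mul1r.
rewrite /c/= -/(c n) => /andP[c0 c1].
rewrite -[n.+3%:R]natr1; move: (n.+2%:R) (ler0n R n.+2) => k k0 h; split.
  apply/andP; split; first by rewrite divr_ge0// addr_ge0// sqr_ge0.
  nra.
by nra.
Qed.

Lemma rootmaj_le n : c n <= c n.+1.
Proof.
have [/andP[c0 c1] _] := rootmaj_bnd n.
rewrite /c/= -/(c n); have := sqr_ge0 (1 - c n); nra.
Qed.

Lemma rootit_linear n : linear (Y n).
Proof.
elim: n => [|n IH] a x y; first by rewrite /Y/= scaler0 addr0.
rewrite /Y/= -/(Y n) XL !IH scalerA mulrC -scalerA -scalerDr.
by congr (_ *: _); rewrite scalerDr addrACA.
Qed.

Lemma rootit_commute n W : linear W -> (forall x, W (X x) = X (W x)) ->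
  forall x, W (Y n x) = Y n (W x).
Proof.
move=> WL WX; elim: n => [|n IH] x; first by rewrite /Y/= lmap0.
by rewrite /Y/= -/(Y n) lmapZ// lmapD// WX !IH.
Qed.

Lemma rootit_commute2 m n x : Y m (Y n x) = Y n (Y m x).
Proof.
apply: rootit_commute; first exact: rootit_linear.
by move=> y; apply/esym/rootit_commute.
Qed.

Lemma rootit_sym n x y : inner (Y n x) y = inner x (Y n y).
Proof.
elim: n x y => [|n IH] x y; first by rewrite /Y/= inner0l inner0r.
rewrite /Y/= -/(Y n) innerZl innerZr innerDl innerDr Xs !IH.
by rewrite (CrealP _)//= realE ler0c invr_ge0 ler0n.
Qed.

Lemma rootit_bnd n x : hn (Y n x) <= c n * hn x.
Proof.
elim: n x => [|n IH] x; first by rewrite /Y/= hn0 mul0r.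
rewrite /Y/c/= -/(Y n) -/(c n) half_norm mulrC mulrAC ler_wpM2r ?invr_ge0//.
apply: le_trans (hnD _ _) _; rewrite mulrDl mul1r lerD//.
apply: le_trans (IH _) _; rewrite expr2 -mulrA ler_wpM2l//.
by have [/andP[]] := rootmaj_bnd n.
Qed.

(** All iterates commute, so that Y_{n+1}^2 - Y_n^2 is the product of
    Y_{n+1} - Y_n and Y_{n+1} + Y_n, as it is for the scalars c_n. *)
Lemma rootit_step n x : hn (Y n.+1 x - Y n x) <= (c n.+1 - c n) * hn x.
Proof.
elim: n x => [|n IH] x.
  rewrite /Y/c/= addr0 !subr0 half_norm expr0n addr0 mul1r.
  by rewrite ler_wpM2l ?invr_ge0.
have -> : Y n.+2 x - Y n.+1 x =
    (2^-1)%:C *: (Y n.+1 (Y n.+1 x + Y n x) - Y n (Y n.+1 x + Y n x)).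
  rewrite [Y n.+2 x]rootitS [X in _ - X = _]rootitS.
  by rewrite !(lmapD (rootit_linear _)) [Y n (Y n.+1 x)]rootit_commute2; hvec.
rewrite half_norm.
have -> : c n.+2 - c n.+1 = 2^-1 * ((c n.+1 - c n) * (c n.+1 + c n)).
  by rewrite {1 2}/c/= -/(c n) -/(c n.+1); field.
rewrite -mulrA ler_wpM2l ?invr_ge0//; apply: le_trans (IH _) _.
rewrite -mulrA ler_wpM2l ?subr_ge0 ?rootmaj_le//.
by apply: le_trans (hnD _ _) _; rewrite mulrDl lerD// rootit_bnd.
Qed.

Lemma rootit_dist m n x : (n <= m)%N -> hn (Y m x - Y n x) <= (c m - c n) * hn x.
Proof.
elim: m => [|m IH]; first by rewrite leqn0 => /eqP ->; rewrite !subrr hn0 mul0r.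
rewrite leq_eqVlt => /orP[/eqP ->|/IH h]; first by rewrite !subrr hn0 mul0r.
have -> : Y m.+1 x - Y n x = (Y m.+1 x - Y m x) + (Y m x - Y n x).
  by rewrite addrA subrK.
have -> : c m.+1 - c n = (c m.+1 - c m) + (c m - c n) by rewrite addrA subrK.
apply: le_trans (hnD _ _) _; rewrite mulrDl lerD//; exact: rootit_step.
Qed.

Lemma rootmaj_small (K e : R) : 0 <= K -> 0 < e ->
  exists N, forall n, (N <= n)%N -> (1 - c n) * K < e.
Proof.
move=> K0 e0; have [|N HN] := @small_inv R (e / (2 * (K + 1))).
  by rewrite divr_gt0// mulr_gt0// ltr_wpDl.
exists N => n /HN h; have [/andP[c0 c1] b] := rootmaj_bnd n.
have k0 : 0 < n.+1%:R :> R by [].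
have p : 0 < 2 * (K + 1) by rewrite mulr_gt0// ltr_wpDl.
have h2 : 2 * (K + 1) < e * n.+1%:R.
  by move: h; rewrite ltr_pdivlMr// mulrC ltr_pdivrMr.
have {}b : (1 - c n) * n.+1%:R <= 2.
  by apply: le_trans b; rewrite ler_wpM2l ?subr_ge0// ler_nat.
rewrite -(@ltr_pM2r _ n.+1%:R)// mulrAC; apply: le_lt_trans h2.
by apply: ler_pM; rewrite ?mulr_ge0 ?subr_ge0// lerDl.
Qed.

Lemma rootit_lim : exists Z, forall n x, hn (Y n x - Z x) <= (1 - c n) * hn x.
Proof.
have /choice[Z ZP] : forall x, exists z, hcvg (fun n => Y n x) z.
  move=> x; apply: hcauchy_cvg => e e0.
  have [N HN] := rootmaj_small (hn_ge0 x) e0; exists N.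
  have key m n : (n <= m)%N -> (N <= n)%N -> hn (Y m x - Y n x) < e.
    move=> nm Nn; apply: le_lt_trans (rootit_dist _ nm) _.
    apply: le_lt_trans (HN n Nn); rewrite ler_wpM2r ?hn_ge0// lerD2r.
    by have [/andP[]] := rootmaj_bnd m.
  move=> m n Nm Nn; case/orP: (leq_total n m) => h; first exact: key.
  by rewrite hnB key.
exists Z => n x; apply: ler_all_eps => e /(ZP x)[N HN].
pose m := maxn N n.
have -> : Y n x - Z x = (Y n x - Y m x) + (Y m x - Z x) by rewrite addrA subrK.
apply: le_trans (hnD _ _) _; apply: lerD; last by rewrite ltW// HN// leq_maxl.
rewrite hnB; apply: le_trans (rootit_dist x (leq_maxr N n)) _.
rewrite ler_wpM2r ?hn_ge0// lerD2r.
by have [/andP[]] := rootmaj_bnd m.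
Qed.

Lemma root_vanish (z K : R) : 0 <= K -> (forall n, z <= (1 - c n) * K) -> z <= 0.
Proof.
move=> K0 h; apply: ler_all_eps => e e0; rewrite add0r.
by have [N /(_ N (leqnn _)) /ltW] := rootmaj_small K0 e0; apply: le_trans.
Qed.

Lemma hn_le0 (x : H) : hn x <= 0 -> x = 0.
Proof. by move=> h; apply: hn0_eq0; apply/eqP; rewrite eq_le h hn_ge0. Qed.

(** The iterates are dominated by the increments of a convergent scalar
    sequence, so they converge at the rate 1 - c_n; every property of Z follows
    from the same property of the iterates by letting n grow. *)
Lemma root_contraction : exists Z : H -> H, [/\ linear Z,
  forall x, hn (Z x) <= hn x, forall x y, inner (Z x) y = inner x (Z y) &
  forall x, Z x + Z x - Z (Z x) = X x].
Proof.
have [Z ZP] := rootit_lim; exists Z.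
have d0 n : 0 <= 1 - c n by rewrite subr_ge0; have [/andP[]] := rootmaj_bnd n.
have ZL : linear Z.
  move=> a x y; apply/eqP; rewrite -subr_eq0; apply/eqP/hn_le0.
  apply: (@root_vanish _ (hn (a *: x + y) + (complex.Re `|a| * hn x + hn y))).
    by rewrite !addr_ge0 ?hn_ge0// -hnZ hn_ge0.
  move=> n; have -> : Z (a *: x + y) - (a *: Z x + Z y) =
      (Z (a *: x + y) - Y n (a *: x + y)) +
      (a *: (Y n x - Z x) + (Y n y - Z y)).
    by rewrite rootit_linear; hvec.
  rewrite mulrDr; apply: le_trans (hnD _ _) _; apply: lerD; first by rewrite hnB.
  rewrite mulrDr; apply: le_trans (hnD _ _) _; apply: lerD => //.
  rewrite hnZ mulrCA ler_wpM2l// -ler0c RRe_real// ger0_real//.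
have Zc x : hn (Z x) <= hn x.
  by have := ZP 0%N x; rewrite /Y/c/= sub0r hnN subr0 mul1r.
have Zrs x y : rip (Z x) y = rip x (Z y).
  apply/eqP; rewrite -subr_eq0 -normr_le0.
  apply: (@root_vanish _ (hn x * hn y + hn x * hn y)).
    by rewrite addr_ge0// mulr_ge0// hn_ge0.
  move=> n; have -> : rip (Z x) y - rip x (Z y) =
      rip (Z x - Y n x) y + rip x (Y n y - Z y).
    rewrite ripDl ripNl ripDr ripNr (_ : rip x (Y n y) = rip (Y n x) y).
      by rewrite addrA subrK.
    by rewrite /rip rootit_sym.
  rewrite mulrDr; apply: le_trans (ler_normD _ _) _; apply: lerD.
    by apply: le_trans (rip_norm _ _) _; rewrite mulrA ler_wpM2r ?hn_ge0// hnB.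
  by apply: le_trans (rip_norm _ _) _; rewrite mulrCA ler_wpM2l ?hn_ge0.
split=> //; first by move=> x y; rewrite !innerE !Zrs lmapZ.
move=> x; apply/eqP; rewrite -subr_eq0; apply/eqP/hn_le0.
apply: (@root_vanish _ (hn x + hn x + (hn x + hn x))).
  by rewrite !addr_ge0 ?hn_ge0.
move=> n.
have E : X x = Y n.+1 x + Y n.+1 x - Y n (Y n x).
  by rewrite !rootitS -scalerDl -rmorphD/= -[2^-1]mul1r -splitr scale1r addrK.
have -> : Z x + Z x - Z (Z x) - X x =
    ((Z x - Y n.+1 x) + (Z x - Y n.+1 x)) +
    (Y n (Y n x - Z x) + (Y n (Z x) - Z (Z x))).
  by rewrite E (lmapB (rootit_linear n)); hvec.
have d' : 1 - c n.+1 <= 1 - c n by rewrite lerD2l lerN2 rootmaj_le.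
rewrite mulrDr; apply: le_trans (hnD _ _) _; apply: lerD; rewrite mulrDr.
  apply: le_trans (hnD _ _) _.
  by apply: lerD; rewrite hnB; apply: le_trans (ZP _ _) _; rewrite ler_wpM2r ?hn_ge0.
apply: le_trans (hnD _ _) _; apply: lerD.
  apply: le_trans (rootit_bnd _ _) _; apply: le_trans (ZP n x).
  by rewrite ler_piMl ?hn_ge0//; have [/andP[]] := rootmaj_bnd n.
by apply: le_trans (ZP _ _) _; rewrite ler_wpM2l.
Qed.

End SquareRoot.

(** * Functional calculus of a self-adjoint operator *)

Section SelfAdjoint.
Context (R : realType) (H : hilbertType R) (T : set (H * H)).
Hypothesis Tsa : self_adjoint T.

Lemma sa_lin : lin_rel T.
Proof. by have [[T0 TL _] _ _] := Tsa. Qed.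

Lemma sa_fun x y y' : T (x, y) -> T (x, y') -> y = y'.
Proof. by have [[_ _ Tf] _ _] := Tsa; exact: Tf. Qed.

Lemma sa_sym x y u w : T (x, y) -> T (u, w) -> inner y u = inner x w.
Proof. by have [_ _ TE] := Tsa; rewrite -{2}TE => Txy /(_ _ _ Txy). Qed.

Lemma sa_closed x y : adherent (graph_set T) ((x, y) : hsum H H) -> T (x, y).
Proof.
by have [_ _ TE] := Tsa; move=> /closureP; rewrite -TE => /adjoint_closed.
Qed.

Lemma sa_limit (u w : nat -> H) x y : (forall n, T (u n, w n)) ->
  hcvg u x -> hcvg w y -> T (x, y).
Proof.
move=> Tuw ux wy; apply: sa_closed => e e0.
have e20 : 0 < e / 2 by rewrite divr_gt0.
have [N1 H1] := ux _ e20; have [N2 H2] := wy _ e20; pose n := maxn N1 N2.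
exists ((u n, w n) : hsum H H); first exact: Tuw.
apply: le_lt_trans (hn_hsumD _) _; rewrite (splitr e) /= hnB [hn (y - _)]hnB.
by rewrite ltrD// ?H1 ?H2// ?leq_maxl ?leq_maxr.
Qed.

(** The resolvents at i and at -i are treated together: c is either of them. *)
Section Resolvent.
Variable c : R[i].
Hypothesis cN : c^* = - c.
Hypothesis c1 : `|c| = 1.

Lemma sa_imaginary x w : T (x, w) -> rip w (c *: x) = 0.
Proof.
move=> Txw; rewrite /rip innerZr cN.
have := sa_sym Txw Txw; rewrite (innerC w x).
move: cN; case: c => a b /= [] /eqP; rewrite -subr_eq0 opprK -mulr2n mulrn_eq0/= => /eqP ->.
case: (inner w x) => p q /= [] /eqP; rewrite -subr_eq0 opprK -mulr2n mulrn_eq0/= => /eqP ->.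
by rewrite oppr0 mul0r mulr0 subr0.
Qed.

(** Since <Tx, x> is real, <Tx, cx> is purely imaginary, and (T - c) x = y obeys
    Pythagoras. *)
Lemma sa_norm x y : T (x, y + c *: x) ->
  hn y ^+ 2 = hn (y + c *: x) ^+ 2 + hn x ^+ 2.
Proof.
move=> /sa_imaginary h; rewrite -[in LHS](addrK (c *: x) y) hnB_sqr h mulr0 subr0.
by rewrite [hn (c *: x)]hnZ c1 mul1r.
Qed.

Lemma sa_resolvent_le x y : T (x, y + c *: x) -> hn x <= hn y.
Proof.
move=> /sa_norm h; rewrite -(@ler_pXn2r _ 2)// ?nnegrE ?hn_ge0//.
by rewrite h lerDr sqr_ge0.
Qed.

Lemma sa_shiftB x y x' y' : T (x, y + c *: x) -> T (x', y' + c *: x') ->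
  T (x - x', (y - y') + c *: (x - x')).
Proof.
move=> h h'; have := lin_relB sa_lin h h'.
by rewrite (_ : y + _ - _ = y - y' + c *: (x - x')); last hvec.
Qed.

(** The range of T - c is closed because T - c is bounded below. A vector u
    orthogonal to the range lies in the domain of the adjoint of T, which is T,
    with T u = c^* u; as <Tu, u> is real, u is zero. *)
Lemma sa_surj y : exists x, T (x, y + c *: x).
Proof.
have TL := sa_lin.
pose V := [set y | exists x, T (x, y + c *: x)].
have [||v Vv yv] := @projection R H V _ _ y.
- split; first by exists 0; rewrite scaler0 addr0; exact: TL.1.
  move=> a u w [x Tx] [x' Tx']; exists (a *: x + x').
  have := TL.2 a _ _ _ _ Tx Tx'; congr (T (_, _)); by hvec.
- move=> u /adherent_seq[w wu Vw]; have /choice[x Tx] := Vw.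
  have [|x0 xx0] := @hcauchy_cvg R H x.
    move=> e e0; have [N HN] := wu _ (divr_gt0 e0 (ltr0Sn _ 1)); exists N => m n Nm Nn.
    apply: le_lt_trans (sa_resolvent_le (sa_shiftB (Tx m) (Tx n))) _.
    have -> : w m - w n = (w m - u) - (w n - u) by hvec.
    by apply: le_lt_trans (hnD _ _) _; rewrite hnN (splitr e) ltrD ?HN.
  exists x0; apply: (sa_limit Tx) => // e e0.
  have [N1 H1] := wu _ (divr_gt0 e0 (ltr0Sn _ 1)).
  have [N2 H2] := xx0 _ (divr_gt0 e0 (ltr0Sn _ 1)).
  exists (maxn N1 N2) => n; rewrite geq_max => /andP[n1 n2].
  have -> : w n + c *: x n - (u + c *: x0) = (w n - u) + c *: (x n - x0) by hvec.
  apply: le_lt_trans (hnD _ _) _; rewrite hnZ c1 mul1r (splitr e).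
  by rewrite ltrD ?H1 ?H2.
set u := y - v in yv.
suff u0 : u = 0 by move/eqP: u0; rewrite subr_eq0 => /eqP ->.
have Tu : T (u, c^* *: u).
  have [_ _ TE] := Tsa; rewrite -TE => x w Txw /=.
  have h : inner u (w - c *: x) = 0 by apply: yv; exists x; rewrite subrK.
  have : inner (w - c *: x) u = 0 by rewrite innerC h rmorph0.
  rewrite innerBl innerZr conjCK -innerZl => /eqP.
  by rewrite subr_eq0 => /eqP.
have := sa_sym Tu Tu; rewrite cN innerZl innerZr rmorphN/= cN opprK hn_sqr => /eqP.
rewrite eq_sym -subr_eq0 mulNr opprK -mulr2n mulrn_eq0/= mulf_eq0.
have -> : (c == 0) = false.
  by apply/negbTE/eqP => c0; move: c1; rewrite c0 normr0 => /eqP; rewrite eq_sym oner_eq0.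
by move=> /= /eqP[] /eqP; rewrite sqrf_eq0 => /eqP/hn0_eq0.
Qed.

Lemma sa_resolvent : exists S, [/\ linear S, forall y, hn (S y) <= hn y &
  forall x y, T (x, y + c *: x) <-> S y = x].
Proof.
have /choice[S SP] := sa_surj.
have SU x y : T (x, y + c *: x) -> S y = x.
  move=> h; apply/eqP; rewrite -subr_eq0; apply/eqP/hn_le0.
  have := sa_resolvent_le (sa_shiftB (SP y) h).
  by rewrite subrr hn0.
exists S; split.
- move=> a u w; apply: SU; have := sa_lin.2 a _ _ _ _ (SP u) (SP w).
  by congr (T (_, _)); hvec.
- by move=> y; exact: sa_resolvent_le (SP y).
by move=> x y; split=> [/SU //|<-].
Qed.

End Resolvent.

Lemma conj_i : ('i%C : R[i])^* = - 'i%C.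
Proof. by apply/eqP; rewrite eq_complex/= oppr0 !eqxx. Qed.

Lemma norm_i : `|'i%C : R[i]| = 1.
Proof. by rewrite normc_def /= expr0n expr1n add0r sqrtr1. Qed.

Lemma sa_has_resolvent : exists z S, is_resolvent T z S.
Proof.
have [S [SL Sc SP]] := sa_resolvent conj_i norm_i.
exists 'i%C, S; split=> //; apply: (@bounded_of_hn _ _ _ SL 1) => x.
by rewrite mul1r.
Qed.

(** With S and S' the inverses of T - i and T + i, the inverse of 1 + T^2 is
    S' S, where S' is the adjoint of S; so X = 1 - S' S is a symmetric
    contraction, and 1 - Z is the root of S' S for the Z with 2 Z - Z^2 = X. *)
Lemma inv_sqrt_exists : exists B, is_inv_sqrt_one_plus_sq T B.
Proof.
have [S [SL Sc SP]] := sa_resolvent conj_i norm_i.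
have iN : (- 'i%C : R[i])^* = - - 'i%C by rewrite rmorphN/= conj_i.
have i1 : `|- 'i%C : R[i]| = 1 by rewrite normrN norm_i.
have [S' [SL' Sc' SP']] := sa_resolvent iN i1.
have adj u v : inner (S u) v = inner u (S' v).
  have /SP Tu : S u = S u by []. have /SP' Tv : S' v = S' v by [].
  have := sa_sym Tu Tv; rewrite innerDl innerDr innerZl innerZr rmorphN/= conj_i opprK.
  by move=> /addIr ->.
have adj' u v : inner (S' u) v = inner u (S v).
  by rewrite innerC -adj -innerC.
pose X u := u - S' (S u).
have XL : linear X by move=> a u v; rewrite /X SL SL'; hvec.
have SSr u : rip u (S' (S u)) = hn (S u) ^+ 2.
  by rewrite /rip -adj -/(rip _ _) rip_xx.
have Xc u : hn (X u) <= hn u.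
  rewrite -(@ler_pXn2r _ 2)// ?nnegrE ?hn_ge0// hnB_sqr SSr.
  have : hn (S' (S u)) ^+ 2 <= hn (S u) ^+ 2.
    by rewrite ler_pXn2r// ?nnegrE ?hn_ge0.
  have := sqr_ge0 (hn (S u)).
  by move: (hn _ ^+ 2) (hn _ ^+ 2) (hn _ ^+ 2) => ? ? ?; lra.
have Xs u v : inner (X u) v = inner u (X v).
  by rewrite /X innerBl innerBr adj' adj.
have [Z [ZL Zc Zs ZE]] := root_contraction XL Xc Xs.
have AP x y : one_plus_sq T (x, y) <-> S' (S y) = x.
  split=> [[y1 [w [/= Txy Tyw ->]]]|<-].
    have -> : S (x + w) = y1 + 'i%C *: x.
      apply/SP; have := lin_relD sa_lin Tyw (lin_relZ 'i%C sa_lin Txy).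
      by congr (T (_, _)); rewrite scalerDr scalerA -expr2 sqr_i scaleN1r; hvec.
    by apply/SP'; rewrite scaleNr addrK.
  have /SP Tu : S y = S y by []. have /SP' Tv : S' (S y) = S' (S y) by [].
  exists (S y - 'i%C *: S' (S y)), (y - S' (S y)); split=> /=.
  - by rewrite -scaleNr.
  - have := lin_relB sa_lin Tu (lin_relZ 'i%C sa_lin Tv).
    congr (T (_, _)); rewrite scalerDr scalerA mulrN -expr2 sqr_i opprK scale1r; hvec.
  - by rewrite addrC subrK.
exists (fun x => x - Z x); split.
- apply: (@bounded_of_hn _ _ _ _ 2); first by move=> a u v; rewrite ZL; hvec.
  move=> x; apply: le_trans (hnD _ _) _; rewrite hnN mulrDl mul1r.
  by rewrite lerD2l Zc.
- move=> x; have Zr : inner (Z x) x = (rip (Z x) x)%:C.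
    have := Zs x x; rewrite (innerC (Z x) x) /rip; case: (inner (Z x) x) => p q /= [] /eqP.
    by rewrite -subr_eq0 opprK -mulr2n mulrn_eq0/= => /eqP ->.
  rewrite innerBl hn_sqr Zr -rmorphB/= ler0c subr_ge0.
  by apply: le_trans (rip_le _ _) _; rewrite expr2 ler_wpM2r ?hn_ge0.
move=> x y; rewrite AP; suff -> : y - Z y - Z (y - Z y) = S' (S y) by [].
have -> : S' (S y) = y - X y by rewrite /X; hvec.
by rewrite -ZE (lmapB ZL); hvec.
Qed.

Lemma inv_sqrtP : is_inv_sqrt_one_plus_sq T (inv_sqrt_one_plus_sq T).
Proof. by apply: xgetPex; exact: inv_sqrt_exists. Qed.

Let B := inv_sqrt_one_plus_sq T.
Let F := bounded_transform T.

Lemma inv_sqrt_linear : linear B.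
Proof. by have [/bounded_hn[]] := inv_sqrtP. Qed.

(** The form <Bz, z> is nonnegative, hence real, and polarization applies. *)
Lemma inv_sqrt_sym x y : inner (B x) y = inner x (B y).
Proof.
have [_ B0 _] := inv_sqrtP; have BL := inv_sqrt_linear.
have Br z : (inner (B z) z)^* = inner (B z) z.
  by apply/CrealP; rewrite ger0_real.
have h1 := Br (x + y); have h2 := Br (x + 'i%C *: y).
move: h1 h2 (Br x) (Br y); rewrite !(lmapD BL) !(lmapZ BL) !innerDl !innerDr !innerZl !innerZr.
rewrite conj_i (innerC (B y) x).
case: (inner (B x) x) => p1 q1; case: (inner (B y) y) => p2 q2.
case: (inner (B x) y) => p3 q3; case: (inner (B y) x) => p4 q4.
simpc => /= -[] h1 [] h2 [] h3 [] h4; congr (_ +i* _); lra.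
Qed.

(** For x = B (B u) one has <Tx, Tx> = <x, T^2 x> = <x, u - x>, which is
    |B u|^2 - |x|^2. *)
Lemma transform_range u : exists2 y, T (B (B u), y) & hn y <= hn (B u).
Proof.
have [_ _ BP] := inv_sqrtP; have [_ /(_ erefl)[y [w [/= Tx Ty uE]]]] := BP (B (B u)) u.
exists y => //; rewrite -(@ler_pXn2r _ 2)// ?nnegrE ?hn_ge0//.
rewrite -rip_xx /rip (sa_sym Tx Ty) -/(rip _ _).
have -> : w = u - B (B u) by apply/eqP; rewrite eq_sym subr_eq [w + _]addrC; apply/eqP.
rewrite ripDr ripNr rip_xx /rip inv_sqrt_sym -/(rip _ _) rip_xx.
by rewrite gerBl sqr_ge0.
Qed.

(** B is symmetric and has trivial kernel, because B^2 is the inverse of an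
    operator. *)
Lemma inv_sqrt_range_dense x : adherent (range B) x.
Proof.
have BL := inv_sqrt_linear.
apply: dense_of_orthogonal.
  split; first by exists 0; rewrite ?lmap0.
  by move=> c _ _ [u _ <-] [v _ <-]; exists (c *: u + v); rewrite ?BL.
move=> z zV.
have Bz : B z = 0.
  by apply: eq_innerr => v; rewrite inv_sqrt_sym inner0l zV//; exists v.
have [_ _ BP] := inv_sqrtP; have [_ /(_ _)[]] := BP 0 z.
  by rewrite -/B Bz (lmap0 BL).
move=> y [w [/= T0y Tyw ->]]; rewrite add0r.
have y0 : y = 0 by apply: sa_fun T0y _; exact: sa_lin.1.
by apply: sa_fun Tyw _; rewrite y0; exact: sa_lin.1.
Qed.

(** By [transform_range], T B is a contraction on the dense range of B. For
    arbitrary x, approximate x from there; the images form a Cauchy sequence,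
    and the graph of T is closed. *)
Lemma transform_total x : exists2 y, T (B x, y) & hn y <= hn x.
Proof.
have [/bounded_hn[BL [M M0 BM]] _ _] := inv_sqrtP; rewrite -/B in BL BM.
have [u ux Vu] := adherent_seq (inv_sqrt_range_dense x).
have /choice[v vu] : forall n, exists v, B v = u n.
  by move=> n; have [v _ <-] := Vu n; exists v.
have /choice[w wP] : forall n, exists w, T (B (u n), w) /\ hn w <= hn (u n).
  by move=> n; have [w ? ?] := transform_range (v n); exists w; rewrite -vu.
have wB m n : hn (w m - w n) <= hn (u m - u n).
  have [y Ty] := transform_range (v m - v n).
  rewrite (lmapB BL) !vu in Ty *; congr (hn _ <= _); apply: sa_fun Ty _.
  rewrite (lmapB BL); apply: (lin_relB sa_lin); [exact: (wP m).1|exact: (wP n).1].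
have [|y wy] := @hcauchy_cvg R H w.
  move=> e e0; have [N HN] := ux _ (divr_gt0 e0 (ltr0Sn _ 1)); exists N => m n Nm Nn.
  apply: le_lt_trans (wB m n) _.
  have -> : u m - u n = (u m - x) - (u n - x) by hvec.
  by apply: le_lt_trans (hnD _ _) _; rewrite hnN (splitr e) ltrD ?HN.
exists y.
  apply: (sa_limit (fun n => (wP n).1)) => // e e0.
  have M1 : 0 < M + 1 by rewrite ltr_wpDl.
  have [N HN] := ux _ (divr_gt0 e0 M1); exists N => n /HN h.
  rewrite -(lmapB BL); apply: le_lt_trans (BM _) _.
  apply: (@le_lt_trans _ _ ((M + 1) * hn (u n - x))).
    by rewrite ler_wpM2r ?hn_ge0// lerDl.
  by rewrite mulrC -ltr_pdivlMr.
apply: ler_all_eps => e e0; have e20 : 0 < e / 2 by rewrite divr_gt0.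
have [N1 H1] := ux _ e20; have [N2 H2] := wy _ e20; pose n := maxn N1 N2.
have -> : y = (y - w n) + w n by rewrite subrK.
apply: le_trans (hnD _ _) _; rewrite addrC (splitr e) addrA; apply: lerD.
  apply: le_trans (wP n).2 _; have -> : u n = x + (u n - x) by rewrite addrC subrK.
  by apply: le_trans (hnD _ _) _; rewrite lerD2l ltW// H1// leq_maxl.
by rewrite hnB ltW// H2// leq_maxr.
Qed.

Lemma transformP x : T (B x, F x).
Proof.
have [y Ty _] := transform_total x.
exact: (@xgetPex _ 0 [set y | T (B x, y)] (ex_intro _ y Ty)).
Qed.

Lemma transform_bounded : bounded_op F.
Proof.
apply: (@bounded_of_hn _ _ _ _ 1).
  move=> a u v; apply: sa_fun (transformP _) _; rewrite inv_sqrt_linear.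
  by apply: sa_lin.2; exact: transformP.
move=> x; rewrite mul1r; have [y Ty] := transform_total x.
by rewrite (sa_fun (transformP x) Ty).
Qed.

(** On the kernel B^2 is the identity, so B x - x is an eigenvector of the
    nonnegative operator B for the eigenvalue -1, hence zero. *)
Lemma inv_sqrt_ker x : ker T x -> B x = x.
Proof.
move=> Tx; have [_ B0 BP] := inv_sqrtP; have BL := inv_sqrt_linear.
have BBx : B (B x) = x.
  by apply/BP; exists 0, 0; split; rewrite /= ?addr0//; exact: sa_lin.1.
apply/eqP; rewrite -subr_eq0; apply/eqP/hn0_eq0/eqP; rewrite -sqrf_eq0.
have BN : B (B x - x) = - (B x - x) by rewrite (lmapB BL) BBx opprB.
have := B0 (B x - x); rewrite -/B BN innerNl hn_sqr.
by rewrite -rmorphN/= ler0c oppr_ge0 => h; rewrite eq_le h sqr_ge0.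
Qed.

Lemma transform_ker x : ker T x -> F x = 0.
Proof.
by move=> Tx; have := transformP x; rewrite inv_sqrt_ker// => /sa_fun/(_ Tx).
Qed.

End SelfAdjoint.

(** * Compact operators on infinite-dimensional subspaces *)

Section Compact.
Context (R : realType) (H : hilbertType R).

Lemma submod_sum (V : set H) n (a : 'I_n -> R[i]) (v : 'I_n -> H) :
  submod V -> (forall i, V (v i)) -> V (\sum_i a i *: v i).
Proof.
move=> [V0 VL] Vv; elim/big_ind: _ => // [x y Vx Vy|i _].
  by rewrite -[x]scale1r; exact: VL.
by rewrite -[_ *: _]addr0; exact: VL.
Qed.

Lemma inner_suml n (v : 'I_n -> H) z : inner (\sum_i v i) z = \sum_i inner (v i) z.
Proof.
elim/big_ind2: _ => [|x a y b <- <-|//]; [exact: inner0l|exact: innerDl].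
Qed.

(** Given e_1 ... e_n, the matrix <v_i, e_j> of n + 1 independent vectors v_i of
    V has a nonzero left kernel vector, whose entries are the coefficients of a
    nonzero vector of V orthogonal to all the e_j. *)
Lemma orthonormal_family (V : set H) : submod V -> infinite_dimensional V ->
  forall n, exists e : 'I_n -> H, (forall i, V (e i)) /\
    forall i j, inner (e i) (e j) = (i == j)%:R.
Proof.
move=> Vs Vi; elim=> [|n [e [Ve eo]]]; first by exists (fun=> 0); split; case.
have [v [Vv vf]] := Vi n.+1.
pose M := \matrix_(i < n.+1, j < n) inner (v i) (e j).
have /rowV0Pn[c /sub_kermxP cM c0] : kermx M != 0.
  rewrite kermx_eq0 /row_free; apply/negP => /eqP h.
  by have := rank_leq_col M; rewrite h ltnn.
pose w := \sum_i c 0 i *: v i.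
have w0 : hn w != 0.
  apply: contra_neq c0 => /hn0_eq0/vf cz; apply/rowP => i; rewrite mxE; exact: cz.
have we j : inner w (e j) = 0.
  transitivity ((c *m M) 0 j); last by rewrite cM mxE.
  rewrite /w inner_suml mxE; apply: eq_bigr => i _; by rewrite mxE innerZl.
pose w1 := (hn w)^-1%:C *: w.
have w1e j : inner w1 (e j) = 0 by rewrite innerZl we mulr0.
have w11 : inner w1 w1 = 1.
  by rewrite hn_sqr hnZr -exprMn mulVf// expr1n.
have Vw1 : V w1 by rewrite -[w1]addr0; apply: Vs.2; [exact: submod_sum|exact: Vs.1].
exists (fun i => if unlift ord_max i is Some j then e j else w1); split.
  by move=> i; case: (unlift _ _).
move=> i j; case: (unliftP ord_max i) => [i' ->|->]; case: (unliftP ord_max j) => [j' ->|->].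
- by rewrite eo (inj_eq lift_inj).
- by rewrite innerC w1e rmorph0 eq_sym (negbTE (neq_lift _ _)).
- by rewrite w1e (negbTE (neq_lift _ _)).
- by rewrite w11 eqxx.
Qed.

(** The image of the unit ball contains c e_i for arbitrarily long orthonormal
    families, and these points are at distance sqrt 2 |c| from each other. A
    finite cover by balls of radius |c| / 2 has at most one of them in each
    ball. *)
Lemma compact_not_scalar (A : H -> H) (V : set H) c : submod V ->
  infinite_dimensional V -> c != 0 -> (forall x, V x -> A x = c *: x) ->
  ~ compact_op A.
Proof.
move=> Vs Vi c0 AV [_]; rewrite compact_cover => cK.
set K := closure _ in cK.
have r0 : 0 < `|c| / 2 by rewrite divr_gt0// normr_gt0.
have KB : K `<=` cover setT (fun x => (ball x (`|c| / 2))^°).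
  by move=> x _; exists x => //; apply: nbhs_singleton; apply: nbhs_interior; exact: nbhsx_ballx.
have [D _ KD] := cK H setT _ (fun x _ => @open_interior _ _) KB.
pose s : seq H := finmap.enum_fset D.
have [e [Ve eo]] := orthonormal_family Vs Vi (size s).+1.
have Ke i : K (c *: e i).
  apply: subset_closure; exists (e i); last exact: AV.
  have := hn_sqr (e i); rewrite eo eqxx => -[] /esym/eqP.
  by rewrite /= hnE sqrp_eq1 ?hn_ge0// => /eqP ->.
have /choice[g gP] i : exists x, x \in s /\ ball x (`|c| / 2) (c *: e i).
  by have [x xD /interior_subset xi] := KD _ (Ke i); exists x.
have gi : injective g.
  move=> i j gij; apply/eqP; apply: contraT => ij.
  have [_ bi] := gP i; have [_ bj] := gP j; rewrite gij in bi.
  have : `|c *: e i - c *: e j| < `|c|.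
    have -> : c *: e i - c *: e j = (g j - c *: e j) - (g j - c *: e i) by hvec.
    rewrite [ltRHS]splitr; apply: le_lt_trans (ler_normB _ _) _.
    by move: bi bj; rewrite -!ball_normE /= => bi bj; exact: ltrD.
  rewrite -scalerBr normrZ gtr_pMr ?normr_gt0// hnE ltcR => h.
  have : hn (e i - e j) ^+ 2 = 2.
    rewrite -rip_xx /rip innerBl !innerBr !eo !eqxx (negbTE ij) eq_sym (negbTE ij).
    by rewrite subr0 sub0r opprK.
  by have := hn_ge0 (e i - e j); nra.
have : (size (map g (enum 'I_(size s).+1)) <= size s)%N.
  apply: uniq_leq_size; first by rewrite map_inj_uniq ?enum_uniq.
  by move=> _ /mapP[i _ ->]; exact: (gP i).1.
by rewrite size_map size_enum_ord ltnn.
Qed.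

End Compact.

(** * Calculus of C^k functions on the plane *)

Section Ck_calculus.
Context (R : realType).
Implicit Types (f g w : R * R -> R) (p v : R * R).

Lemma Ck_continuous k f : Ck k f -> continuous f.
Proof. by case: k => [|k] []. Qed.

Lemma CkW k f : Ck k.+1 f -> Ck k f.
Proof.
elim: k f => [|k IH] f; first by move=> [].
by move=> [cf [df /IH fx /IH fy]]; split.
Qed.

Lemma Ck_cst k (a : R) : Ck k (fun=> a).
Proof.
elim: k a => [|k IH] a; (split; first by move=> p; exact: cvg_cst) => //.
have D v : 'D_v (fun=> a : R) = (fun=> 0) :> (R * R -> R).
  by apply/funext => p; exact: derive_cst.
by split; rewrite ?D//; move=> p; split; exact: derivable_cst.
Qed.

Lemma CkD k f g : Ck k f -> Ck k g -> Ck k (fun p => f p + g p).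
Proof.
elim: k f g => [|k IH] f g.
  by move=> [cf _] [cg _]; split=> // p; apply: cvgD; [exact: cf|exact: cg].
move=> [cf [df fx fy]] [cg [dg gx gy]]; split.
  by move=> p; apply: cvgD; [exact: cf|exact: cg].
have D v : (forall p, derivable f p v) -> (forall p, derivable g p v) ->
    'D_v (fun p => f p + g p) = (fun p => 'D_v f p + 'D_v g p).
  by move=> fv gv; apply/funext => p; exact: (deriveD (fv p) (gv p)).
split.
- move=> p; have [fp1 fp2] := df p; have [gp1 gp2] := dg p.
  by split; [exact: (derivableD fp1 gp1)|exact: (derivableD fp2 gp2)].
- by rewrite D; [exact: IH|move=> p; exact: (df p).1|move=> p; exact: (dg p).1].
- by rewrite D; [exact: IH|move=> p; exact: (df p).2|move=> p; exact: (dg p).2].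
Qed.

Lemma CkM k f g : Ck k f -> Ck k g -> Ck k (fun p => f p * g p).
Proof.
elim: k f g => [|k IH] f g.
  by move=> [cf _] [cg _]; split=> // p; apply: cvgM; [exact: cf|exact: cg].
move=> fS gS; have fk := CkW fS; have gk := CkW gS.
move: fS gS => [cf [df fx fy]] [cg [dg gx gy]]; split.
  by move=> p; apply: cvgM; [exact: cf|exact: cg].
have D v : (forall p, derivable f p v) -> (forall p, derivable g p v) ->
    'D_v (fun p => f p * g p) = (fun p => f p * 'D_v g p + g p * 'D_v f p).
  by move=> fv gv; apply/funext => p; exact: (deriveM (fv p) (gv p)).
split.
- move=> p; have [fp1 fp2] := df p; have [gp1 gp2] := dg p.
  by split; [exact: (derivableM fp1 gp1)|exact: (derivableM fp2 gp2)].
- by rewrite D; [apply: CkD; exact: IH|move=> p; exact: (df p).1|move=> p; exact: (dg p).1].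
- by rewrite D; [apply: CkD; exact: IH|move=> p; exact: (df p).2|move=> p; exact: (dg p).2].
Qed.

Lemma CkZ k a f : Ck k f -> Ck k (fun p => a * f p).
Proof. by move=> fk; apply: CkM => //; exact: Ck_cst. Qed.

Lemma CkN k f : Ck k f -> Ck k (fun p => - f p).
Proof. by move=> /(CkZ (-1)); under eq_fun do rewrite mulN1r. Qed.

Lemma CkB k f g : Ck k f -> Ck k g -> Ck k (fun p => f p - g p).
Proof. by move=> fk /CkN; exact: CkD. Qed.

Lemma is_derive_along (V : normedModType R) (f : V -> R) (g : R -> R) (p v : V) (t d : R) :
  (forall h, f (h *: v + p) = g (h + t)) -> is_derive t 1 g d -> is_derive p v f d.
Proof.
move=> fg [dg gd].
have E : (fun h : R => h^-1 *: ((f \o shift p) (h *: v) - f p)) =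
         (fun h : R => h^-1 *: ((g \o shift t) (h *: (1 : R)) - g t)).
  apply/funext => h /=; rewrite fg [h *: (1 : R)]mulr1.
  by have := fg 0; rewrite scale0r !add0r => ->.
by apply: DeriveDef; rewrite /derivable /derive ?E.
Qed.

Lemma is_derive_line (V : normedModType R) (f : V -> R) (g : R -> R) (p v : V) (t d : R) :
  (forall h, f (h *: v + p) = g (h + t)) -> is_derive p v f d -> is_derive t 1 g d.
Proof.
move=> fg [df fd].
have E : (fun h : R => h^-1 *: ((f \o shift p) (h *: v) - f p)) =
         (fun h : R => h^-1 *: ((g \o shift t) (h *: (1 : R)) - g t)).
  apply/funext => h /=; rewrite fg [h *: (1 : R)]mulr1.
  by have := fg 0; rewrite scale0r !add0r => ->.
by apply: DeriveDef; rewrite /derivable /derive -?E.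
Qed.

Lemma is_derive_fst p v : is_derive p v (fst : R * R -> R) v.1.
Proof.
apply: (@is_derive_along _ _ (fun t => t * v.1 + p.1) _ _ 0) => [h|].
  by rewrite addr0.
by apply: is_derive_eq; rewrite scaler0 addr0 add0r [_ *: _]mulr1.
Qed.

Lemma is_derive_snd p v : is_derive p v (snd : R * R -> R) v.2.
Proof.
apply: (@is_derive_along _ _ (fun t => t * v.2 + p.2) _ _ 0) => [h|].
  by rewrite addr0.
by apply: is_derive_eq; rewrite scaler0 addr0 add0r [_ *: _]mulr1.
Qed.

Lemma Ck_fst k : Ck k (fst : R * R -> R).
Proof.
case: k => [|k]; (split; first by move=> p; exact: cvg_fst) => //.
have D v : 'D_v (fst : R * R -> R) = (fun=> v.1).
  by apply/funext => p; have [] := is_derive_fst p v.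
split; [|by rewrite D; exact: (Ck_cst k)|by rewrite D; exact: (Ck_cst k)].
by move=> p; split; [have [h _] := is_derive_fst p (1, 0)|have [h _] := is_derive_fst p (0, 1)];
  exact: h.
Qed.

Lemma Ck_snd k : Ck k (snd : R * R -> R).
Proof.
case: k => [|k]; (split; first by move=> p; exact: cvg_snd) => //.
have D v : 'D_v (snd : R * R -> R) = (fun=> v.2).
  by apply/funext => p; have [] := is_derive_snd p v.
split; [|by rewrite D; exact: (Ck_cst k)|by rewrite D; exact: (Ck_cst k)].
by move=> p; split; [have [h _] := is_derive_snd p (1, 0)|have [h _] := is_derive_snd p (0, 1)];
  exact: h.
Qed.

Lemma is_derive_comp1 (phi : R -> R) w p v (a b : R) :
  is_derive (w p) 1 phi a -> is_derive p v w b ->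
  is_derive p v (fun q => phi (w q)) (a * b).
Proof.
move=> dphi dw.
have dw1 : is_derive (0 : R) 1 (fun h : R => w (h *: v + p)) b.
  by apply: is_derive_line dw => h; rewrite addr0.
apply: (@is_derive_along _ _ (phi \o (fun h : R => w (h *: v + p))) _ _ 0) => [h|].
  by rewrite /= addr0.
have dphi' : is_derive (w ((0 : R) *: v + p)) 1 phi a by rewrite scale0r add0r.
exact: is_derive1_comp.
Qed.

Lemma mean_value (g dg : R -> R) (a b : R) : (forall t : R, is_derive t 1 g (dg t)) ->
  exists2 c, `|c - a| <= `|b - a| & g b - g a = dg c * (b - a).
Proof.
move=> dgP; have cg (x y : R) : {within `[x, y], continuous g}.
  apply: continuous_subspaceT => t.
  by apply/differentiable_continuous/derivable1_diffP; have [] := dgP t.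
have [ab|/ltW ba] := leP a b.
  have [c + E] := MVT_segment ab (fun t _ => dgP t) (@cg a b).
  rewrite in_itv/= => /andP[ac cb]; exists c => //.
  by rewrite !ger0_norm ?subr_ge0// lerD2r.
have [c + E] := MVT_segment ba (fun t _ => dgP t) (@cg b a).
rewrite in_itv/= => /andP[bc ca]; exists c.
  by rewrite !ler0_norm ?subr_le0// lerN2 lerD2r.
by rewrite -opprB E -mulrN opprB.
Qed.

Lemma Ck1_line1 f (x y : R) : Ck 1 f ->
  is_derive x 1 (fun t => f (t, y)) ('D_(1, 0) f (x, y)).
Proof.
move=> [_ [df _ _]]; apply: (@is_derive_line _ f _ (x, y) (1, 0)) => [h|].
  by congr f; congr (_, _) => /=; rewrite /GRing.scale/= ?mulr1// mulr0 add0r.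
exact/derivableP/(df _).1.
Qed.

Lemma Ck1_line2 f (x y : R) : Ck 1 f ->
  is_derive y 1 (fun t => f (x, t)) ('D_(0, 1) f (x, y)).
Proof.
move=> [_ [df _ _]]; apply: (@is_derive_line _ f _ (x, y) (0, 1)) => [h|].
  by congr f; congr (_, _) => /=; rewrite /GRing.scale/= ?mulr1// mulr0 add0r.
exact/derivableP/(df _).2.
Qed.

Lemma diff_of_expansion (V W : normedModType R) (f d : V -> W) (x : V) : linear d ->
  continuous d ->
  (forall e : R, 0 < e -> \forall h \near (0 : V), `|f (h + x) - (f x + d h)| <= e * `|h|) ->
  (differentiable f x) /\ (forall h, 'd f x h = d h).
Proof.
move=> dL cd fd; pose dM := GRing.isLinear.Build _ _ _ _ _ dL.
pose dl : {linear _ -> _} := HB.pack d dM.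
have E : f \o shift x = cst (f x) + dl +o_ 0 id by apply/eqaddoP => e e0; exact: fd.
have dE := @diff_unique _ _ _ f dl x cd E.
split; last by move=> h; rewrite dE.
by apply/diff_locallyP; rewrite dE.
Qed.

(** Continuous partial derivatives imply differentiability: the increment is
    split along the two axes, and the mean value theorem is applied to each
    part. *)
Lemma Ck1_diff f p : Ck 1 f -> (differentiable f p) /\
  (forall h : R * R, 'd f p h = h.1 * 'D_(1, 0) f p + h.2 * 'D_(0, 1) f p).
Proof.
move=> f1; have [cf [df [cx _] [cy _]]] := f1.
pose d (h : R * R) := h.1 * 'D_(1, 0) f p + h.2 * 'D_(0, 1) f p.
have dL : linear d.
  move=> a x y; rewrite /d/= /GRing.scale/=; ring.
have cd : continuous d.
  by move=> h; apply: cvgD; apply: cvgMl; [exact: cvg_fst|exact: cvg_snd].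
apply: (@diff_of_expansion _ _ f d) => // e e0.
  have e20 : 0 < e / 2 by rewrite divr_gt0.
  have /cvgrPdist_le/(_ _ e20)/nbhs_ballP[r1 /= r10 B1] := cx p.
  have /cvgrPdist_le/(_ _ e20)/nbhs_ballP[r2 /= r20 B2] := cy p.
  apply/nbhs_ballP; exists (Num.min r1 r2) => /=; first by rewrite lt_min r10.
  move=> [h1 h2] [/=]; rewrite /ball/= sub0r normrN sub0r normrN !lt_min.
  move=> /andP[h1r1 h1r2] /andP[h2r1 h2r2].
  case: p @d dL cd B1 B2 => x y d dL cd B1 B2 /=.
  have [c1 c1h E1] := mean_value x (h1 + x) (fun t => Ck1_line1 t (h2 + y) f1).
  have [c2 c2h E2] := mean_value y (h2 + y) (fun t => Ck1_line2 x t f1).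
  rewrite addrK in c1h E1; rewrite addrK in c2h E2.
  have -> : f (h1 + x, h2 + y) - (f (x, y) + d (h1, h2)) =
      h1 * ('D_(1, 0) f (c1, h2 + y) - 'D_(1, 0) f (x, y)) +
      h2 * ('D_(0, 1) f (x, c2) - 'D_(0, 1) f (x, y)).
    have -> : f (h1 + x, h2 + y) = (f (h1 + x, h2 + y) - f (x, h2 + y)) +
      (f (x, h2 + y) - f (x, y)) + f (x, y) by ring.
    by rewrite E1 E2 /d/=; ring.
  have n1 : `|h1| <= `|(h1, h2)| by rewrite prod_normE/= le_max lexx.
  have n2 : `|h2| <= `|(h1, h2)| by rewrite prod_normE/= le_max lexx orbT.
  have b1 : `|'D_(1, 0) f (c1, h2 + y) - 'D_(1, 0) f (x, y)| <= e / 2.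
    rewrite distrC; apply: B1; split; rewrite /ball/=.
      by rewrite distrC (le_lt_trans c1h).
    by rewrite distrC addrK.
  have b2 : `|'D_(0, 1) f (x, c2) - 'D_(0, 1) f (x, y)| <= e / 2.
    rewrite distrC; apply: B2; split; rewrite /ball/=.
      by rewrite subrr normr0.
    by rewrite distrC (le_lt_trans c2h).
  apply: le_trans (ler_normD _ _) _; rewrite !normrM (splitr e) mulrDl.
  by apply: lerD; rewrite mulrC ler_pM.
Qed.

Lemma Ck1_curve f (a b : R -> R) (t da db : R) : Ck 1 f ->
  is_derive t 1 a da -> is_derive t 1 b db ->
  is_derive t 1 (fun s => f (a s, b s))
    (da * 'D_(1, 0) f (a t, b t) + db * 'D_(0, 1) f (a t, b t)).
Proof.
move=> f1 [ad aE] [bd bE]; have [fd fE] := Ck1_diff (a t, b t) f1.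
have {}ad : differentiable a t by exact/derivable1_diffP.
have {}bd : differentiable b t by exact/derivable1_diffP.
have pd := differentiable_pair ad bd.
have cd : differentiable (f \o (fun s => (a s, b s))) t by exact: differentiable_comp.
apply: DeriveDef; first exact/derivable1_diffP.
rewrite deriveE// diff_comp//= fE diff_pair//=.
by rewrite -!deriveE// aE bE.
Qed.

End Ck_calculus.

(** * Smooth bump functions *)

Section SmoothStep.
Context (R : realType).

(** P(1/t) exp(-1/t) for t > 0, extended by 0. This class of functions is closed
    under differentiation ([is_derive_flat]), so each of its members is smooth. *)
Definition flat (P : {poly R}) (t : R) : R :=
  if 0 < t then P.[t^-1] * expR (- t^-1) else 0.

Lemma poly_bound (P : {poly R}) : exists2 K, 0 <= K &
  forall x, 1 <= x -> `|P.[x]| <= K * x ^+ size P.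
Proof.
exists (\sum_(i < size P) `|P`_i|); first exact: sumr_ge0.
move=> x x1; rewrite horner_coef (le_trans (ler_norm_sum _ _ _))// mulr_suml.
apply: ler_sum => i _; have x0 : 0 <= x by apply: le_trans x1.
rewrite normrM ler_wpM2l// ger0_norm ?exprn_ge0//.
by rewrite ler_weXn2l// ltnW.
Qed.

(** The exponential beats the polynomial: exp(1/t) is at least a multiple of
    t^-(n+2), where n bounds the degree of P. The order 2 makes the derivative
    at 0 exist and vanish. *)
Lemma flat_bound (P : {poly R}) : exists2 K, 0 <= K &
  forall t, 0 < t <= 1 -> `|flat P t| <= K * t ^+ 2.
Proof.
have [K K0 KP] := poly_bound P; pose n := size P.
exists (K * (n.+2)`!%:R); first by rewrite mulr_ge0.
move=> t /andP[t0 t1]; rewrite /flat t0.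
have x1 : 1 <= t^-1 by rewrite invf_ge1.
have x0 : 0 < t^-1 by rewrite invr_gt0.
rewrite normrM (ger0_norm (expR_ge0 _)).
apply: le_trans (_ : K * t^-1 ^+ n * expR (- t^-1) <= _).
  by rewrite ler_wpM2r ?expR_ge0// KP.
rewrite -mulrA -mulrA ler_wpM2l// expRN ler_pdivrMr ?expR_gt0//.
have f0 : 0 < (n.+2)`!%:R :> R by rewrite ltr0n fact_gt0.
have := expR_ge1Dxn n.+1 (ltW x0) => h.
have {}h : t^-1 ^+ n.+2 <= (n.+2)`!%:R * expR t^-1.
  by rewrite mulrC -ler_pdivrMr//; apply: le_trans h; rewrite lerDr.
rewrite mulrAC; apply: le_trans (_ : t^-1 ^+ n.+2 * t ^+ 2 <= _).
  rewrite -addn2 exprD -mulrA -exprMn mulVf ?gt_eqF//.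
  by rewrite expr1n mulr1.
by rewrite ler_wpM2r// sqr_ge0.
Qed.

Lemma is_derive_flat (P : {poly R}) (t : R) :
  is_derive t 1 (flat P) (flat ('X^2 * (P - P^`())) t).
Proof.
have [t0|t0|->] := ltgtP t 0.
- have -> : flat ('X^2 * (P - P^`())) t = 0 by rewrite /flat ltNge (ltW t0).
  apply: (@near_eq_is_derive _ _ _ (fun=> 0)).
  have := lt_nbhsl t0; apply: filterS => x x0.
    by rewrite /flat ltNge (ltW x0).
- have ne : \forall x \near t, P.[x^-1] * expR (- x^-1) = flat P x.
    by have := lt_nbhsr t0; apply: filterS => x x0; rewrite /flat x0.
  apply: (near_eq_is_derive ne).
  have tn : t != 0 by rewrite gt_eqF.
  have dV : is_derive t 1 (fun t : R => t^-1) (- t^-1 ^+ 2).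
    have := @is_deriveV _ id t 1 1 tn (is_derive_id t 1).
    by rewrite [_ *: _]mulr1 exprVn.
  have dP : is_derive t 1 (fun t : R => P.[t^-1]) (P^`().[t^-1] * (- t^-1 ^+ 2)).
    exact: (@is_derive1_comp _ (horner P) (fun t : R => t^-1)).
  have dE : is_derive t 1 (fun t : R => expR (- t^-1)) (expR (- t^-1) * t^-1 ^+ 2).
    have dN : is_derive t 1 (fun t : R => - t^-1) (t^-1 ^+ 2).
      by rewrite -[t^-1 ^+ 2]opprK; exact: is_deriveN.
    exact: (@is_derive1_comp _ expR (fun t : R => - t^-1)).
  have -> : flat ('X^2 * (P - P^`())) t = P.[t^-1] *: (expR (- t^-1) * t^-1 ^+ 2) +
      expR (- t^-1) *: (P^`().[t^-1] * (- t^-1 ^+ 2)).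
    by rewrite /flat t0 !hornerE /GRing.scale/=; ring.
  exact: (is_deriveM dP dE).
have -> : flat ('X^2 * (P - P^`())) 0 = 0 by rewrite /flat ltxx.
have [K K0 KP] := flat_bound P.
have lim0 : (fun h : R => h^-1 *: ((flat P \o shift 0) (h *: (1 : R)) - flat P 0)) @ 0^' --> 0.
  apply/cvgrPdist_le => e e0; near=> h.
  rewrite /= sub0r normrN [h *: (1 : R)]mulr1 addr0.
  rewrite {2}/flat ltxx subr0.
  have hn : h != 0 by near: h; exact: nbhs_dnbhs_neq.
  have [h0|h0] := ltP 0 h; last by rewrite /flat ltNge h0 scaler0 normr0 ltW.
  have hs : `|h| < Num.min 1 (e / (K + 1)).
    near: h; apply: dnbhs0_lt; rewrite lt_min ltr01 divr_gt0//.
    by rewrite ltr_wpDl.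
  move: hs; rewrite gtr0_norm// lt_min => /andP[h1 he].
  rewrite normrM normfV (gtr0_norm h0) ler_pdivrMl//.
  apply: le_trans (KP h _) _; first by rewrite h0 ltW.
  rewrite expr2 mulrA mulrC ler_pM2l//.
  have : h * (K + 1) <= e by rewrite -ler_pdivlMr ?ltW// ltr_wpDl.
  by apply: le_trans; rewrite mulrDr mulr1 mulrC lerDl ltW.
apply: DeriveDef; first by apply/cvg_ex; exists 0.
exact: cvg_lim lim0.
Unshelve. all: by end_near. Qed.

Lemma flat_continuous (P : {poly R}) : continuous (flat P).
Proof.
move=> t; apply/differentiable_continuous/derivable1_diffP.
by have [] := is_derive_flat P t.
Qed.

Lemma Ck_flat k P (w : R * R -> R) : (forall k, Ck k w) -> Ck k (fun p => flat P (w p)).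
Proof.
move=> wk; elim: k P => [|k IH] P; (split; first by move=> p;
  apply: continuous_comp; [exact: (Ck_continuous (wk 0%N))|exact: flat_continuous]) => //.
have [_ [dw wx wy]] := wk k.+1.
have D v p : derivable w p v -> is_derive p v (fun p => flat P (w p))
    (flat ('X^2 * (P - P^`())) (w p) * 'D_v w p).
  by move=> dwp; apply: is_derive_comp1; [exact: is_derive_flat|exact: derivableP].
split.
- move=> p; split; [have [h _] := D _ _ (dw p).1|have [h _] := D _ _ (dw p).2]; exact: h.
- rewrite (_ : 'D_(1, 0) (fun p : R * R => flat P (w p)) = (fun p => flat ('X^2 * (P - P^`())) (w p) * 'D_(1, 0) w p)).
    by apply: CkM => //; exact: IH.
  by apply/funext => p; have [_ h] := D _ _ (dw p).1; exact: h.
- rewrite (_ : 'D_(0, 1) (fun p : R * R => flat P (w p)) = (fun p => flat ('X^2 * (P - P^`())) (w p) * 'D_(0, 1) w p)).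
    by apply: CkM => //; exact: IH.
  by apply/funext => p; have [_ h] := D _ _ (dw p).2; exact: h.
Qed.

Definition step : R -> R := flat 1.

Lemma stepE t : step t = if 0 < t then expR (- t^-1) else 0.
Proof. by rewrite /step /flat hornerE mul1r. Qed.

Lemma step_ge0 t : 0 <= step t.
Proof. by rewrite stepE; case: ifP => // _; exact: expR_ge0. Qed.

Lemma step_le1 t : step t <= 1.
Proof.
rewrite stepE; case: ifP => // t0.
by rewrite -expR0 ler_expR oppr_le0 invr_ge0 ltW.
Qed.

Lemma step_le0 t : t <= 0 -> step t = 0.
Proof. by rewrite stepE ltNge => ->. Qed.

Lemma step_pinfty (u : nat -> R) : u @ \oo --> +oo -> step (u n) @[n --> \oo] --> (1 : R).
Proof.
move=> uoo.
apply/cvgrPdist_le => e e0; near=> n.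
have ue : e^-1 <= u n by near: n; have /cvgryPge := uoo; exact.
have u0 : 0 < u n by apply: lt_le_trans ue; rewrite invr_gt0.
have ie : (u n)^-1 <= e by rewrite -[e]invrK lef_pV2// posrE invr_gt0.
rewrite ger0_norm ?subr_ge0 ?step_le1// stepE u0.
have := expR_ge1Dx (- (u n)^-1); move: (expR _) => x; move: (u n)^-1 ie => v; lra.
Unshelve. all: by end_near. Qed.

(** Smooth functions of values between 0 and 1 that converge, within the open
    disc, to the indicator of the quadrant x > a, y > c. The subtracted 1 in the
    last factor confines the support to x^2 + y^2 <= 1 - 1/n. *)
Definition quadrant_bump (a c : R) (n : nat) (p : R * R) : R :=
  step (n%:R * (p.1 - a)) * step (n%:R * (p.2 - c)) *
  step (n%:R * (1 - (p.1 * p.1 + p.2 * p.2)) - 1).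

Lemma Ck_quadrant_bump a c n k : Ck k (quadrant_bump a c n).
Proof.
have C1 j : Ck j (fst : R * R -> R) by exact: Ck_fst.
have C2 j : Ck j (snd : R * R -> R) by exact: Ck_snd.
apply: CkM; [apply: CkM|]; apply: Ck_flat => j.
- by apply: CkZ; apply: CkB => //; exact: Ck_cst.
- by apply: CkZ; apply: CkB => //; exact: Ck_cst.
- apply: CkB; last exact: Ck_cst.
  by apply: CkZ; apply: CkB; [exact: Ck_cst|apply: CkD; apply: CkM].
Qed.

Lemma csmooth_real (f : R * R -> R) : (forall k, Ck k f) -> csmooth (fun p => (f p)%:C).
Proof. by move=> fk k; split; [exact: fk|exact: Ck_cst]. Qed.

Lemma quadrant_bump_cvg a c (p : R * R) : p.1 ^+ 2 + p.2 ^+ 2 < 1 ->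
  quadrant_bump a c n p @[n --> \oo] --> (((a < p.1) && (c < p.2))%R%:R : R).
Proof.
move=> p1.
have oo (b : R) : 0 < b -> n%:R * b @[n --> \oo] --> +oo.
  move=> b0; apply/cvgryPge => A; have /cvgryPge/(_ (A / b)) := @cvgr_idn R.
  by apply: filterS => n; rewrite ler_pdivrMr.
have stepcvg (b d : R) : (b <= 0 -> forall n, step (n%:R * b - d) = 0) ->
    step (n%:R * b - d) @[n --> \oo] --> ((0 < b)%R%:R : R).
  have [b0 _|b0 h] := ltP 0 b; last first.
    by under eq_fun do rewrite h//; exact: cvg_cst.
  apply: step_pinfty; apply/cvgryPge => A.
  have := oo b b0; move=> /cvgryPge/(_ (A + d)); apply: filterS => n.
  by rewrite lerBrDr.
have s1 (x b : R) : step (n%:R * (x - b)) @[n --> \oo] --> ((b < x)%R%:R : R).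
  have := stepcvg (x - b) 0; rewrite subr_gt0; under eq_fun do rewrite subr0.
  apply=> h n; rewrite subr0 step_le0// mulr_ge0_le0//.
have s2 : step (n%:R * (1 - (p.1 * p.1 + p.2 * p.2)) - 1) @[n --> \oo] --> (1 : R).
  have := stepcvg (1 - (p.1 * p.1 + p.2 * p.2)) 1; rewrite subr_gt0 -!expr2 p1.
  by apply; rewrite subr_le0 leNgt p1.
rewrite -mulnb natrM -[X in _ --> X]mulr1; apply: cvgM => //.
by apply: cvgM.
Qed.

Lemma quadrant_bump_bnd a c n p : 0 <= quadrant_bump a c n p <= 1.
Proof.
rewrite !mulr_ge0 ?step_ge0//=.
by rewrite -[1]mulr1 ler_pM ?mulr_ge0 ?step_ge0 ?step_le1// -[1]mulr1 ler_pM ?step_ge0 ?step_le1.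
Qed.

Lemma quadrant_bump_supp a c n p : quadrant_bump a c n p != 0 ->
  p.1 ^+ 2 + p.2 ^+ 2 <= 1 - n%:R^-1 /\ (0 < n)%N.
Proof.
rewrite /quadrant_bump !mulf_eq0 !negb_or => /andP[_ h].
have {h} : 0 < n%:R * (1 - (p.1 * p.1 + p.2 * p.2)) - 1.
  by rewrite ltNge; apply: contra h => /step_le0 ->.
rewrite -!expr2; case: n => [|n]; first by rewrite mul0r sub0r ltNge lerN10.
rewrite subr_gt0 mulrC -ltr_pdivrMr// mul1r => h; split=> //.
by rewrite lerBrDl -lerBrDr ltW.
Qed.

Lemma Cc_quadrant_bump a c n : Cc_smooth (fun p => (quadrant_bump a c n p)%:C).
Proof.
rewrite /Cc_smooth; set supp := closure _.
pose K := [set p : R * R | p.1 ^+ 2 + p.2 ^+ 2 <= 1 - n%:R^-1].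
have Kcl : closed K.
  have cK : continuous (fun p : R * R => p.1 ^+ 2 + p.2 ^+ 2).
    apply: (@Ck_continuous R 0); apply: CkD; rewrite /=.
      by have := CkM (@Ck_fst R 0) (@Ck_fst R 0).
    by have := CkM (@Ck_snd R 0) (@Ck_snd R 0).
  have -> : K = (fun p : R * R => p.1 ^+ 2 + p.2 ^+ 2) @^-1` [set x | x <= 1 - n%:R^-1] by [].
  by apply: preimage_closed; [move=> p _; exact: cK|exact: closed_le].
have [n0|n0] := posnP n.
  have -> : supp = set0.
    rewrite /supp (_ : [set p | _] = set0) ?closure0//.
    apply/seteqP; split=> // p /=; rewrite (_ : (_ != 0) = (quadrant_bump a c n p != 0)).
      by move=> /quadrant_bump_supp[]; rewrite n0.
    by congr (~~ _); rewrite (@fmorph_eq0 _ _ (real_complex R)).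
  by split; [exact/csmooth_real/Ck_quadrant_bump|exact: compact0|].
have sK : supp `<=` K.
  rewrite /supp; rewrite (_ : K = closure K); last by rewrite -closure_id.
  apply: closure_subset => p /=; rewrite (_ : (_ != 0) = (quadrant_bump a c n p != 0)).
    by move=> /quadrant_bump_supp[].
  by congr (~~ _); rewrite (@fmorph_eq0 _ _ (real_complex R)).
have n1 : 0 < n%:R^-1 :> R by rewrite invr_gt0 ltr0n.
split; first exact/csmooth_real/Ck_quadrant_bump.
  apply: (@subclosed_compact _ _ (`[(-1 : R), 1]%classic `*` `[(-1 : R), 1]%classic)).
  - exact: closed_closure.
  - by apply: compact_setX; exact: segment_compact.
  move=> p /sK; rewrite /K/= => h.
  have := sqr_ge0 p.1; have := sqr_ge0 p.2 => h1 h2.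
  by split; rewrite /= in_itv/=; apply/andP; split; nra.
by move=> p /sK; rewrite /K /open_disc/= => h; apply: le_lt_trans h _; rewrite ltrBlDr ltrDl.
Qed.

End SmoothStep.

(** * Integration in polar coordinates *)

(** The Radon-Nikodym derivative of nu with respect to mu is unique, so it is
    rho on D. *)
Lemma integral_against_density d (T : measurableType d) (R : realType)
    (nu : {finite_measure set T -> \bar R}) (mu : {measure set T -> \bar R})
    (D : set T) (rho f : T -> R) :
  sigma_finite setT mu -> measurable D -> measurable_fun setT rho ->
  mu.-integrable D (EFin \o rho) ->
  (forall A, measurable A -> nu A = \int[mu]_(x in A `&` D) (rho x)%:E)%E ->
  nu.-integrable setT (EFin \o f) ->
  (\int[nu]_x (f x)%:E = \int[mu]_(x in D) (f x * rho x)%:E)%E.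
Proof.
move=> + mD mrho; case: mu => [mu' cmu]; set mu := Measure.Pack cmu => muf irho nuE fi.
pose muM := @Measure_isSigmaFinite.Build _ _ R mu muf.
pose m : {sigma_finite_measure set T -> \bar R} := HB.pack mu' cmu muM.
have dom : nu `<< m.
  apply/null_content_dominatesP => A mA A0.
  have mAD : measurable (A `&` D) by exact: measurableI.
  rewrite nuE// null_set_integral//.
    exact/measurable_EFinP/measurable_funTS.
  apply/eqP; rewrite eq_le measure_ge0 andbT -A0.
  by apply: le_measure; rewrite ?inE.
have mf : measurable_fun setT f by have /integrableP[/measurable_EFinP] := fi.
pose r : T -> \bar R := (EFin \o rho) \_ D.
have ir : mu.-integrable setT r by exact/(integrable_mkcond _ mD).
have -> : (\int[nu]_x (f x)%:E = \int[nu]_x (EFin \o f) x)%E by [].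
rewrite -(Radon_Nikodym_change_of_variables dom measurableT fi).
rewrite [RHS]integral_mkcond; apply: ae_eq_integral => //.
- apply: emeasurable_funM; first exact/measurable_EFinP.
  by apply: (measurable_int m); exact: Radon_Nikodym_integrable.
- apply/(measurable_restrictT _ mD)/measurable_EFinP/measurable_funTS.
  exact: measurable_funM.
have : ae_eq m setT (Radon_Nikodym (charge_of_finite_measure nu) m) r.
  apply: integral_ae_eq => //.
  - exact: Radon_Nikodym_integrable.
  - by have /integrableP[] := ir.
  by move=> E _ mE; rewrite -Radon_Nikodym_integral// [LHS]nuE// /r -integral_mkcondr.
apply: filterS => x /(_ I) h _; rewrite h /r !patchE; case: ifP => // _.
by rewrite mule0.
Qed.

Section PlaneIntegration.
Context (R : realType).
Local Notation plane := (measurableTypeR R * measurableTypeR R)%type.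
Local Notation leb := (@lebesgue_measure R).
Local Notation leb2 := (leb \x leb)%E.
Local Notation pbox := (@polar_box R).
Local Notation parea := (@polar_area R).

(** The measurable structure on the plane is that of the product; an open set is
    a countable union of rational boxes. *)
Lemma open_plane_measurable (U : set (R * R)) : open U -> measurable (U : set plane).
Proof.
move=> oU.
pose box (q : (rat * rat) * (rat * rat)) : set plane :=
  `](ratr q.1.1 : R), (ratr q.1.2 : R)[%classic `*` `](ratr q.2.1 : R), (ratr q.2.2 : R)[%classic.
pose F q := if `[< box q `<=` U >] then box q else set0.
have -> : (U : set plane) = \bigcup_q F q.
  apply/seteqP; split=> [[x y] Uxy|p [q _]]; last first.
    by rewrite /F; case: ifPn => // /asboolP; exact.
  have /nbhs_ballP[e /= e0 eU] : nbhs (x, y) U by apply: open_nbhs_nbhs; split.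
  have itv (t : R) : exists2 q : rat * rat, t - e < ratr q.1 < t & t < ratr q.2 < t + e.
    have [a] : exists a : rat, (ratr a : R) \in `]t - e, t[.
      by apply: rat_in_itvoo; rewrite ltrBlDr ltrDl.
    have [b] : exists b : rat, (ratr b : R) \in `]t, t + e[.
      by apply: rat_in_itvoo; rewrite ltrDl.
    by rewrite !in_itv/= => bt at'; exists (a, b).
  have [[a b] /= /andP[a1 a2] /andP[b1 b2]] := itv x.
  have [[c d] /= /andP[c1 c2] /andP[d1 d2]] := itv y.
  exists ((a, b), (c, d)) => //; rewrite /F asboolT.
    by split; rewrite /= in_itv/= ?a2 ?b1 ?c2 ?d1.
  move=> [x' y'] [/=]; rewrite !in_itv/= => /andP[x1 x2] /andP[y1 y2].
  apply: eU; split; rewrite /ball/= ltr_norml; apply/andP; split; lra.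
apply: countable_bigcupT_measurable => // q; rewrite /F; case: ifP => _ //.
by apply: measurableX; exact: measurable_itv.
Qed.

Lemma continuous_plane_measurable (f : R * R -> R) : continuous f ->
  measurable_fun setT (f : plane -> R).
Proof.
move=> /continuousP cf; apply: (measurability _ (RGenOpens.measurableE R)) => _ [_ [a [b ->] <-]].
by rewrite setTI; apply: open_plane_measurable; exact/cf/interval_open.
Qed.

Lemma leb2_sigma_finite : sigma_finite setT leb2.
Proof.
have /sigma_finiteP[F [TF ndF Foo]] := sigma_finiteT (@lebesgue_measure R).
exists (fun n => F n `*` F n).
  apply/seteqP; split=> // -[x y] _.
  have [n _ Fnx] : (\bigcup_n F n) x by rewrite -TF.
  have [k _ Fky] : (\bigcup_n F n) y by rewrite -TF.
  exists (maxn n k) => //; split.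
    by move: x Fnx; exact/subsetPset/ndF/leq_maxl.
  by move: y Fky; exact/subsetPset/ndF/leq_maxr.
move=> k; have [mF Fk] := Foo k; split; first exact: measurableX.
by rewrite product_measure1E// lte_mul_pinfty// ge0_fin_numE.
Qed.

Definition polar_density (q : plane) : R := q.1 / (2 * pi).

Lemma polar_density_measurable : measurable_fun setT polar_density.
Proof. by apply: (@measurable_funM _ plane R setT fst (cst (2 * pi)^-1)). Qed.

Lemma polar_density_ge0 q : pbox q -> 0 <= polar_density q.
Proof.
move=> [/= + _]; rewrite in_itv/= => /andP[q0 _].
by rewrite divr_ge0// mulr_ge0// pi_ge0.
Qed.

Lemma polar_density_le1 q : pbox q -> polar_density q <= 1.
Proof.
move=> [/= + _]; rewrite in_itv/= => /andP[q0 q1].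
rewrite ler_pdivrMr ?mulr_gt0 ?pi_gt0// mul1r (le_trans q1)//.
by have := pi_ge2 R; lra.
Qed.

Lemma leb2_box : leb2 pbox = (2 * pi)%:E.
Proof.
rewrite /polar_box product_measure1E//=; try exact: measurable_itv.
rewrite !lebesgue_measure_itv/= !lte_fin ltr01 mulr_gt0 ?pi_gt0//.
by rewrite -!EFinB -EFinM !subr0 mul1r.
Qed.

Lemma leb2_box_lty : (leb2 pbox < +oo)%E.
Proof. by rewrite leb2_box ltry. Qed.

Lemma box_integrable (f : plane -> R) M : measurable_fun setT f ->
  (forall q, pbox q -> `|f q| <= M) -> leb2.-integrable pbox (EFin \o f).
Proof.
move=> mf fM; apply: measurable_bounded_integrable.
- exact: measurable_polar_box.
- exact: leb2_box_lty.
- exact: measurable_funTS.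
exists M; split; first exact: num_real.
by move=> x xM q /= qb; apply: le_trans (fM q qb) (ltW xM).
Qed.

Lemma polar_area_fin : fin_num_fun parea.
Proof.
have le1 A : measurable A -> (parea A <= (2 * pi)%:E)%E.
  move=> mA; rewrite /polar_area -leb2_box.
  apply: (@le_trans _ _ (\int[leb2]_(q in A `&` pbox) 1)%E).
    apply: ge0_le_integral => //.
    - by apply: measurableI => //; exact: measurable_polar_box.
    - by move=> q [_ qb]; rewrite lee_fin polar_density_ge0.
    - by apply/measurable_EFinP/measurable_funTS; exact: polar_density_measurable.
    - by move=> q [_ qb]; rewrite lee_fin polar_density_le1.
  rewrite integral_cst ?mul1e; last by apply: measurableI => //; exact: measurable_polar_box.
  by apply: le_measure; rewrite ?inE; [apply: measurableI => //|..]; try exact: measurable_polar_box.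
move=> A mA; rewrite fin_numElt (le_lt_trans (le1 A mA)) ?ltry// andbT.
by apply: lt_le_trans (polar_area_ge0 A); rewrite ltNyr.
Qed.

HB.instance Definition _ := @Measure_isFinite.Build _ _ _ parea polar_area_fin.

Lemma disc_measure_fin : fin_num_fun (@disc_measure R).
Proof.
move=> A mA; apply: polar_area_fin; rewrite -[X in measurable X]setTI.
exact: measurable_polar.
Qed.

HB.instance Definition _ := @Measure_isFinite.Build _ _ _ (@disc_measure R) disc_measure_fin.

Lemma polar_area_box : parea (~` pbox) = 0 :> \bar R.
Proof. by rewrite /polar_area setICl integral_set0. Qed.

Lemma polar_bounded_integrable (f : plane -> R) M : measurable_fun setT f ->
  (forall q, pbox q -> `|f q| <= M) -> parea.-integrable setT (EFin \o f).
Proof.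
move=> mf fM; have mb := @measurable_polar_box R.
apply/(negligible_integrable (measurableC mb) measurableT).
- exact/measurable_EFinP.
- exact: polar_area_box.
rewrite setDE setCK setTI; apply: measurable_bounded_integrable => //.
- by rewrite ltey_eq polar_area_fin.
- exact: measurable_funTS.
exists M; split; first exact: num_real.
by move=> x xM q /= qb; apply: le_trans (fM q qb) (ltW xM).
Qed.

Lemma polar_integral (f : plane -> R) M : measurable_fun setT f ->
  (forall q, pbox q -> `|f q| <= M) ->
  (\int[parea]_q (f q)%:E = \int[leb2]_(q in pbox) (f q * polar_density q)%:E)%E.
Proof.
move=> mf fM; have fi := polar_bounded_integrable mf fM.
apply: (integral_against_density leb2_sigma_finite) => //.
- exact: measurable_polar_box.
- exact: polar_density_measurable.
- apply: (@box_integrable _ 1); first exact: polar_density_measurable.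
  by move=> q qb; rewrite ger0_norm ?polar_density_ge0// polar_density_le1.
Qed.

End PlaneIntegration.

(** * The divergence theorem on the disc *)

Section DiscIntegration.
Context (R : realType).
Local Notation plane := (measurableTypeR R * measurableTypeR R)%type.
Local Notation leb := (@lebesgue_measure R).
Local Notation leb2 := (leb \x leb)%E.
Local Notation pbox := (@polar_box R).
Local Notation disc := (@disc_measure R).

Lemma cvgMM (f g : R * R -> R) : continuous f -> continuous g ->
  continuous (fun q => f q * g q).
Proof. by move=> cf cg q; apply: cvgM; [exact: cf|exact: cg]. Qed.

Lemma cvgDD (f g : R * R -> R) : continuous f -> continuous g ->
  continuous (fun q => f q + g q).
Proof. by move=> cf cg q; apply: cvgD; [exact: cf|exact: cg]. Qed.

Lemma continuous_pairl (r : R) : continuous (fun t : R => (r, t)).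
Proof.
move=> t; have h1 : (fun _ : R => r) x @[x --> t] --> r by exact: cvg_cst.
have h2 : (fun x : R => x) x @[x --> t] --> t by exact: cvg_id.
exact: (cvg_pair h1 h2).
Qed.

Lemma continuous_pairr (r : R) : continuous (fun t : R => (t, r)).
Proof.
move=> t; have h1 : (fun _ : R => r) x @[x --> t] --> r by exact: cvg_cst.
have h2 : (fun x : R => x) x @[x --> t] --> t by exact: cvg_id.
exact: (cvg_pair h2 h1).
Qed.

Lemma polar_norm (q : plane) : (polar q).1 ^+ 2 + (polar q).2 ^+ 2 = q.1 ^+ 2.
Proof. by rewrite /polar/= !exprMn -mulrDr cos2Dsin2 mulr1. Qed.

Lemma polar_closed_disc q : pbox q -> closed_disc (polar q).
Proof.
move=> [/= + _]; rewrite in_itv/= => /andP[q0 q1].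
by rewrite /closed_disc/= polar_norm expr_le1.
Qed.

Lemma closed_disc_square (p : R * R) : closed_disc p -> `|p.1| <= 1 /\ `|p.2| <= 1.
Proof.
rewrite /closed_disc/= => h; have h1 := sqr_ge0 p.1; have h2 := sqr_ge0 p.2.
by split; rewrite -(@expr_le1 _ 2)// real_normK ?num_real//; lra.
Qed.

Lemma continuous_bounded_square (h : R * R -> R) : continuous h ->
  exists M, forall p, `|p.1| <= 1 -> `|p.2| <= 1 -> `|h p| <= M.
Proof.
move=> ch; pose K := (`[(-1 : R), 1]%classic `*` `[(-1 : R), 1]%classic).
have cK : compact (h @` K).
  apply: continuous_compact; first exact: continuous_subspaceT.
  by apply: compact_setX; exact: segment_compact.
have [M [_ HM]] := compact_bounded cK.
exists (M + 1) => p p1 p2; apply: HM; first by rewrite ltrDl.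
exists p => //; split; rewrite /= in_itv/= -ler_norml//.
Qed.

Lemma disc_integrable (h : plane -> R) M : measurable_fun setT h ->
  (forall p, closed_disc p -> `|h p| <= M) -> disc.-integrable setT (EFin \o h).
Proof.
move=> mh hM; apply: integrable_pushforward => //.
- exact: measurable_polar.
- exact/measurable_EFinP.
rewrite preimage_setT; apply: (@polar_bounded_integrable _ (h \o @polar R) M).
  by apply: measurableT_comp => //; exact: measurable_polar.
by move=> q qb; apply: hM; exact: polar_closed_disc.
Qed.

Lemma disc_integral (h : plane -> R) M : measurable_fun setT h ->
  (forall p, closed_disc p -> `|h p| <= M) ->
  (\int[disc]_p (h p)%:E = \int[leb2]_(q in pbox) (h (polar q) * polar_density q)%:E)%E.
Proof.
move=> mh hM.
have mhp : measurable_fun setT (h \o @polar R).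
  by apply: measurableT_comp => //; exact: measurable_polar.
have hb q : pbox q -> `|(h \o @polar R) q| <= M.
  by move=> qb; apply: hM; exact: polar_closed_disc.
rewrite -(polar_integral mhp hb).
rewrite (@integral_pushforward _ _ _ _ _ _ (@measurable_polar R) (@polar_area R) setT (EFin \o h))//.
- exact/measurable_EFinP.
- by rewrite preimage_setT; exact: (@polar_bounded_integrable _ (h \o @polar R) M).
Qed.

Lemma disc_continuous_integrable (h : R * R -> R) : continuous h ->
  disc.-integrable setT (EFin \o h).
Proof.
move=> ch; have [M HM] := continuous_bounded_square ch.
apply: (@disc_integrable h M); first exact: continuous_plane_measurable.
by move=> p /closed_disc_square[p1 p2]; exact: HM.
Qed.

Lemma disc_continuous_integral (h : R * R -> R) : continuous h ->
  (\int[disc]_p (h p)%:E = \int[leb2]_(q in pbox) (h (polar q) * polar_density q)%:E)%E.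
Proof.
move=> ch; have [M HM] := continuous_bounded_square ch.
apply: (@disc_integral h M); first exact: continuous_plane_measurable.
by move=> p /closed_disc_square[p1 p2]; exact: HM.
Qed.

Lemma box_continuous_integrable (f : R * R -> R) : continuous f ->
  leb2.-integrable pbox (EFin \o (f : plane -> R)).
Proof.
move=> cf; have cK : compact (f @` (`[(0 : R), 1]%classic `*` `[(0 : R), 2 * pi]%classic)).
  apply: continuous_compact; first exact: continuous_subspaceT.
  by apply: compact_setX; exact: segment_compact.
have [M [_ HM]] := compact_bounded cK.
apply: (@box_integrable _ f (M + 1)); first exact: continuous_plane_measurable.
by move=> q qb; apply: HM; [rewrite ltrDl|exists q].
Qed.

Lemma box_integral0_theta (f : R * R -> R) : continuous f ->
  (forall x, \int[leb]_(y in `[0%R, (2 * pi)%R]) (f (x, y))%:E = 0)%E ->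
  (\int[leb2]_(q in pbox) (f q)%:E = 0)%E.
Proof.
move=> cf f0; rewrite integral_mkcond.
have fi : leb2.-integrable setT ((EFin \o (f : plane -> R)) \_ pbox).
  by apply/(integrable_mkcond _ (@measurable_polar_box R)); exact: box_continuous_integrable.
rewrite -(integral12_prod_meas1 fi); apply: integral0_eq => x _.
have [x01|x01] := boolP (x \in `[(0 : R), 1]%classic).
  rewrite -[RHS](f0 x) [RHS]integral_mkcond; apply: eq_integral => y _.
  rewrite !patchE; congr (if _ then _ else _).
  by apply/idP/idP => [/set_mem[] _ /mem_set//|/set_mem yi]; apply/mem_set; split => //; exact: set_mem.
apply: integral0_eq => y _; rewrite patchE ifN//.
by apply: contra x01 => /set_mem[x01 _]; exact/mem_set.
Qed.

Lemma box_integral0_r (f : R * R -> R) : continuous f ->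
  (forall y, \int[leb]_(x in `[0%R, 1%R]) (f (x, y))%:E = 0)%E ->
  (\int[leb2]_(q in pbox) (f q)%:E = 0)%E.
Proof.
move=> cf f0; rewrite integral_mkcond.
have fi : leb2.-integrable setT ((EFin \o (f : plane -> R)) \_ pbox).
  by apply/(integrable_mkcond _ (@measurable_polar_box R)); exact: box_continuous_integrable.
rewrite -(integral21_prod_meas1 fi); apply: integral0_eq => y _.
have [y01|y01] := boolP (y \in `[(0 : R), 2 * pi]%classic).
  rewrite -[RHS](f0 y) [RHS]integral_mkcond; apply: eq_integral => x _.
  rewrite !patchE; congr (if _ then _ else _).
  by apply/idP/idP => [/set_mem[] /mem_set//|/set_mem xi]; apply/mem_set; split => //; exact: set_mem.
apply: integral0_eq => x _; rewrite patchE ifN//.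
by apply: contra y01 => /set_mem[_ y01]; exact/mem_set.
Qed.

Lemma ftc_segment (f F : R -> R) (a b : R) : a < b -> continuous f ->
  (forall x : R, is_derive x 1 F (f x)) ->
  (\int[leb]_(x in `[a, b]) (f x)%:E = (F b - F a)%:E)%E.
Proof.
move=> ab cf dF; have cF : continuous F.
  by move=> x; apply/differentiable_continuous/derivable1_diffP; have [] := dF x.
rewrite EFinB; apply: continuous_FTC2 => //.
- exact: continuous_subspaceT.
- split; first by move=> x _; have [] := dF x.
    exact: (cvg_at_right_filter (cF a)).
  exact: (cvg_at_left_filter (cF b)).
by move=> x _; rewrite derive1E; have [] := dF x.
Qed.

Lemma continuous_polar : continuous (@polar R : R * R -> R * R).
Proof.
have cc (f : R -> R) : continuous f -> continuous (fun q : R * R => q.1 * f q.2).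
  by move=> cf q; apply: cvgM; [exact: cvg_fst|apply: continuous_comp; [exact: cvg_snd|exact: cf]].
move=> q; exact: (cvg_pair (cc _ (@continuous_cos R) q) (cc _ (@continuous_sin R) q)).
Qed.

(** Since A'' = -A, the integrand is d_r (r A w) + d_theta (A' w). The first
    term integrates to zero in r, because w vanishes on the circle and r A w at
    the origin; the second integrates to zero in theta by periodicity. For
    A = cos the integrand is r d_x w, and for A = sin it is r d_y w. *)
Lemma polar_divergence (A A' : R -> R) (w : R * R -> R) :
  (forall t : R, is_derive t 1 A (A' t)) -> (forall t : R, is_derive t 1 A' (- A t)) ->
  A' (2 * pi) = A' 0 ->
  Ck 1 w -> (forall p, p.1 ^+ 2 + p.2 ^+ 2 = 1 -> w p = 0) ->
  (\int[leb2]_(q in pbox)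
    (q.1 * ((A q.2 * cos q.2 - A' q.2 * sin q.2) * 'D_(1, 0) w (polar q) +
           (A q.2 * sin q.2 + A' q.2 * cos q.2) * 'D_(0, 1) w (polar q)))%:E = 0)%E.
Proof.
move=> dA dA' per w1 w0; have [cw [_ [cx _] [cy _]]] := w1.
have cont1 (f : R -> R) : continuous f -> continuous (fun q : R * R => f q.2).
  by move=> cf q; apply: continuous_comp; [exact: cvg_snd|exact: cf].
have contp (f : R * R -> R) : continuous f -> continuous (fun q : R * R => f (polar q)).
  by move=> cf q; apply: continuous_comp; [exact: continuous_polar|exact: cf].
have c1 : continuous (fst : R * R -> R) by move=> q; exact: cvg_fst.
have cA : continuous (fun q : R * R => A q.2).
  by apply: cont1 => x; apply/differentiable_continuous/derivable1_diffP; have [] := dA x.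
have cA' : continuous (fun q : R * R => A' q.2).
  by apply: cont1 => x; apply/differentiable_continuous/derivable1_diffP; have [] := dA' x.
have cc : continuous (fun q : R * R => cos q.2 : R) by apply: cont1; exact: continuous_cos.
have cs : continuous (fun q : R * R => sin q.2 : R) by apply: cont1; exact: continuous_sin.
have cNs : continuous (fun q : R * R => - sin q.2 : R) by move=> q; apply: cvgN; exact: cs.
have cNA : continuous (fun q : R * R => - A q.2 : R) by move=> q; apply: cvgN; exact: cA.
pose gr (q : R * R) := A q.2 * w (polar q) +
  (q.1 * A q.2) * (cos q.2 * 'D_(1, 0) w (polar q) + sin q.2 * 'D_(0, 1) w (polar q)).
pose gt (q : R * R) := (- A q.2) * w (polar q) + A' q.2 *
  (q.1 * - sin q.2 * 'D_(1, 0) w (polar q) + q.1 * cos q.2 * 'D_(0, 1) w (polar q)).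
have cgr : continuous gr.
  apply: (@cvgDD (fun q => A q.2 * w (polar q))); first exact: (cvgMM cA (contp _ cw)).
  apply: (cvgMM (cvgMM c1 cA)).
  exact: (cvgDD (cvgMM cc (contp _ cx)) (cvgMM cs (contp _ cy))).
have cgt : continuous gt.
  apply: (@cvgDD (fun q => - A q.2 * w (polar q))); first exact: (cvgMM cNA (contp _ cw)).
  apply: (cvgMM cA').
  exact: (cvgDD (cvgMM (cvgMM c1 cNs) (contp _ cx)) (cvgMM (cvgMM c1 cc) (contp _ cy))).
transitivity (\int[leb2]_(q in pbox) ((EFin \o (gr : plane -> R)) q + (EFin \o (gt : plane -> R)) q))%E.
  by apply: eq_integral => q _; rewrite /= -EFinD; congr EFin; rewrite /gr /gt; ring.
have mb := @measurable_polar_box R.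
rewrite integralD//; [|exact: box_continuous_integrable|exact: box_continuous_integrable].
rewrite (box_integral0_r cgr) ?(box_integral0_theta cgt) ?adde0//.
  move=> r.
  have dF (t : R) : is_derive t 1 (fun t : R => A' t * w (polar (r, t))) (gt (r, t)).
    have dw : is_derive t 1 (fun t : R => w (polar (r, t)))
      (r * - sin t * 'D_(1, 0) w (polar (r, t)) + r * cos t * 'D_(0, 1) w (polar (r, t))).
      exact: (@Ck1_curve _ w (fun t => r * cos t) (fun t => r * sin t)).
    have -> : gt (r, t) = A' t *: (r * - sin t * 'D_(1, 0) w (polar (r, t)) +
        r * cos t * 'D_(0, 1) w (polar (r, t))) + w (polar (r, t)) *: - A t.
      by rewrite /gt/= /GRing.scale/=; ring.
    exact: (is_deriveM (dA' t) dw).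
  rewrite (@ftc_segment (fun t => gt (r, t)) _ _ _ _ _ dF) ?mulr_gt0 ?pi_gt0//.
    by rewrite per /polar/= mulr_natl cos2pi sin2pi cos0 sin0 subrr.
  by move=> t; apply: continuous_comp; [exact: continuous_pairl|exact: cgt].
move=> t.
have dk (k r : R) : is_derive r 1 (fun r : R => r * k) k.
  by apply: is_derive_eq; rewrite scaler0 add0r [_ *: _]mulr1.
have dF (r : R) : is_derive r 1 (fun r : R => r * A t * w (polar (r, t))) (gr (r, t)).
  have dw : is_derive r 1 (fun r : R => w (polar (r, t)))
    (cos t * 'D_(1, 0) w (polar (r, t)) + sin t * 'D_(0, 1) w (polar (r, t))).
    exact: (@Ck1_curve _ w (fun r => r * cos t) (fun r => r * sin t) _ _ _ w1 (dk _ _) (dk _ _)).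
  have dr : is_derive r 1 (fun r : R => r * A t) (A t) by exact: dk.
  have -> : gr (r, t) = (r * A t) *: (cos t * 'D_(1, 0) w (polar (r, t)) +
      sin t * 'D_(0, 1) w (polar (r, t))) + w (polar (r, t)) *: A t.
    by rewrite /gr/= /GRing.scale/=; ring.
  exact: (is_deriveM dr dw).
rewrite (@ftc_segment (fun r => gr (r, t)) _ _ _ _ _ dF) ?ltr01//.
  by rewrite mul0r mul0r w0 ?mulr0 ?subrr// polar_norm expr1n.
by move=> r; apply: continuous_comp; [exact: continuous_pairr|exact: cgr].
Qed.

End DiscIntegration.

(** * Mean values of derivatives, and null sets of the disc *)

Section DiscMeasure.
Context (R : realType).
Local Notation plane := (measurableTypeR R * measurableTypeR R)%type.
Local Notation leb := (@lebesgue_measure R).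
Local Notation leb2 := (leb \x leb)%E.
Local Notation pbox := (@polar_box R).
Local Notation disc := (@disc_measure R).

Lemma mean_derive_zero (w : R * R -> R) : Ck 1 w ->
  (forall p, p.1 ^+ 2 + p.2 ^+ 2 = 1 -> w p = 0) ->
  (\int[disc]_p ('D_(1, 0) w p)%:E = 0 /\ \int[disc]_p ('D_(0, 1) w p)%:E = 0)%E.
Proof.
move=> w1 w0; have [cw [_ [cx _] [cy _]]] := w1.
have pi2 : (2 * pi : R) = pi *+ 2 by rewrite mulr_natl.
have dcos (t : R) : is_derive t 1 (cos : R -> R) (- sin t) by exact: is_derive_cos.
have dsin (t : R) : is_derive t 1 (sin : R -> R) (cos t) by exact: is_derive_sin.
have dNsin (t : R) : is_derive t 1 (fun t : R => - sin t) (- cos t) by exact: is_deriveN.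
have [k kp] : exists k : R, forall r : R, r / (2 * pi) = k * r.
  by exists (2 * pi)^-1 => r; rewrite mulrC.
have cs2 (q : R * R) : (cos q.2 : R) ^+ 2 + sin q.2 ^+ 2 = 1 by exact: cos2Dsin2.
have scale (g : R * R -> R) : (\int[leb2]_(q in pbox) (g q)%:E = 0)%E ->
    leb2.-integrable pbox (EFin \o (g : plane -> R)) ->
    (\int[leb2]_(q in pbox) (k * g q)%:E = 0)%E.
  move=> g0 gi; under eq_integral do rewrite EFinM.
  by rewrite (integralZl (@measurable_polar_box R) gi) g0 mule0.
have int (h : R * R -> R) : continuous h ->
    leb2.-integrable pbox (EFin \o (fun q : plane => q.1 * h (polar q))).
  move=> ch; apply: (@box_continuous_integrable _ (fun q => q.1 * h (polar q))).
  have c1 : continuous (fst : R * R -> R) by move=> q; exact: cvg_fst.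
  have ch' : continuous (fun q : R * R => h (polar q)).
    by move=> q; apply: continuous_comp; [exact: (@continuous_polar R q)|exact: (ch (polar q))].
  exact: (cvgMM c1 ch').
split; rewrite disc_continuous_integral//.
- rewrite -[RHS](scale (fun q => q.1 * 'D_(1, 0) w (polar q))); last exact: (int _ cx).
    by apply: eq_integral => q _; rewrite /polar_density kp; congr EFin; ring.
  have per : - sin (2 * pi) = - sin 0 :> R by rewrite pi2 sin2pi sin0.
  rewrite -[RHS](polar_divergence dcos dNsin per w1 w0).
  apply: eq_integral => q _; congr EFin; congr (_ * _).
  have -> : cos q.2 * cos q.2 - - sin q.2 * sin q.2 = 1 :> R by rewrite -(cs2 q); ring.
  by rewrite mul1r -[LHS]addr0; congr (_ + _); ring.
- rewrite -[RHS](scale (fun q => q.1 * 'D_(0, 1) w (polar q))); last exact: (int _ cy).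
    by apply: eq_integral => q _; rewrite /polar_density kp; congr EFin; ring.
  have per : cos (2 * pi) = cos 0 :> R by rewrite pi2 cos2pi cos0.
  rewrite -[RHS](polar_divergence dsin dcos per w1 w0).
  apply: eq_integral => q _; congr EFin; congr (_ * _).
  have -> : sin q.2 * sin q.2 + cos q.2 * cos q.2 = 1 :> R by rewrite -(cs2 q); ring.
  by rewrite mul1r -[LHS]add0r; congr (_ + _); ring.
Qed.

(** Within the box, A lies over a single radius. Circles, the origin and the
    complement of the open disc are of this kind. *)
Lemma polar_null (A : set plane) (c : R) : measurable A ->
  (forall q, pbox q -> A q -> q.1 = c) -> @polar_area R A = 0%E.
Proof.
move=> mA Ac; rewrite /polar_area.
have mb := @measurable_polar_box R.
have mB : measurable (A `&` pbox) by exact: measurableI.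
apply: null_set_integral => //.
  by apply/measurable_EFinP/measurable_funTS; exact: polar_density_measurable.
apply/eqP; rewrite eq_le measure_ge0 andbT.
apply: (@le_trans _ _ (leb2 ([set c] `*` `[(0 : R), 2 * pi]%classic))).
  apply: le_measure; rewrite ?inE//.
    by apply: measurableX => //; exact: measurable_itv.
  by move=> q [Aq qb]; split; [exact: Ac|exact: qb.2].
rewrite product_measure1E//; try exact: measurable_itv.
by rewrite [X in (X * _)%E](@lebesgue_measure_set1 R c) mul0e.
Qed.

Lemma disc_null (A : set plane) (c : R) : measurable A ->
  (forall q, pbox q -> A (polar q) -> q.1 = c) -> disc A = 0%E.
Proof.
move=> mA Ac; apply: (@polar_null _ c) => //; rewrite -[X in measurable X]setTI.
exact: measurable_polar.
Qed.

Lemma measurable_sqnorm : measurable_fun setT (fun p : plane => p.1 ^+ 2 + p.2 ^+ 2).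
Proof.
apply: (@continuous_plane_measurable R (fun p => p.1 ^+ 2 + p.2 ^+ 2)).
have c1 : continuous (fst : R * R -> R) by move=> q; exact: cvg_fst.
have c2 : continuous (snd : R * R -> R) by move=> q; exact: cvg_snd.
exact: (cvgDD (cvgMM c1 c1) (cvgMM c2 c2)).
Qed.

Lemma disc_circle_null (c : R) : disc [set p | p.1 ^+ 2 + p.2 ^+ 2 = c] = 0.
Proof.
apply: (@disc_null _ (Num.sqrt c)).
  by have := measurable_sqnorm measurableT (@measurable_set1 R c); rewrite setTI.
move=> q [/= + _]; rewrite in_itv/= polar_norm => /andP[q0 _] <-.
by rewrite sqrtr_sqr ger0_norm.
Qed.

Lemma disc_ae_open : {ae disc, forall p, open_disc p}.
Proof.
have mo : measurable (~` [set p : plane | p.1 ^+ 2 + p.2 ^+ 2 < 1]).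
  apply: measurableC.
  have := measurable_sqnorm measurableT (@measurable_itv R `]-oo, 1[%R).
  by rewrite setTI /preimage; under eq_set do rewrite /= in_itv/=.
exists (~` [set p : plane | p.1 ^+ 2 + p.2 ^+ 2 < 1]); split; [exact: mo| |by []].
apply: (@disc_null _ 1 mo).
move=> q [/= + _]; rewrite in_itv/= polar_norm => /andP[q0 q1] /negP.
rewrite -leNgt => h; apply/eqP; rewrite eq_le q1/=.
by rewrite -(@expr_ge1 _ 2).
Qed.

Lemma disc_measure_gt0 : (0 < disc setT)%E.
Proof.
rewrite /disc_measure /pushforward preimage_setT /polar_area setTI.
have mb := @measurable_polar_box R.
pose B : set plane := `[(2^-1 : R), 1]%classic `*` `[(0 : R), 2 * pi]%classic.
have mB : measurable B by apply: measurableX; exact: measurable_itv.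
have lB : leb2 B = (2^-1 * (2 * pi))%:E.
  rewrite /B product_measure1E//=; try exact: measurable_itv.
  rewrite !lebesgue_measure_itv/= !lte_fin mulr_gt0 ?pi_gt0// invf_lt1// ltr1n/=.
  by rewrite -!EFinB -EFinM subr0; congr (_%:E); field.
have BP : B `<=` pbox.
  move=> q [/= + h]; rewrite in_itv/= => /andP[q0 q1]; split => //=.
  by rewrite in_itv/= q1 (le_trans _ q0)// invr_ge0.
have mr : measurable_fun setT (EFin \o @polar_density R).
  by apply/measurable_EFinP; exact: polar_density_measurable.
apply: (@lt_le_trans _ _ (\int[leb2]_(q in B) (2^-1 / (2 * pi))%:E)%E).
  rewrite integral_cst// [X in (_ * X)%E]lB -EFinM lte_fin.
  by rewrite !mulr_gt0 ?invr_gt0 ?mulr_gt0 ?pi_gt0.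
apply: (@le_trans _ _ (\int[leb2]_(q in B) (polar_density q)%:E)%E).
  apply: ge0_le_integral => //.
  - by move=> q _; rewrite lee_fin divr_ge0 ?mulr_ge0 ?pi_ge0 ?invr_ge0.
  - exact: measurable_funTS.
  - move=> q [/= + _]; rewrite in_itv/= => /andP[q0 q1].
    by rewrite lee_fin ler_wpM2r// invr_ge0 mulr_ge0// pi_ge0.
apply: ge0_subset_integral => //; first exact: measurable_funTS.
by move=> q qb; rewrite lee_fin polar_density_ge0.
Qed.

End DiscMeasure.

(** * Functions orthogonal to the bumps *)

Section Quadrants.
Context (R : realType).
Local Notation plane := (measurableTypeR R * measurableTypeR R)%type.
Local Notation disc := (@disc_measure R).

Definition quadrant (a c : R) : set plane := [set p | a < p.1 /\ c < p.2].
Definition quadrants : set (set plane) := [set A | exists a c, A = quadrant a c].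

Lemma quadrantE a c : quadrant a c = `]a, +oo[%classic `*` `]c, +oo[%classic.
Proof.
by apply/seteqP; split=> p; rewrite /quadrant /= !in_itv/= !andbT.
Qed.

Lemma quadrant_measurable a c : measurable (quadrant a c).
Proof. by rewrite quadrantE; apply: measurableX; exact: measurable_itv. Qed.

Lemma plane_measurable_quadrants : @measurable _ plane = <<s quadrants >>.
Proof.
apply/seteqP; split; last first.
  apply: smallest_sub; first exact: sigma_algebra_measurable.
  by move=> _ [a [c ->]]; exact: quadrant_measurable.
pose aT := g_sigma_algebraType quadrants.
have oo (x : R) : exists n : nat, - n%:R < x.
  exists (Num.bound `|x|); rewrite ltrNl.
  by apply: le_lt_trans (archi_boundP (normr_ge0 x)); rewrite -normrN ler_norm.
have m1 : measurable_fun setT (fst : aT -> measurableTypeR R).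
  apply: (measurability _ (RGenOInfty.measurableE R)) => _ [_ [x ->] <-]; rewrite setTI.
  have -> : fst @^-1` `]x, +oo[ = \bigcup_n (quadrant x (- n%:R)) :> set aT.
    apply/seteqP; split=> [p /=|p [n _ [/= h _]]]; last by rewrite in_itv/= h.
    by rewrite in_itv/= andbT => h; have [n hn] := oo p.2; exists n.
  by apply: bigcupT_measurable => n; apply: sub_sigma_algebra; exists x, (- n%:R).
have m2 : measurable_fun setT (snd : aT -> measurableTypeR R).
  apply: (measurability _ (RGenOInfty.measurableE R)) => _ [_ [x ->] <-]; rewrite setTI.
  have -> : snd @^-1` `]x, +oo[ = \bigcup_n (quadrant (- n%:R) x) :> set aT.
    apply/seteqP; split=> [p /=|p [n _ [/= _ h]]]; last by rewrite in_itv/= h.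
    by rewrite in_itv/= andbT => h; have [n hn] := oo p.1; exists n.
  by apply: bigcupT_measurable => n; apply: sub_sigma_algebra; exists (- n%:R), x.
rewrite measurable_prod_measurableType; apply: smallest_sub; first exact: smallest_sigma_algebra.
move=> _ [A mA] [B mB] <-.
have : (measurable : set (set aT)) ((fst @^-1` A) `&` (snd @^-1` B)).
  by apply: measurableI; rewrite -[X in measurable X]setTI; [exact: m1|exact: m2].
exact.
Qed.

(** The sets over which u has integral zero form a Dynkin system that contains
    the pi-system of the quadrants, hence all Borel sets. *)
Lemma ae0_of_quadrants (u : plane -> R) : disc.-integrable setT (EFin \o u) ->
  (forall a c, \int[disc]_(p in quadrant a c) (u p)%:E = 0)%E ->
  {ae disc, forall p, u p = 0}.
Proof.
move=> iu u0.
pose P := [set A : set plane | (\int[disc]_(p in A) (u p)%:E = 0)%E].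
have PT : P setT.
  (* This quadrant contains the whole disc. *)
  rewrite /P /= -[RHS](u0 (-2) (-2)); have [N [mN N0 HN]] := disc_ae_open R.
  have mQ := quadrant_measurable (-2) (-2).
  have QN : disc (~` quadrant (-2) (-2)) = 0.
    apply/eqP; rewrite eq_le measure_ge0 andbT -N0; apply: le_measure; rewrite ?inE//.
      exact: measurableC.
    move=> p nQ; apply: HN => /= h; apply: nQ; rewrite /open_disc/= in h.
    by split; have := sqr_ge0 p.1; have := sqr_ge0 p.2; nra.
  rewrite [LHS](negligible_integral (measurableC mQ) measurableT iu QN).
  by rewrite setTD setCK.
have PP A : measurable A -> P A.
  rewrite {1}plane_measurable_quadrants; apply: dynkin_induction => //.
  - exact: plane_measurable_quadrants.
  - move=> _ _ [a [c ->]] [b [d ->]]; exists (Num.max a b), (Num.max c d).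
    apply/seteqP; split=> p; rewrite /quadrant/= !gt_max; first by move=> [[-> ->] [-> ->]].
    by move=> [/andP[-> ->] /andP[-> ->]].
  - by move=> _ [a [c ->]]; exact: u0.
  - move=> S mS PS; rewrite /P/=.
    have : (\int[disc]_(p in S `|` ~` S) (u p)%:E = 0)%E by rewrite setUv.
    rewrite integral_setU//; [|exact: measurableC| |].
    + by rewrite PS add0e.
    + by have /integrableP[mu _] := iu; rewrite setUv.
    + exact/disj_setPCl.
  - move=> F mF tF PF; rewrite /P/= integral_bigcup//.
      by rewrite eseries0// => i _ _; exact: PF.
    by apply: (integrableS measurableT) => //; exact: bigcupT_measurable.
have : ae_eq disc setT (EFin \o u) (cst 0%E).
  apply: integral_ae_eq => // E _ mE.
  by rewrite [RHS]integral0; exact: PP.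
by apply: filterS => p /(_ I) [].
Qed.

(** Let n grow in the bumps and use dominated convergence. *)
Lemma ae0_of_bumps (u : plane -> R) : disc.-integrable setT (EFin \o u) ->
  (forall a c n, \int[disc]_p (u p * quadrant_bump a c n p)%:E = 0)%E ->
  {ae disc, forall p, u p = 0}.
Proof.
move=> iu u0; have /integrableP[/measurable_EFinP mu ufin] := iu.
have mb a c n : measurable_fun setT (quadrant_bump a c n : plane -> R).
  by apply: continuous_plane_measurable; exact: (Ck_continuous (Ck_quadrant_bump a c n 0)).
have mQ a c : measurable_fun setT (fun p : plane => ((a < p.1) && (c < p.2))%R%:R : R).
  rewrite (_ : (fun p => _) = \1_(quadrant a c)); first exact: measurable_indic (quadrant_measurable a c).
  apply/funext => p; rewrite indicE; suff -> : (p \in quadrant a c) = (a < p.1) && (c < p.2) by [].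
  by apply/idP/idP => [/set_mem[-> ->]//|/andP[h1 h2]]; apply/mem_set.
apply: ae0_of_quadrants => // a c.
have [_ _ dc] : [/\ disc.-integrable setT
    (fun p => (u p * ((a < p.1) && (c < p.2))%R%:R)%:E),
    ([sequence \int[disc]_p `|(u p * quadrant_bump a c n p)%:E -
       (u p * ((a < p.1) && (c < p.2))%R%:R)%:E|]_n @ \oo --> 0)%E &
    ([sequence \int[disc]_p (u p * quadrant_bump a c n p)%:E]_n @ \oo -->
      \int[disc]_p (u p * ((a < p.1) && (c < p.2))%R%:R)%:E)%E].
  apply: (@dominated_convergence _ _ _ disc setT measurableT
    (fun n p => (u p * quadrant_bump a c n p)%:E) _ (fun p => `|(u p)%:E|)%E).
  - by move=> n; apply/measurable_EFinP/measurable_funM.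
  - by apply/measurable_EFinP/measurable_funM.
  - apply: filterS (@disc_ae_open R) => p po _; apply: cvg_EFin; first exact: nearW.
    by apply: cvgM; [exact: cvg_cst|exact: quadrant_bump_cvg].
  - exact: integrable_abse.
  - apply: aeW => p n _; rewrite !abse_EFin lee_fin normrM.
    have /andP[b0 b1] := quadrant_bump_bnd a c n p.
    by rewrite (ger0_norm b0) ler_piMr.
have -> : (\int[disc]_(p in quadrant a c) (u p)%:E =
    \int[disc]_p (u p * ((a < p.1) && (c < p.2))%R%:R)%:E)%E.
  rewrite integral_mkcond; apply: eq_integral => p _; rewrite patchE.
  case: ifPn => [/set_mem[-> ->]|]; first by rewrite mulr1.
  move=> pQ; rewrite (_ : (a < p.1) && (c < p.2) = false) ?mulr0//.
  by apply/negbTE; apply: contra pQ => /andP[h1 h2]; apply/mem_set.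
move: dc; under eq_fun do rewrite u0.
by move=> /cvg_lim <-//; rewrite lim_cst.
Qed.

End Quadrants.

(** * The Dirac operators in cartesian coordinates *)

Section DiracOperators.
Context (R : realType).
Local Notation plane := (measurableTypeR R * measurableTypeR R)%type.
Local Notation disc := (@disc_measure R).
Local Notation parea := (@polar_area R).
Implicit Types (f g : R * R -> R[i]) (p v : R * R).
Local Notation Re := (@complex.Re R).
Local Notation Im := (@complex.Im R).

Definition ccontinuous f := continuous (Re \o f) /\ continuous (Im \o f).
Definition cC1 f := Ck 1 (Re \o f) /\ Ck 1 (Im \o f).

(** (d_x + i d_y) f *)
Definition dbar f p : R[i] :=
  ('D_(1, 0) (Re \o f) p - 'D_(0, 1) (Im \o f) p) +i*
  ('D_(1, 0) (Im \o f) p + 'D_(0, 1) (Re \o f) p).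

(** -(d_x - i d_y) f *)
Definition ndel f p : R[i] :=
  (- 'D_(1, 0) (Re \o f) p - 'D_(0, 1) (Im \o f) p) +i*
  (- 'D_(1, 0) (Im \o f) p + 'D_(0, 1) (Re \o f) p).

Lemma csmooth_C1 f : csmooth f -> cC1 f.
Proof. by move=> fs; have [f1 f2] := fs 1%N; split. Qed.

Lemma cC1_continuous f : cC1 f -> ccontinuous f.
Proof. by move=> [f1 f2]; split; [exact: Ck_continuous f1|exact: Ck_continuous f2]. Qed.

Lemma ccontinuous_dbar f : cC1 f -> ccontinuous (dbar f).
Proof.
move=> [[_ [_ [ux _] [uy _]]] [_ [_ [vx _] [vy _]]]]; split.
  by move=> p; apply: cvgB; [exact: ux|exact: vy].
by move=> p; apply: cvgD; [exact: vx|exact: uy].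
Qed.

Lemma ccontinuous_ndel f : cC1 f -> ccontinuous (ndel f).
Proof.
move=> [[_ [_ [ux _] [uy _]]] [_ [_ [vx _] [vy _]]]]; split.
  by move=> p; apply: cvgB; [apply: cvgN; exact: ux|exact: vy].
by move=> p; apply: cvgD; [apply: cvgN; exact: vx|exact: uy].
Qed.

Lemma ccontinuous_L2fun f : ccontinuous f -> (f : plane -> R[i]) \in L2fun disc.
Proof.
move=> [c1 c2]; have key (h : R * R -> R) : continuous h -> (h : plane -> R) \in Lfun disc 2%:E.
  move=> ch; apply/Lfun2P; split; first exact: continuous_plane_measurable.
  have ch2 : continuous (fun p => h p ^+ 2) by exact: (cvgMM ch ch).
  have := disc_continuous_integrable ch2.
  exact: integrable_lty.
by rewrite unfold_in; apply/andP; split; exact: key.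
Qed.

Lemma L2_of_continuous f : ccontinuous f ->
  exists x : L2D R, {ae disc, forall p, L2_fun x p = f p}.
Proof.
by move=> /ccontinuous_L2fun fL; exists (\pi_(L2 disc) (SqInt fL)); exact: L2_piE.
Qed.

Lemma drE f (q : plane) : cC1 f -> dr f q =
  (cos q.2 * 'D_(1, 0) (Re \o f) (polar q) + sin q.2 * 'D_(0, 1) (Re \o f) (polar q)) +i*
  (cos q.2 * 'D_(1, 0) (Im \o f) (polar q) + sin q.2 * 'D_(0, 1) (Im \o f) (polar q)).
Proof.
move=> [u1 v1]; case: q => r t /=.
have dk (k s : R) : is_derive s 1 (fun r : R => r * k) k.
  by apply: is_derive_eq; rewrite scaler0 add0r [_ *: _]mulr1.
have key (w : R * R -> R) : Ck 1 w -> derive1 (fun s : R => w (polar (s, t))) r =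
    cos t * 'D_(1, 0) w (polar (r, t)) + sin t * 'D_(0, 1) w (polar (r, t)).
  move=> w1; rewrite derive1E.
  by have [_ E] := @Ck1_curve _ w (fun r => r * cos t) (fun r => r * sin t) _ _ _ w1 (dk _ r) (dk _ r).
by rewrite /dr /cderive1 -(key _ u1) -(key _ v1).
Qed.

Lemma dthetaE f (q : plane) : cC1 f -> dtheta f q =
  (q.1 * (- sin q.2 * 'D_(1, 0) (Re \o f) (polar q) + cos q.2 * 'D_(0, 1) (Re \o f) (polar q))) +i*
  (q.1 * (- sin q.2 * 'D_(1, 0) (Im \o f) (polar q) + cos q.2 * 'D_(0, 1) (Im \o f) (polar q))).
Proof.
move=> [u1 v1]; case: q => r t /=.
have key (w : R * R -> R) : Ck 1 w -> derive1 (fun s : R => w (polar (r, s))) t =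
    r * (- sin t * 'D_(1, 0) w (polar (r, t)) + cos t * 'D_(0, 1) w (polar (r, t))).
  move=> w1; rewrite derive1E.
  have [_ E] := @Ck1_curve _ w (fun s => r * cos s) (fun s => r * sin s) t (r * - sin t) (r * cos t) w1 _ _.
  by rewrite mulrDr !mulrA.
by rewrite /dtheta /cderive1 -(key _ u1) -(key _ v1).
Qed.

Lemma polar_dbar f (q : plane) : cC1 f -> q.1 != 0 ->
  expi q.2 * (dr f q + 'i * (q.1^-1)%:C * dtheta f q) = dbar f (polar q).
Proof.
move=> f1 q0; rewrite drE// dthetaE// /dbar /expi -complexiE.
set ux := 'D_(1, 0) (Re \o f) (polar q); set uy := 'D_(0, 1) (Re \o f) (polar q).
set vx := 'D_(1, 0) (Im \o f) (polar q); set vy := 'D_(0, 1) (Im \o f) (polar q).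
have := cos2Dsin2 q.2; move: (cos q.2) (sin q.2) q.1 q0 ux uy vx vy.
move=> c s r r0 ux uy vx vy cs; simpc; rewrite !(mulKf r0).
rewrite -[ux - vy]mul1r -[vx + uy]mul1r -cs; congr (_ +i* _).
  by move: ux uy vx vy => ux uy vx vy; ring.
by move: ux uy vx vy => ux uy vx vy; ring.
Qed.

Lemma polar_ndel f (q : plane) : cC1 f -> q.1 != 0 ->
  expi (- q.2) * (- dr f q + 'i * (q.1^-1)%:C * dtheta f q) = ndel f (polar q).
Proof.
move=> f1 q0; rewrite drE// dthetaE// /ndel /expi -complexiE cosN sinN.
set ux := 'D_(1, 0) (Re \o f) (polar q); set uy := 'D_(0, 1) (Re \o f) (polar q).
set vx := 'D_(1, 0) (Im \o f) (polar q); set vy := 'D_(0, 1) (Im \o f) (polar q).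
have := cos2Dsin2 q.2; move: (cos q.2) (sin q.2) q.1 q0 ux uy vx vy.
move=> c s r r0 ux uy vx vy cs; simpc; rewrite !(mulKf r0).
rewrite -[- ux - vy]mul1r -[- vx + uy]mul1r -cs; congr (_ +i* _).
  by move: ux uy vx vy => ux uy vx vy; ring.
by move: ux uy vx vy => ux uy vx vy; ring.
Qed.

Lemma measurable_neq_fun (x y : plane -> R[i]) :
  measurable_fun setT (Re \o x) -> measurable_fun setT (Im \o x) ->
  measurable_fun setT (Re \o y) -> measurable_fun setT (Im \o y) ->
  measurable [set p | x p <> y p].
Proof.
move=> x1 x2 y1 y2.
have key (g h : plane -> R) : measurable_fun setT g -> measurable_fun setT h ->
    measurable [set p | g p <> h p].
  move=> mg mh; have mgh : measurable_fun setT (fun p => g p - h p) by exact: measurable_funB.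
  have -> : [set p | g p <> h p] = ~` ((fun p => g p - h p) @^-1` [set 0]).
    apply/seteqP; split=> p /= gh; last by move=> E; apply: gh; rewrite E subrr.
    by move=> /eqP; rewrite subr_eq0 => /eqP.
  apply: measurableC; rewrite -[X in measurable X]setTI.
  by apply: mgh => //; exact: measurable_set1.
have -> : [set p | x p <> y p] =
    [set p | Re (x p) <> Re (y p)] `|` [set p | Im (x p) <> Im (y p)].
  apply/seteqP; split=> p /= xy; last by move: xy => [xy|xy] E; apply: xy; rewrite E.
  have [h1|h1] := pselect (Re (x p) = Re (y p)); last by left.
  right=> h2; apply: xy; move: h1 h2; case: (x p) => a b; case: (y p) => c d /=.
  by move=> -> ->.
by apply: measurableU; exact: key.
Qed.

Lemma L2_measurable (x : L2D R) :
  measurable_fun setT (Re \o L2_fun x) /\ measurable_fun setT (Im \o L2_fun x).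
Proof. by have /andP[/Lfun2P[m1 _] /Lfun2P[m2 _]] := L2_inP x. Qed.

Lemma ccontinuous_measurable f : ccontinuous f ->
  measurable_fun setT (Re \o f : plane -> R) /\ measurable_fun setT (Im \o f : plane -> R).
Proof. by move=> [c1 c2]; split; exact: continuous_plane_measurable. Qed.

(** The measure on the disc is the image of the polar one, so a property of
    points of the plane has the same null sets on both sides as soon as the
    exceptional set is measurable. *)
Lemma ae_polar_discP (x : L2D R) f : ccontinuous f ->
  {ae parea, forall q, L2_fun x (polar q) = f (polar q)} <->
  {ae disc, forall p, L2_fun x p = f p}.
Proof.
move=> cf; have [x1 x2] := L2_measurable x; have [f1 f2] := ccontinuous_measurable cf.
have mN := measurable_neq_fun x1 x2 f1 f2.
have mp (N : set plane) : measurable N -> measurable (@polar R @^-1` N).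
  by move=> mN'; rewrite -[X in measurable X]setTI; exact: measurable_polar.
split=> [[N [mN' N0 HN]]|[N [mN' N0 HN]]].
  exists [set p | L2_fun x p <> f p]; split => //.
  apply/eqP; rewrite eq_le measure_ge0 andbT -N0 /disc_measure /pushforward.
  by apply: le_measure; rewrite ?inE; [exact: (mp _ mN)|exact: mN'|move=> q /= h; exact: HN].
exists (@polar R @^-1` N); split => //; first exact: mp.
by move=> q /= h; exact: HN.
Qed.

Lemma ae_radius_neq0 : {ae parea, forall q, q.1 != 0}.
Proof.
have m0 : measurable [set q : plane | q.1 = 0].
  have := @measurable_fst _ _ (measurableTypeR R) (measurableTypeR R) measurableT [set 0] (measurable_set1 0).
  by rewrite setTI.
exists [set q : plane | q.1 = 0]; split => //.
  by apply: (@polar_null _ _ 0 m0) => q _.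
by move=> q /= /negP; rewrite negbK => /eqP.
Qed.

Lemma polar_ae2 (P Q S : plane -> Prop) : (forall q, P q -> Q q -> S q) ->
  {ae parea, forall q, P q} -> {ae parea, forall q, Q q} -> {ae parea, forall q, S q}.
Proof.
have FF := ae_filter_ringOfSetsType (parea : {measure set plane -> \bar R}).
exact: filterS2.
Qed.

Lemma Dplus0P (z : L2D R * L2D R) : Dplus0 R z <-> exists f, [/\ Cc_smooth f,
  {ae disc, forall p, L2_fun z.1 p = f p} & {ae disc, forall p, L2_fun z.2 p = dbar f p}].
Proof.
split=> -[f [fC zf zd]]; exists f; have [fs _ _] := fC;
  have f1 := csmooth_C1 fs; split => //; have cd := ccontinuous_dbar f1.
  apply/(ae_polar_discP _ cd); apply: polar_ae2 ae_radius_neq0 zd => q q0 ->.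
  exact: polar_dbar.
move/(ae_polar_discP _ cd) in zd; apply: polar_ae2 ae_radius_neq0 zd => q q0 ->.
by rewrite polar_dbar.
Qed.

Lemma Dminus0P (z : L2D R * L2D R) : Dminus0 R z <-> exists f, [/\ Cc_smooth f,
  {ae disc, forall p, L2_fun z.1 p = f p} & {ae disc, forall p, L2_fun z.2 p = ndel f p}].
Proof.
split=> -[f [fC zf zd]]; exists f; have [fs _ _] := fC;
  have f1 := csmooth_C1 fs; split => //; have cd := ccontinuous_ndel f1.
  apply/(ae_polar_discP _ cd); apply: polar_ae2 ae_radius_neq0 zd => q q0 ->.
  exact: polar_ndel.
move/(ae_polar_discP _ cd) in zd; apply: polar_ae2 ae_radius_neq0 zd => q q0 ->.
by rewrite polar_ndel.
Qed.

End DiracOperators.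

(** * Formal adjointness of the Dirac operators *)

Section DiracDomain.
Context (R : realType).
Local Notation plane := (measurableTypeR R * measurableTypeR R)%type.
Local Notation disc := (@disc_measure R).
Implicit Types (f g : R * R -> R[i]) (p v : R * R).

Lemma disc_ae1 (P Q : plane -> Prop) : (forall p, P p -> Q p) ->
  {ae disc, forall p, P p} -> {ae disc, forall p, Q p}.
Proof.
have FF := ae_filter_ringOfSetsType (disc : {measure set plane -> \bar R}).
exact: filterS.
Qed.

Lemma disc_ae2 (P Q S : plane -> Prop) : (forall p, P p -> Q p -> S p) ->
  {ae disc, forall p, P p} -> {ae disc, forall p, Q p} -> {ae disc, forall p, S p}.
Proof.
have FF := ae_filter_ringOfSetsType (disc : {measure set plane -> \bar R}).
exact: filterS2.
Qed.

Local Notation Re := (@complex.Re R).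
Local Notation Im := (@complex.Im R).

Lemma derive_lincomb (u v s : R * R -> R) (a b : R) p e :
  derivable u p e -> derivable v p e -> derivable s p e ->
  'D_e (fun q => a * u q + b * v q + s q) p = a * 'D_e u p + b * 'D_e v p + 'D_e s p.
Proof.
move=> du dv ds.
have [_ E] := is_deriveD (is_deriveD (is_deriveZ a (derivableP du)) (is_deriveZ b (derivableP dv))) (derivableP ds).
exact: E.
Qed.

Lemma derive_sum_prod (u v s t : R * R -> R) (b : R) p e :
  derivable u p e -> derivable v p e -> derivable s p e -> derivable t p e ->
  'D_e (fun q => u q * s q + b * (v q * t q)) p =
  (u p * 'D_e s p + s p * 'D_e u p) + b * (v p * 'D_e t p + t p * 'D_e v p).
Proof.
move=> du dv ds dt.
have [_ E] := is_deriveD (is_deriveM (derivableP du) (derivableP ds))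
  (is_deriveZ b (is_deriveM (derivableP dv) (derivableP dt))).
exact: E.
Qed.

Section Lincomb.
Variables (c : R[i]) (f g : R * R -> R[i]).
Let h p := c * f p + g p.

Lemma Re_lincomb : Re \o h =
  (fun p => Re c * Re (f p) + - Im c * Im (f p) + Re (g p)).
Proof.
apply/funext => p; rewrite /h /=; case: c => a b; case: (f p) => u v; case: (g p) => s t /=.
by ring.
Qed.

Lemma Im_lincomb : Im \o h =
  (fun p => Re c * Im (f p) + Im c * Re (f p) + Im (g p)).
Proof.
apply/funext => p; rewrite /h /=; case: c => a b; case: (f p) => u v; case: (g p) => s t /=.
by ring.
Qed.

Lemma csmooth_lincomb : csmooth f -> csmooth g -> csmooth h.
Proof.
move=> fs gs k; rewrite Re_lincomb Im_lincomb; have [f1 f2] := fs k; have [g1 g2] := gs k.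
by split; apply: CkD => //; apply: CkD; apply: CkZ.
Qed.

Lemma Cc_lincomb : Cc_smooth f -> Cc_smooth g -> Cc_smooth h.
Proof.
move=> [fs fc fo] [gs gc go].
have sub : closure [set p | h p != 0] `<=` closure [set p | f p != 0] `|` closure [set p | g p != 0].
  rewrite -closureU; apply: closure_subset => p /=; rewrite /h.
  have [->|] := eqVneq (f p) 0; last by left.
  by rewrite mulr0 add0r; right.
split; first exact: csmooth_lincomb.
  apply: subclosed_compact sub; first exact: closed_closure.
  exact: compactU.
by move=> p /sub[/fo|/go].
Qed.

Lemma derivable_cC1 (w : R * R -> R[i]) p : cC1 w ->
  [/\ derivable (Re \o w) p (1, 0), derivable (Re \o w) p (0, 1),
      derivable (Im \o w) p (1, 0) & derivable (Im \o w) p (0, 1)].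
Proof.
by move=> [[_ [dw _ _]] [_ [dw' _ _]]]; have [? ?] := dw p; have [? ?] := dw' p.
Qed.

Lemma dbar_lincomb p : cC1 f -> cC1 g -> dbar h p = c * dbar f p + dbar g p.
Proof.
move=> /(@derivable_cC1 _ p)[f1 f2 f3 f4] /(@derivable_cC1 _ p)[g1 g2 g3 g4].
rewrite /dbar Re_lincomb Im_lincomb.
rewrite (derive_lincomb _ _ f1 f3 g1) (derive_lincomb _ _ f2 f4 g2).
rewrite (derive_lincomb _ _ f3 f1 g3) (derive_lincomb _ _ f4 f2 g4).
by case: c => a b; simpc => /=; congr (_ +i* _); ring.
Qed.

Lemma ndel_lincomb p : cC1 f -> cC1 g -> ndel h p = c * ndel f p + ndel g p.
Proof.
move=> /(@derivable_cC1 _ p)[f1 f2 f3 f4] /(@derivable_cC1 _ p)[g1 g2 g3 g4].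
rewrite /ndel Re_lincomb Im_lincomb.
rewrite (derive_lincomb _ _ f1 f3 g1) (derive_lincomb _ _ f2 f4 g2).
rewrite (derive_lincomb _ _ f3 f1 g3) (derive_lincomb _ _ f4 f2 g4).
by case: c => a b; simpc => /=; congr (_ +i* _); ring.
Qed.

End Lincomb.

Lemma Cc_zero : Cc_smooth (fun=> 0 : R[i]).
Proof.
have -> : (fun=> 0 : R[i]) = (fun p : R * R => (quadrant_bump 0 0 0 p)%:C).
  apply/funext => p; rewrite (_ : quadrant_bump 0 0 0 p = 0)//.
  by apply/eqP/negP => /negP /quadrant_bump_supp[].
exact: Cc_quadrant_bump.
Qed.

Lemma dbar_zero p : dbar (fun=> 0) p = 0.
Proof. by rewrite /dbar !derive_cst subrr addr0. Qed.

Lemma ndel_zero p : ndel (fun=> 0) p = 0.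
Proof. by rewrite /ndel !derive_cst subr0 oppr0 addr0. Qed.

Lemma Dplus0_lin : lin_rel (Dplus0 R).
Proof.
split.
  apply/Dplus0P; exists (fun=> 0); split; [exact: Cc_zero|exact: L20E|].
  by apply: disc_ae1 (L20E disc) => p ->; rewrite dbar_zero.
move=> c x x' y y' /Dplus0P[f [fC /= xf yf]] /Dplus0P[g [gC /= xg yg]].
apply/Dplus0P; exists (fun p => c * f p + g p); split; first exact: Cc_lincomb.
- have h1 := disc_ae2 (fun p => @conj _ _) (L2DE (c *: x) x') (L2ZE c x).
  have h2 := disc_ae2 (fun p => @conj _ _) xf xg.
  by apply: disc_ae2 h1 h2 => p [-> ->] [-> ->].
- have h1 := disc_ae2 (fun p => @conj _ _) (L2DE (c *: y) y') (L2ZE c y).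
  have h2 := disc_ae2 (fun p => @conj _ _) yf yg.
  have [fs _ _] := fC; have [gs _ _] := gC.
  apply: disc_ae2 h1 h2 => p [-> ->] [-> ->]; rewrite dbar_lincomb//; exact: csmooth_C1.
Qed.

Lemma Dminus0_lin : lin_rel (Dminus0 R).
Proof.
split.
  apply/Dminus0P; exists (fun=> 0); split; [exact: Cc_zero|exact: L20E|].
  by apply: disc_ae1 (L20E disc) => p ->; rewrite ndel_zero.
move=> c x x' y y' /Dminus0P[f [fC /= xf yf]] /Dminus0P[g [gC /= xg yg]].
apply/Dminus0P; exists (fun p => c * f p + g p); split; first exact: Cc_lincomb.
- have h1 := disc_ae2 (fun p => @conj _ _) (L2DE (c *: x) x') (L2ZE c x).
  have h2 := disc_ae2 (fun p => @conj _ _) xf xg.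
  by apply: disc_ae2 h1 h2 => p [-> ->] [-> ->].
- have h1 := disc_ae2 (fun p => @conj _ _) (L2DE (c *: y) y') (L2ZE c y).
  have h2 := disc_ae2 (fun p => @conj _ _) yf yg.
  have [fs _ _] := fC; have [gs _ _] := gC.
  apply: disc_ae2 h1 h2 => p [-> ->] [-> ->]; rewrite ndel_lincomb//; exact: csmooth_C1.
Qed.

Lemma Cc_circle f p : Cc_smooth f -> p.1 ^+ 2 + p.2 ^+ 2 = 1 -> f p = 0.
Proof.
move=> [_ _ fo] p1; apply/eqP/negP => /negP fp.
by have := fo p (@subset_closure _ [set p | f p != 0] p fp); rewrite /open_disc/= p1 ltxx.
Qed.

Lemma inner_continuous (x y : L2D R) f g : ccontinuous f -> ccontinuous g ->
  {ae disc, forall p, L2_fun x p = f p} -> {ae disc, forall p, L2_fun y p = g p} ->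
  inner x y = cintegral disc (fun p => f p * (g p)^*).
Proof.
move=> cf cg xf yg; apply: cintegral_ae.
- exact: (L2fun_cintegrable (L2_inP x) (L2_inP y)).
- exact: (L2fun_cintegrable (ccontinuous_L2fun cf) (ccontinuous_L2fun cg)).
- by apply: disc_ae2 xf yg => p -> ->.
Qed.

Lemma disc_Rintegral0 (h k : R * R -> R) : Ck 1 h -> Ck 1 k ->
  (forall p, p.1 ^+ 2 + p.2 ^+ 2 = 1 -> h p = 0) ->
  (forall p, p.1 ^+ 2 + p.2 ^+ 2 = 1 -> k p = 0) ->
  \int[disc]_p ('D_(1, 0) h p + 'D_(0, 1) k p) = 0.
Proof.
move=> h1 k1 h0 k0; have [_ [_ [chx _] _]] := h1; have [_ [_ _ [cky _]]] := k1.
rewrite RintegralD//; [|exact: disc_continuous_integrable|exact: disc_continuous_integrable].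
have [e1 _] := mean_derive_zero h1 h0; have [_ e2] := mean_derive_zero k1 k0.
by rewrite /Rintegral e1 e2 addr0.
Qed.

(** The function dbar f g^* - f (ndel g)^* equals dbar applied to f g^*, which
    vanishes on the circle as soon as f does. *)
Lemma dbar_adjoint f g (x y u v : L2D R) : Cc_smooth f -> csmooth g ->
  {ae disc, forall p, L2_fun x p = f p} -> {ae disc, forall p, L2_fun y p = dbar f p} ->
  {ae disc, forall p, L2_fun u p = g p} -> {ae disc, forall p, L2_fun v p = ndel g p} ->
  inner y u = inner x v.
Proof.
move=> fC gs xf yf ug vg; have [fs _ _] := fC.
have f1 := csmooth_C1 fs; have g1 := csmooth_C1 gs.
rewrite (inner_continuous (ccontinuous_dbar f1) (cC1_continuous g1) yf ug).
rewrite (inner_continuous (cC1_continuous f1) (ccontinuous_ndel g1) xf vg).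
have i1 := L2fun_cintegrable (ccontinuous_L2fun (ccontinuous_dbar f1)) (ccontinuous_L2fun (cC1_continuous g1)).
have i2 := L2fun_cintegrable (ccontinuous_L2fun (cC1_continuous f1)) (ccontinuous_L2fun (ccontinuous_ndel g1)).
apply/eqP; rewrite -subr_eq0 addrC -mulN1r; have [_ <-] := cintegral_lin (-1) i2 i1.
have [[u1 v1] [s1 t1]] := (f1, g1).
(* With f g^* = w1 + i w2, the integrand is (d_x + i d_y) (f g^* ). *)
pose w1 p := Re (f p) * Re (g p) + 1 * (Im (f p) * Im (g p)).
pose w2 p := Im (f p) * Re (g p) + (-1) * (Re (f p) * Im (g p)).
have w11 : Ck 1 w1 by apply: CkD; [exact: (CkM u1 s1)|exact: (CkZ 1 (CkM v1 t1))].
have w21 : Ck 1 w2 by apply: CkD; [exact: (CkM v1 s1)|exact: (CkZ (-1) (CkM u1 t1))].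
have Nw21 : Ck 1 (fun p => - w2 p) by exact: CkN.
have w10 p : p.1 ^+ 2 + p.2 ^+ 2 = 1 -> w1 p = 0.
  by move=> /(Cc_circle fC); rewrite /w1 => ->; rewrite !mul0r mulr0 addr0.
have w20 p : p.1 ^+ 2 + p.2 ^+ 2 = 1 -> w2 p = 0.
  by move=> /(Cc_circle fC); rewrite /w2 => ->; rewrite !mul0r mulr0 addr0.
have Nw20 p : p.1 ^+ 2 + p.2 ^+ 2 = 1 -> - w2 p = 0 by move=> /w20 ->; rewrite oppr0.
have DN p : 'D_(0, 1) (fun p => - w2 p) p = - 'D_(0, 1) w2 p.
  by have [_ [dw _ _]] := w21; have [_ d] := dw p; exact: (deriveN d).
have pw p : -1 * (f p * (ndel g p)^*) + dbar f p * (g p)^* =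
    ('D_(1, 0) w1 p + 'D_(0, 1) (fun p => - w2 p) p) +i* ('D_(1, 0) w2 p + 'D_(0, 1) w1 p).
  have [a1 a2 a3 a4] := derivable_cC1 p f1; have [b1 b2 b3 b4] := derivable_cC1 p g1.
  rewrite DN (derive_sum_prod 1 a1 a3 b1 b3) (derive_sum_prod 1 a2 a4 b2 b4).
  rewrite (derive_sum_prod (-1) a3 a1 b1 b3) (derive_sum_prod (-1) a4 a2 b2 b4).
  rewrite /dbar /ndel /=; case: (f p) => fu fv; case: (g p) => gu gv.
  by simpc => /=; congr (_ +i* _); ring.
rewrite /cintegral; under eq_Rintegral do rewrite pw /=.
rewrite disc_Rintegral0//; under eq_Rintegral do rewrite pw /=.
by rewrite disc_Rintegral0.
Qed.

End DiracDomain.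

(** * Density of the test functions, and antiholomorphic polynomials *)

Section DensityKernel.
Context (R : realType).
Local Notation plane := (measurableTypeR R * measurableTypeR R)%type.
Local Notation disc := (@disc_measure R).
Implicit Types (f g : R * R -> R[i]) (p v : R * R).
Local Notation Re := (@complex.Re R).
Local Notation Im := (@complex.Im R).

Lemma ccontinuous_real (h : R * R -> R) : continuous h -> ccontinuous (fun p => (h p)%:C).
Proof. by move=> ch; split => //; move=> p; exact: cvg_cst. Qed.

(** Only the bumps are used as test functions: they are real, so the real and
    imaginary parts of x can be treated one at a time. *)
Lemma L2_orthogonal_bumps (x : L2D R) :
  (forall f (y : L2D R), Cc_smooth f -> {ae disc, forall p, L2_fun y p = f p} ->
    inner x y = 0) -> x = 0.
Proof.
move=> x0.
have int1 (h : plane -> R[i]) : h \in L2fun disc ->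
    disc.-integrable setT (EFin \o (Re \o h)) /\ disc.-integrable setT (EFin \o (Im \o h)).
  move=> hL; have c1 : ccontinuous (fun _ : R * R => (1 : R)%:C) by apply: (@ccontinuous_real (fun=> 1)) => p; exact: cvg_cst.
  have /andP[/Lfun1_integrable i1 /Lfun1_integrable i2] := L2fun_cintegrable hL (ccontinuous_L2fun c1).
  split.
    by apply: eq_integrable i1 => // p _; congr EFin => /=; case: (h p) => a b /=; ring.
  by apply: eq_integrable i2 => // p _; congr EFin => /=; case: (h p) => a b /=; ring.
have [ix1 ix2] := int1 _ (L2_inP x).
have bumps a c n : (\int[disc]_p (Re (L2_fun x p) * quadrant_bump a c n p)%:E = 0 /\
    \int[disc]_p (Im (L2_fun x p) * quadrant_bump a c n p)%:E = 0)%E.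
  pose b (p : R * R) := (quadrant_bump a c n p)%:C : R[i].
  have cb : ccontinuous b.
    apply: ccontinuous_real; exact: (Ck_continuous (Ck_quadrant_bump a c n 0)).
  have [y yb] := L2_of_continuous cb.
  have := x0 b y (Cc_quadrant_bump a c n) yb.
  have bL := ccontinuous_L2fun cb.
  have ixb := L2fun_cintegrable (L2_inP x) bL.
  have -> : inner x y = cintegral disc (fun p => L2_fun x p * (b p)^*).
    apply: cintegral_ae => //; first exact: (L2fun_cintegrable (L2_inP x) (L2_inP y)).
    by apply: disc_ae1 yb => p ->.
  have e1 p : Re (L2_fun x p * (b p)^*) = Re (L2_fun x p) * quadrant_bump a c n p.
    by rewrite /b; case: (L2_fun x p) => s t /=; rewrite oppr0 mulr0 subr0.
  have e2 p : Im (L2_fun x p * (b p)^*) = Im (L2_fun x p) * quadrant_bump a c n p.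
    by rewrite /b; case: (L2_fun x p) => s t /=; rewrite oppr0 mulr0 add0r.
  have /andP[/Lfun1_integrable j1 /Lfun1_integrable j2] := ixb.
  have k1 : disc.-integrable setT (fun p => (Re (L2_fun x p) * quadrant_bump a c n p)%:E).
    by apply: eq_integrable j1 => // p _; rewrite /= e1.
  have k2 : disc.-integrable setT (fun p => (Im (L2_fun x p) * quadrant_bump a c n p)%:E).
    by apply: eq_integrable j2 => // p _; rewrite /= e2.
  rewrite /cintegral; under eq_Rintegral do rewrite e1.
  under [X in _ +i* X]eq_Rintegral do rewrite e2.
  move=> /eqP; rewrite eq_complex /= => /andP[/eqP r1 /eqP r2].
  have fin1 := integrable_fin_num measurableT k1.
  have fin2 := integrable_fin_num measurableT k2.
  by split; apply/eqP; rewrite -fine_eq0//; apply/eqP.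
have z1 := ae0_of_bumps ix1 (fun a c n => (bumps a c n).1).
have z2 := ae0_of_bumps ix2 (fun a c n => (bumps a c n).2).
apply/L2_eqP; apply: disc_ae2 (disc_ae2 (fun p => @conj _ _) z1 z2) (L20E disc).
by move=> p [/= h1 h2] ->; move: h1 h2; case: (L2_fun x p) => s t /= -> ->.
Qed.

Lemma Cc_dense (V : set (L2D R)) : submod V ->
  (forall f (y : L2D R), Cc_smooth f -> {ae disc, forall p, L2_fun y p = f p} -> V y) ->
  forall x, adherent V x.
Proof.
move=> Vs VC; apply: dense_of_orthogonal => // x xV.
by apply: L2_orthogonal_bumps => f y fC yf; apply: xV; exact: VC yf.
Qed.

Lemma dom_submod (H1 H2 : hilbertType R) (T : set (H1 * H2)) : lin_rel T -> submod (dom T).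
Proof.
move=> [T0 TL]; split; first by exists 0.
by move=> c x y [x' Tx] [y' Ty]; exists (c *: x' + y'); exact: TL.
Qed.

Lemma Dplus0_dense (x : L2D R) : adherent (dom (Dplus0 R)) x.
Proof.
apply: Cc_dense; first exact/dom_submod/Dplus0_lin.
move=> f y fC yf; have [fs _ _] := fC.
have [w wf] := L2_of_continuous (ccontinuous_dbar (csmooth_C1 fs)).
by exists w; apply/Dplus0P; exists f.
Qed.

Lemma Dminus0_dense (x : L2D R) : adherent (dom (Dminus0 R)) x.
Proof.
apply: Cc_dense; first exact/dom_submod/Dminus0_lin.
move=> f y fC yf; have [fs _ _] := fC.
have [w wf] := L2_of_continuous (ccontinuous_ndel (csmooth_C1 fs)).
by exists w; apply/Dminus0P; exists f.
Qed.

Lemma Dminus0_adjoint : Dminus0 R `<=` adjoint (Dplus0 R).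
Proof.
move=> [u v] /Dminus0P[g [[gs _ _] /= ug vg]] x y /Dplus0P[f [fC /= xf yf]] /=.
exact: dbar_adjoint fC gs xf yf ug vg.
Qed.

Lemma Dplus0_adjoint : Dplus0 R `<=` adjoint (Dminus0 R).
Proof.
move=> [x y] Dxy u v /Dminus0_adjoint/(_ _ _ Dxy)/= h.
by rewrite (innerC x v) (innerC y u) h.
Qed.

Definition zbar (p : R * R) : R[i] := p.1 +i* - p.2.

Lemma csmoothM f g : csmooth f -> csmooth g -> csmooth (fun p => f p * g p).
Proof.
move=> fs gs k; have [f1 f2] := fs k; have [g1 g2] := gs k.
have -> : Re \o (fun p => f p * g p) = (fun p => Re (f p) * Re (g p) - Im (f p) * Im (g p)).
  by apply/funext => p /=; case: (f p) => ? ?; case: (g p).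
have -> : Im \o (fun p => f p * g p) = (fun p => Re (f p) * Im (g p) + Im (f p) * Re (g p)).
  by apply/funext => p /=; case: (f p) => ? ?; case: (g p).
split; first exact: (CkB (CkM f1 g1) (CkM f2 g2)).
exact: (CkD (CkM f1 g2) (CkM f2 g1)).
Qed.

Lemma ndelM f g p : cC1 f -> cC1 g ->
  ndel (fun p => f p * g p) p = f p * ndel g p + g p * ndel f p.
Proof.
move=> /(@derivable_cC1 _ _ p)[a1 a2 a3 a4] /(@derivable_cC1 _ _ p)[b1 b2 b3 b4].
have eR : Re \o (fun p => f p * g p) =
    (fun p => Re (f p) * Re (g p) + (-1) * (Im (f p) * Im (g p))).
  by apply/funext => q /=; case: (f q) => ? ?; case: (g q) => ? ? /=; rewrite mulN1r.
have eI : Im \o (fun p => f p * g p) =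
    (fun p => Re (f p) * Im (g p) + 1 * (Im (f p) * Re (g p))).
  by apply/funext => q /=; case: (f q) => ? ?; case: (g q) => ? ? /=; rewrite mul1r.
rewrite /ndel eR eI (derive_sum_prod (-1) a1 a3 b1 b3) (derive_sum_prod 1 a2 a4 b4 b2).
rewrite (derive_sum_prod 1 a1 a3 b3 b1) (derive_sum_prod (-1) a2 a4 b2 b4) /=.
case: (f p) => fu fv; case: (g p) => gu gv.
by simpc => /=; congr (_ +i* _); ring.
Qed.

Lemma csmooth_zbar : csmooth zbar.
Proof.
have [e1 e2] : Re \o zbar = fst /\ Im \o zbar = (fun p => - p.2) by [].
by move=> k; rewrite e1 e2; split; [exact: Ck_fst|apply: CkN; exact: Ck_snd].
Qed.

Lemma csmooth_zbarX n : csmooth (fun p => zbar p ^+ n).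
Proof.
elim: n => [|n IH]; first exact: (csmooth_real (fun k => Ck_cst k 1)).
have := csmoothM csmooth_zbar IH; congr csmooth; apply/funext => p.
by rewrite exprS.
Qed.

Lemma ndel_zbar p : ndel zbar p = 0.
Proof.
have [e1 e2] : Re \o zbar = fst /\ Im \o zbar = (fun p => - p.2) by [].
have D1 e : 'D_e (fst : R * R -> R) p = e.1 by have [_ E] := is_derive_fst p e.
have D2 e : 'D_e (fun p : R * R => - p.2) p = - e.2.
  by have [_ E] := is_deriveN (is_derive_snd p e); exact: E.
by rewrite /ndel e1 e2 !D1 !D2 /= opprK addNr oppr0 oppr0 addr0.
Qed.

Lemma ndel_zbarX n p : ndel (fun p => zbar p ^+ n) p = 0.
Proof.
elim: n => [|n IH].
  have -> : (fun p => zbar p ^+ 0) = (fun=> 1) by apply/funext => q; rewrite expr0.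
  by rewrite /ndel !derive_cst subr0 oppr0 addr0.
have -> : (fun p => zbar p ^+ n.+1) = (fun p => zbar p * zbar p ^+ n).
  by apply/funext => q; rewrite exprS.
rewrite ndelM ?ndel_zbar ?IH ?mulr0 ?addr0//; apply: csmooth_C1.
  exact: csmooth_zbar.
exact: csmooth_zbarX.
Qed.

Lemma L2_sumE n (c : 'I_n -> R[i]) (x : 'I_n -> L2D R) :
  {ae disc, forall p, L2_fun (\sum_i c i *: x i) p = \sum_i c i * L2_fun (x i) p}.
Proof.
elim: n c x => [|n IH] c x.
  by rewrite big_ord0; apply: disc_ae1 (L20E disc) => p ->; rewrite big_ord0.
rewrite big_ord_recr /=.
have h1 := disc_ae2 (fun p => @conj _ _) (L2DE (\sum_(i < n) c (widen_ord (leqnSn n) i) *: x (widen_ord (leqnSn n) i)) (c ord_max *: x ord_max)) (L2ZE (c ord_max) (x ord_max)).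
apply: disc_ae2 (IH (fun i => c (widen_ord (leqnSn n) i)) (fun i => x (widen_ord (leqnSn n) i))) h1.
by move=> p E [-> ->]; rewrite E big_ord_recr.
Qed.

(** The point with zbar = r lies on a circle, and circles are null. *)
Lemma zbar_ae_neq (r : R[i]) : {ae disc, forall p, zbar p != r}.
Proof.
have m : measurable [set p : plane | p.1 ^+ 2 + p.2 ^+ 2 = Re r ^+ 2 + Im r ^+ 2].
  by have := @measurable_sqnorm R measurableT _ (@measurable_set1 R (Re r ^+ 2 + Im r ^+ 2)); rewrite setTI.
exists [set p : plane | p.1 ^+ 2 + p.2 ^+ 2 = Re r ^+ 2 + Im r ^+ 2].
split=> //; first exact: disc_circle_null.
by move=> p /= /negP; rewrite negbK => /eqP <- /=; rewrite sqrrN.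
Qed.

(** A nonzero P splits, so zbar avoids its finitely many zeros almost everywhere;
    if P also vanished at zbar almost everywhere, the disc would be a null
    set. *)
Lemma zbar_poly_ae (P : {poly R[i]}) : {ae disc, forall p, P.[zbar p] = 0} -> P = 0.
Proof.
move=> P0; apply/eqP; apply: contraT => Pn.
have [rs PE] := closed_field_poly_normal P.
have : {ae disc, forall p, zbar p \notin rs}.
  elim: rs {PE} => [|r rs IH].
    by apply: disc_ae1 (L20E disc).
  by apply: disc_ae2 (zbar_ae_neq r) IH => p h1 h2; rewrite inE negb_or h1.
move=> /(disc_ae2 (fun p => @conj _ _) P0) h.
have : {ae disc, forall p, False}.
  apply: disc_ae1 h => p [/eqP]; rewrite -/(root P (zbar p)) PE.
  by rewrite rootZ ?lead_coef_eq0// root_prod_XsubC => ->.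
move=> [N [mN N0 HN]]; have := disc_measure_gt0 R.
rewrite ltNge -N0 le_measure// ?inE//.
by move=> p _; exact: HN.
Qed.

(** The powers of zbar are smooth up to the boundary and killed by ndel, so
    [dbar_adjoint] puts them in the kernel of the adjoint. *)
Lemma ker_infinite : infinite_dimensional (ker (adjoint (Dplus R))).
Proof.
move=> n.
have /choice[x xz] : forall i : 'I_n, exists x : L2D R, {ae disc, forall p, L2_fun x p = zbar p ^+ i}.
  move=> i; apply: L2_of_continuous; exact/cC1_continuous/csmooth_C1/csmooth_zbarX.
exists x; split.
  move=> i; rewrite /ker /Dplus /= adjoint_closure => y w /Dplus0P[f [fC /= yf wf]] /=.
  apply: (dbar_adjoint fC (csmooth_zbarX i) yf wf (xz i)).
  by apply: disc_ae1 (L20E disc) => p ->; rewrite ndel_zbarX.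
move=> c c0; pose P := rVpoly (\row_i c i).
have PE z : P.[z] = \sum_i c i * z ^+ i.
  rewrite horner_poly; apply: eq_bigr => i _; rewrite valK mxE//.
have P0 : P = 0.
  apply: zbar_poly_ae.
  have all_x : {ae disc, forall p, forall i : 'I_n, L2_fun (x i) p = zbar p ^+ i}.
    have key m : {ae disc, forall p, forall i : 'I_n, (i < m)%N -> L2_fun (x i) p = zbar p ^+ i}.
      elim: m => [|m IH]; first by apply: disc_ae1 (L20E disc).
      have [mn|mn] := ltnP m n; last first.
        apply: disc_ae1 IH => p h i _; apply: h; exact: leq_trans (ltn_ord i) mn.
      apply: disc_ae2 (xz (Ordinal mn)) IH => p h1 h2 i.
      rewrite ltnS leq_eqVlt => /orP[/eqP im|]; last exact: h2.
      by have -> : i = Ordinal mn by exact: val_inj.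
    by apply: disc_ae1 (key n) => p h i; exact: h.
  apply: disc_ae2 (disc_ae2 (fun p => @conj _ _) (L2_sumE c x) all_x) (L20E disc).
  move=> p [h1 h2] h3; rewrite PE; transitivity (L2_fun (\sum_i c i *: x i) p).
    by rewrite h1; apply: eq_bigr => i _; rewrite h2.
  by rewrite c0.
by move=> i; have := coef_rVpoly_ord (\row_i c i) i; rewrite -/P P0 coef0 mxE.
Qed.

End DensityKernel.

(** * The self-adjoint extension *)

Section Extension.
Context (R : realType).

Lemma adherentS (H : hilbertType R) (V W : set H) : V `<=` W ->
  forall x, adherent V x -> adherent W x.
Proof. by move=> VW x Vx e /Vx[v /VW Wv h]; exists v. Qed.

Lemma Dplus_operator : is_operator (Dplus R).
Proof.
apply: (@formal_adjoint_closable _ _ _ (Dplus0 R) (Dminus0 R)).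
- exact: Dplus0_lin.
- exact: Dminus0_adjoint.
- exact: Dminus0_dense.
Qed.

Lemma Dminus_operator : is_operator (Dminus R).
Proof.
apply: (@formal_adjoint_closable _ _ _ (Dminus0 R) (Dplus0 R)).
- exact: Dminus0_lin.
- exact: Dplus0_adjoint.
- exact: Dplus0_dense.
Qed.

Lemma offdiag_operator (H1 H2 : hilbertType R) (B : set (H2 * H1)) (A : set (H1 * H2)) :
  is_operator B -> is_operator A -> is_operator (offdiag B A).
Proof.
move=> [B0 BL Bf] [A0 AL Af]; split=> //.
  by move=> c [x x'] [u u'] [y y'] [w w'] [/= h1 h2] [/= h3 h4]; split; [exact: BL|exact: AL].
move=> [x x'] [y y'] [w w'] [/= h1 h2] [/= h3 h4].
by rewrite (Bf _ _ _ h1 h3) (Af _ _ _ h2 h4).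
Qed.

Lemma Dminus_sub_adjoint : Dminus R `<=` adjoint (Dplus R).
Proof.
rewrite /Dplus adjoint_closure => z /(closure_subset (@Dminus0_adjoint R)).
exact: adjoint_closed.
Qed.

Let Dext := offdiag (adjoint (Dplus R)) (Dplus R).

Lemma Dext_self_adjoint : self_adjoint Dext.
Proof.
apply: offdiag_self_adjoint.
- exact: Dplus_operator.
- by move=> z; have /closure_id <- := @closed_closure _ (Dplus0 R).
- move=> x; apply: adherentS (@Dplus0_dense R x) => y [w Dyw]; exists w.
  exact: (@subset_closure _ (Dplus0 R) (y, w) Dyw).
- move=> x; apply: adherentS (@Dminus0_dense R x) => y [w Dyw]; exists w.
  rewrite /Dplus adjoint_closure; exact: Dminus0_adjoint.
Qed.

Lemma ker_submod (H : hilbertType R) (T : set (H * H)) : lin_rel T -> submod (ker T).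
Proof.
move=> [T0 TL]; split=> // c x y Tx Ty.
by have := TL c _ _ _ _ Tx Ty; rewrite scaler0 addr0.
Qed.

Lemma Dext_ker_infinite : infinite_dimensional (ker Dext).
Proof.
move=> n; have [x [xk xf]] := @ker_infinite R n.
have [D0 _ _] := Dplus_operator.
exists (fun i => ((0, x i) : hsum (L2D R) (L2D R))); split; first by move=> i; split => //=; exact: xk.
move=> c c0; apply: xf.
have snd_sum : (\sum_i c i *: ((0, x i) : hsum (L2D R) (L2D R))).2 = \sum_i c i *: x i.
  by apply: (big_morph (fun z : hsum (L2D R) (L2D R) => z.2)).
by rewrite -snd_sum c0.
Qed.

Lemma infinite_dimensional_neq0 (H : hilbertType R) (V : set H) :
  infinite_dimensional V -> exists2 x, V x & x != 0.
Proof.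
move=> /(_ 1%N)[v [Vv vf]]; exists (v ord0) => //; apply/eqP => v0.
have := vf (fun=> 1); rewrite big_ord1 v0 scaler0 => /(_ erefl ord0)/eqP.
by rewrite oner_eq0.
Qed.

(** On the kernel of T the equation (T - z) x = y reads x = - y / z. *)
Lemma resolvent_not_compact (H : hilbertType R) (T : set (H * H)) z S :
  lin_rel T -> infinite_dimensional (ker T) -> is_resolvent T z S -> ~ compact_op S.
Proof.
move=> TL Ti [[SL _] SP].
have Sk x : ker T x -> S (- (z *: x)) = x by move=> Tx; apply/SP; rewrite addNr.
have z0 : z != 0.
  apply/eqP => z0; have [x Tx /eqP[]] := infinite_dimensional_neq0 Ti.
  by rewrite -(Sk x Tx) z0 scale0r oppr0 (lmap0 SL).
apply: (@compact_not_scalar R H S (ker T) (- z^-1)) => //.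
- exact: ker_submod.
- by rewrite oppr_eq0 invr_eq0.
move=> x Tx; rewrite -[in RHS](Sk x Tx) (lmapN SL) (lmapZ SL).
by rewrite scaleNr scalerN opprK scalerA mulVf// scale1r.
Qed.

Lemma identity_not_compact (H : hilbertType R) (V : set H) (A : H -> H) :
  submod V -> infinite_dimensional V -> (forall x, V x -> A x = x) -> ~ compact_op A.
Proof.
move=> Vs Vi AV; apply: (@compact_not_scalar R H A V 1) => //.
by move=> x Vx; rewrite scale1r AV.
Qed.

Lemma mulop2_1 (x : hsum (L2D R) (L2D R)) : mulop2 (fun=> 1) x = x.
Proof.
have m1 (y : L2D R) : mulop (fun=> 1) y = y.
  apply/L2_eqP; rewrite /mulop; set A := [set _ | _].
  have Ay : A y by apply: aeW => p; rewrite mul1r.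
  have := @xgetPex _ 0 A (ex_intro _ y Ay).
  by apply: disc_ae1 => p ->; rewrite mul1r.
by rewrite /mulop2 !m1; case: x.
Qed.

End Extension.

Theorem mainTheorem3 (R : realType) :
  let D := offdiag (Dminus R) (Dplus R) in
  let Dext := offdiag (adjoint (Dplus R)) (Dplus R) in
  let F := bounded_transform Dext in
  (* D is the minimal closed extension of the Dirac operator *)
  (D = closure (offdiag (Dminus0 R) (Dplus0 R)) /\ is_operator D) /\
  (* Dext is a self-adjoint extension of D *)
  (D `<=` Dext /\ self_adjoint Dext) /\
  infinite_dimensional (ker Dext) /\
  ((exists z S, is_resolvent Dext z S) /\
   (forall z S, is_resolvent Dext z S -> ~ compact_op S)) /\
  ~ spectral_triple (smooth_algebra R) Dext /\
  (* F = Dext (1 + Dext^2)^(-1/2) is an everywhere defined bounded operator *)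
  (is_inv_sqrt_one_plus_sq Dext (inv_sqrt_one_plus_sq Dext) /\
   (forall x, Dext (inv_sqrt_one_plus_sq Dext x, F x)) /\
   bounded_op F) /\
  ~ compact_op (fun x => x - F (F x)) /\
  ~ fredholm_module (continuous_algebra R) F.
Proof.
move=> D Dext F.
have sa : self_adjoint Dext by exact: Dext_self_adjoint.
have inf : infinite_dimensional (ker Dext) by exact: Dext_ker_infinite.
have lin := sa_lin sa; have ks := ker_submod lin.
have FF x : ker Dext x -> x - F (F x) = x.
  move=> kx; have [FL _] := transform_bounded sa.
  by rewrite /F (transform_ker sa kx) (lmap0 FL) subr0.
split; first by split; [exact: offdiag_closure|exact: offdiag_operator (@Dminus_operator R) (@Dplus_operator R)].
split.
  by split=> // z [z1 z2]; split => //; exact: Dminus_sub_adjoint.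
split=> //.
split.
  by split; [exact: sa_has_resolvent|move=> z S; exact: resolvent_not_compact].
split.
  move=> [_ _ /(_ (mulop2 (fun=> 1)))[]].
    by exists (fun=> 1) => //; exact: (csmooth_real (fun k => Ck_cst k 1)).
  move=> _ _; apply: (identity_not_compact ks inf) => x kx.
  by rewrite /= (inv_sqrt_ker sa kx) mulop2_1.
split.
  split; first exact: inv_sqrtP.
  by split; [exact: transformP|exact: transform_bounded].
split; first exact: (identity_not_compact ks inf FF).
move=> [_ _ /(_ (mulop2 (fun=> 1)))[]].
  exists (fun=> 1) => //; split; apply: continuous_subspaceT => p; exact: cvg_cst.
move=> _ + _; apply: (identity_not_compact ks inf) => x kx.
by rewrite mulop2_1 FF.
Qed.
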